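(* Let $\sigma:\mathbb{R}\to\mathbb{R}$ be Lipschitz continuous, and let $w$ and $G$ satisfy Hypotheses H1 and H2 (stated in the context). Then the equation $$\mathcal{L}u(t,x)=\sigma(u(t,x))\dot{L}(t,x),\quad t\in[0,T],\ x\in\mathbb{R},$$ with the given deterministic initial conditions (understood in the mild sense described in the context) has a unique solution $u=\{u(t,x);t\in[0,T],x\in\mathbb{R}\}$ which is $L^2(\Omega)$-continuous (i.e. $(t,x)\mapsto u(t,x)\in L^2(\Omega)$ is continuous on $[0,T]\times\mathbb{R}$) and satisfies $$\sup_{(t,x)\in[0,T]\times\mathbb{R}}E|u(t,x)|^2<\infty.$$ Uniqueness means that any two such solutions $u,u'$ satisfy $u(t,x)=u'(t,x)$ a.s. for every $(t,x)\in[0,T]\times\mathbb{R}$.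
   Context: Noise. Fix $T>0$, let $\mathbb{R}_0=\mathbb{R}\setminus\{0\}$ and $U=[0,T]\times\mathbb{R}\times\mathbb{R}_0$ with its Borel $\sigma$-field. Let $\nu$ be a Lévy measure on $\mathbb{R}_0$, i.e. $\int_{\mathbb{R}_0}(1\wedge|z|^2)\,\nu(dz)<\infty$, such that in addition $v:=\int_{\mathbb{R}_0}z^2\,\nu(dz)<\infty$. Let $N$ be a Poisson random measure on $U$ with intensity $\mu=dt\,dx\,\nu(dz)$, defined on a complete probability space $(\Omega,\mathcal{F},P)$, and let $\widehat N(A)=N(A)-\mu(A)$ (for Borel $A\subset U$ with $\mu(A)<\infty$) be the compensated measure. Let $\mathcal{B}_b(\mathbb{R})$ be the class of bounded Borel sets in $\mathbb{R}$. The Lévy white noise is $L=\{L_t(B);t\in[0,T],B\in\mathcal{B}_b(\mathbb{R})\}$ with $L_t(B)=\int_0^t\int_B\int_{\mathbb{R}_0}z\,\widehat N(ds,dx,dz)$; $\dot L$ denotes its formal derivative. $\mathcal{F}^L_t$ is the $\sigma$-field generated by $L_s(B)$, $s\in[0,t]$, $B\in\mathcal{B}_b(\mathbb{R})$. Random variables that are a.s. equal are identified. Predictability and integral. A process $X=\{X(t,x)\}$ is predictable if it is measurable with respect to the $\sigma$-field generated by processes $Y(\omega)1_{(a,b]}(t)1_A(x)$ with $0<a<b$, $Y$ bounded and $\mathcal{F}^L_a$-measurable, $A\in\mathcal{B}_b(\mathbb{R})$. For predictable $X$ with $E\int_0^T\int_{\mathbb{R}}|X(t,x)|^2dxdt<\infty$,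 the Itô integral $\int_0^T\int_{\mathbb{R}}X(t,x)L(dt,dx)=\int_0^T\int_{\mathbb{R}}\int_{\mathbb{R}_0}X(t,x)z\,\widehat N(dt,dx,dz)$ is defined and satisfies $E|\int_0^T\int_{\mathbb{R}} X\,dL|^2=vE\int_0^T\int_{\mathbb{R}}|X(t,x)|^2dxdt$. Equation. $\mathcal{L}$ is a second-order differential operator, $w$ is the (deterministic) solution on $[0,T]\times\mathbb{R}$ of $\mathcal{L}u=0$ with the given deterministic initial conditions, and $G$ is the Green function of $\mathcal{L}$ on $\mathbb{R}_+\times\mathbb{R}$. A (mild) solution is a predictable process $u=\{u(t,x);t\in[0,T],x\in\mathbb{R}\}$ such that, for every $(t,x)\in[0,T]\times\mathbb{R}$, a.s., $$u(t,x)=w(t,x)+\int_0^t\int_{\mathbb{R}}G(t-s,x-y)\sigma(u(s,y))L(ds,dy).$$ Standing assumptions. $G(t,\cdot)\in L^1(\mathbb{R})$ for the times $t$ occurring below, with Fourier transform $\mathcal{F}G(t,\cdot)(\xi)=\int_{\mathbb{R}}e^{-i\xi x}G(t,x)dx$. Hypothesis H1: $w$ is continuous and uniformly bounded on $[0,T]\times\mathbb{R}$. Hypothesis H2: (a) $\int_0^T\int_{\mathbb{R}}G^2(t,x)dxdt<\infty$; (b) $t\mapsto\mathcal{F}G(t,\cdot)(\xi)$ is continuous on $[0,T]$ for every $\xi\in\mathbb{R}$; (c) there exist $\varepsilon>0$ and a non-negative function $k_t(\cdot)$ such that $|\mathcal{F}G(t+h,\cdot)(\xi)-\mathcal{F}G(t,\cdot)(\xi)|\le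 k_t(\xi)$ for all $t\in[0,T]$, $h\in[0,\varepsilon]$ (and all $\xi\in\mathbb{R}$), and $\int_0^T\int_{\mathbb{R}}|k_t(\xi)|^2d\xi dt<\infty$.
   Formalization: The predictable σ-field is also given the time-0 generators Y·1_{0}(t)1_A(x), Y bounded and F^L_0-measurable; with 0<a<b only, predictable processes are constant at t=0, so no solution could equal a non-constant w(0,·) there. *)

(* Defs.v *)
(* MathComp-Analysis formalization of mild solutions of equations driven by
   a pure-jump Levy space-time white noise. *)
From Stdlib Require List.
From HB Require Import structures.
From mathcomp Require Import all_boot all_order all_algebra.
From mathcomp Require Import complex.
From mathcomp Require Import all_classical all_reals all_analysis.
From mathcomp Require Import measurable_realfun.

Set Implicit Arguments.
Unset Strict Implicit.
Unset Printing Implicit Defensive.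
Import Order.TTheory GRing.Theory Num.Theory.
Import numFieldNormedType.Exports.

Local Open Scope classical_set_scope.
Local Open Scope ring_scope.

Section deterministic.
Context {R : realType}.
Local Notation Rm := (measurableTypeR R).
Implicit Types (T : R) (nu : {measure set Rm -> \bar R}).

Definition space_time T : set (R * R) := `[0, T]%classic `*` setT.

(* A point (t, (x, z)) is a time, a position and a jump size. *)
Definition jump_domain T : set (Rm * (Rm * Rm)) :=
  `[0, T]%classic `*` (setT `*` [set~ 0]).

(* A measure on R \ {0} is a measure on R that does not charge 0. *)
Definition levy_measure nu : Prop :=
  nu [set 0] = 0%E /\
  (\int[nu]_z (Num.min 1 (`|z| ^+ 2))%:E < +oo)%E.

Definition finite_second_moment nu : Prop :=
  (\int[nu]_z (z ^+ 2)%:E < +oo)%E.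

Definition area : {measure set (Rm * Rm) -> \bar R} :=
  (@lebesgue_measure R \x @lebesgue_measure R)%E.

(* dt dx nu(dz); [\x^] only needs its first factor to be sigma-finite. *)
Definition intensity nu : {measure set (Rm * (Rm * Rm)) -> \bar R} :=
  (@lebesgue_measure R \x^ (@lebesgue_measure R \x^ nu))%E.

Definition bounded_borel (B : set R) : Prop :=
  measurable (B : set Rm) /\ bounded_set B.

(* e^(- i xi x) = cos (xi x) - i sin (xi x), integrated componentwise. *)
Definition fourier (f : R -> R) (xi : R) : R[i] :=
  Complex (\int[lebesgue_measure]_x (cos (xi * x) * f x))
          (- \int[lebesgue_measure]_x (sin (xi * x) * f x)).

Definition hypothesis_H1 T (w : R -> R -> R) : Prop :=
  {within space_time T, continuous (fun q : R * R => w q.1 q.2)} /\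
  [bounded w q.1 q.2 | q in space_time T].

Definition in_L1 (f : R -> R) : Prop :=
  lebesgue_measure.-integrable setT (EFin \o f).

(* Membership of G(t, .) in L^1(R) is asked at all the times at which its
   Fourier transform is used: t in [0, T], and t + h in part (c). *)
Definition hypothesis_H2 T (G : R -> R -> R) : Prop :=
  [/\ measurable_fun (space_time T) (fun q : Rm * Rm => G q.1 q.2) /\
      (\int[area]_(q in space_time T) (G q.1 q.2 ^+ 2)%:E < +oo)%E,
      forall t, 0 <= t <= T -> in_L1 (G t),
      forall xi, {within `[0, T]%classic,
                    continuous (fun t => fourier (G t) xi : R[i]^o)}
    & exists (eps : R) (k : R -> R -> R),
      [/\ 0 < eps,
          forall t xi, 0 <= k t xi,
          forall t h, 0 <= t <= T -> 0 <= h <= eps ->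
            in_L1 (G (t + h)) /\
            forall xi, `|fourier (G (t + h)) xi - fourier (G t) xi|
                       <= (k t xi)%:C%C,
          measurable_fun (space_time T) (fun q : Rm * Rm => k q.1 q.2)
        & (\int[area]_(q in space_time T) (`|k q.1 q.2| ^+ 2)%:E < +oo)%E]].

End deterministic.

Section noise.
Context {R : realType} {d : measure_display} {Omega : measurableType d}.
Local Notation Rm := (measurableTypeR R).
Variables (P : probability Omega R) (T : R) (nu : {measure set Rm -> \bar R}).
Variable N : R.-ker Omega ~> (Rm * (Rm * Rm))%type.

(* The second argument of [poisson_prob] is unused; the value at rate 0 is
   the Dirac mass at 0. *)
Definition poisson_random_measure : Prop :=
  [/\ forall A, measurable A -> A `<=` jump_domain T ->
        (intensity nu A < +oo)%E ->
        forall k : nat,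
          P [set o | N o A = k%:R%:E] =
          poisson_prob (fine (intensity nu A)) k [set k],
      forall A, measurable A -> A `<=` jump_domain T ->
        intensity nu A = +oo%E -> {ae P, forall o, N o A = +oo%E}
    & forall n (A : 'I_n -> set (Rm * (Rm * Rm))),
        (forall i, measurable (A i) /\ A i `<=` jump_domain T) ->
        trivIset setT A ->
        forall C : 'I_n -> set (\bar R), (forall i, measurable (C i)) ->
          P (\bigcap_(i in setT) [set o | C i (N o (A i))]) =
          (\prod_(i < n) P [set o | C i (N o (A i))])%E].

(* Only used for intensity nu A < +oo, where N o A is a.s. finite. *)
Definition compensated (A : set (Rm * (Rm * Rm))) (o : Omega) : R :=
  fine (N o A) - fine (intensity nu A).

(* The elementary integrand Y(o) 1_(a, b](t) 1_A(x) 1_C(z). *)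
Record elementary := Elementary {
  el_coef : Omega -> R;
  el_start : R;
  el_stop : R;
  el_space : set R;
  el_jump : set R }.

Definition el_support (e : elementary) : set (Rm * (Rm * Rm)) :=
  `]el_start e, el_stop e]%classic `*` (el_space e `*` el_jump e).

Definition is_filtration_measurable (F : set (set Omega)) (Y : Omega -> R) :=
  forall C : set R, measurable C -> F (Y @^-1` C).

Definition bounded_adapted (F : set (set Omega)) (Y : Omega -> R) : Prop :=
  is_filtration_measurable F Y /\ [bounded Y o | o in setT].

Definition is_elementary (F : R -> set (set Omega)) (e : elementary) : Prop :=
  [/\ 0 < el_start e < el_stop e /\ el_stop e <= T,
      bounded_adapted (F (el_start e)) (el_coef e),
      bounded_borel (el_space e)
    & [/\ measurable (el_jump e), ~ el_jump e 0 & (nu (el_jump e) < +oo)%E]].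

Definition simple_integrand (s : seq elementary) (o : Omega)
    (q : Rm * (Rm * Rm)) : R :=
  \sum_(e <- s) el_coef e o * \1_(el_support e) q.

Definition simple_integral (s : seq elementary) (o : Omega) : R :=
  \sum_(e <- s) el_coef e o * compensated (el_support e) o.

(* I is a version of the integral of H against the compensated measure: the
   L^2(P) limit of the integrals of F-adapted simple integrands that converge
   to H in L^2(P x intensity). *)
Definition compensated_integral (F : R -> set (set Omega))
    (H : Omega -> Rm * (Rm * Rm) -> R) (I : Omega -> R) : Prop :=
  measurable_fun setT I /\
  exists S : nat -> seq elementary,
    [/\ forall n, List.Forall (is_elementary F) (S n),
        (fun n => \int[P]_o \int[intensity nu]_(q in jump_domain T)
            ((simple_integrand (S n) o q - H o q) ^+ 2)%:E)%E @ \oo --> 0%E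
      & (fun n => \int[P]_o ((simple_integral (S n) o - I o) ^+ 2)%:E)%E
            @ \oo --> 0%E].

(* L is a version of L_t(B); for the trivial filtration the simple integrands
   are the deterministic ones. *)
Definition levy_noise (t : R) (B : set R) (L : Omega -> R) : Prop :=
  compensated_integral (fun _ => [set set0; setT])
    (fun _ q => q.2.2 * (\1_(`[0, t]%classic : set R) q.1 * \1_B q.2.1)) L.

(* Random variables are identified when a.s. equal, so the generated
   sigma-field takes all the versions of the L_s(B); if P is complete, it
   contains all the P-negligible sets. *)
Definition noise_filtration (t : R) : set (set Omega) :=
  <<s [set S | exists s B L C,
         [/\ 0 <= s <= t, bounded_borel B, levy_noise s B L,
             measurable C & S = L @^-1` C] ]>>.

Definition process_domain : set (Omega * (R * R)) := setT `*` space_time T.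

(* Generators of the predictable sigma-field. The ones at time 0 cannot be
   omitted: without them Omega x {0} x R would be an atom, and no predictable
   process could be equal to a non-constant w(0, .) at time 0. *)
Definition predictable_generator (p : Omega * (R * R) -> R) : Prop :=
  (exists a b Y A,
     [/\ 0 < a < b, bounded_adapted (noise_filtration a) Y, bounded_borel A
       & p = fun x => Y x.1 * \1_(`]a, b]%classic : set R) x.2.1 * \1_A x.2.2]) \/
  (exists Y A,
     [/\ bounded_adapted (noise_filtration 0) Y, bounded_borel A
       & p = fun x => Y x.1 * \1_[set 0 : R] x.2.1 * \1_A x.2.2]).

Definition predictable_sets : set (set (Omega * (R * R))) :=
  <<s process_domain,
      [set S | exists p C, [/\ predictable_generator p, measurable C
                              & S = process_domain `&` p @^-1` C] ]>>.

Definition predictable (X : R -> R -> Omega -> R) : Prop :=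
  forall C : set R, measurable C ->
    predictable_sets
      (process_domain `&` (fun x => X x.2.1 x.2.2 x.1) @^-1` C).

(* I is a version of the Ito integral of X(t, x) L(dt, dx) over [0, T] x R. *)
Definition ito_integral (X : R -> R -> Omega -> R) (I : Omega -> R) : Prop :=
  [/\ predictable X,
      (\int[P]_o \int[area]_(q in space_time T)
          (`|X q.1 q.2 o| ^+ 2)%:E < +oo)%E
    & compensated_integral noise_filtration
        (fun o q => X q.1 q.2.1 o * q.2.2) I].

Section solution.
Variables (w G : R -> R -> R) (sigma : R -> R).

Definition mild_solution (u : R -> R -> Omega -> R) : Prop :=
  predictable u /\
  forall t x, 0 <= t <= T ->
    exists2 I, ito_integral
        (fun s y o => \1_(`[0, t]%classic : set R) s
                      * (G (t - s) (x - y) * sigma (u s y o))) I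
      & {ae P, forall o, u t x o = w t x + I o}.

Definition L2_continuous (u : R -> R -> Omega -> R) : Prop :=
  (forall t x, 0 <= t <= T -> u t x \in Lfun P 2%:E) /\
  forall p, space_time T p ->
    'N[P]_(2%:E)[(fun o => (u q.1 q.2 o - u p.1 p.2 o)%:E)]%E
      @[q --> within (space_time T) (nbhs p)] --> 0%E.

Definition L2_bounded (u : R -> R -> Omega -> R) : Prop :=
  (ereal_sup [set 'E_P[(fun o => `|u q.1 q.2 o| ^+ 2)%R] | q in space_time T]
   < +oo)%E.

Definition regular_solution (u : R -> R -> Omega -> R) : Prop :=
  [/\ mild_solution u, L2_continuous u & L2_bounded u].

End solution.
End noise.

(* Main.v *)
Require Import Defs.
From HB Require Import structures.
From mathcomp Require Import all_boot all_order all_algebra.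
From mathcomp Require Import all_classical all_reals all_analysis.
From mathcomp Require Import measurable_realfun.
From mathcomp Require Import ring lra.
Import Order.TTheory GRing.Theory Num.Theory.
Import numFieldNormedType.Exports.

(** A mild solution is a fixed point of the substitution that sends X to
    w + G * sigma(X) dL, the stochastic convolution being taken in space-time.
    Let g be G, extended by 0 outside [0, T] x R; it is square integrable on the
    plane. If E|sigma(X)(s,y) - sigma(X')(s,y)|^2 <= m e^(ns) for all (s,y), the
    isometry of the integral and the reflection (s,y) -> (t-s,x-y) bound the second
    moment of the difference of the convolutions at (t,x) by a constant times
    m e^(nt) times the integral of g(r,z)^2 e^(-nr) dr dz. By dominated
    convergence that integral tends to 0 as n grows ([exponential_weight]), so
    for n large the substitution is a contraction for the norm
    sup e^(-nt) E|X(t,x)|^2 ([picard_contraction]). Geometric convergence of the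
    iterates gives existence ([picard_exists]); iterating the contraction on two
    solutions gives uniqueness ([picard_unique]). The iterates stay bounded in L2
    since w is bounded and sigma has linear growth.

    For the iteration to make sense the convolution has to have a predictable
    version. It is an integral of predictable data, known at time t because g
    vanishes at negative times. As a function of (t,x) it is uniformly continuous
    in L2: by the isometry its modulus is that of the translates of g
    ([translation_continuity], [convolution_modulus]). An adapted process of this
    kind is the limit of its values at the preceding points of finer and finer
    grids, and those frozen processes are predictable ([predictable_version]). The
    same modulus, with the continuity of w, gives the L2 continuity of the solution
    ([solution_modulus]).

    The probabilistic input is the isometry. Counts of disjoint sets are
    independent Poisson variables, so a centered count of B has mean 0 and
    variance mu(B) and is independent of everything determined by the counts
    outside B ([counts_indep], [outside_indep]). If the coefficients of simple
    integrands do not look into the future, the mixed terms of the square of a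
    simple sum vanish, up to common parts of supports ([centered_covariance],
    [simple_isometry]). Limits in L2 inherit the isometry with a constant 16,
    which comes from using (a + b)^2 <= 2 a^2 + 2 b^2 as triangle inequality and is
    harmless for a contraction ([integral_isometry]).

    That the filtration of the noise does not look into the future is a fact about
    integrals too: every version of L_s(B) agrees almost surely with a limit of
    sums of centered counts of sets before time s
    ([noise_filtration_outside]). Integrals exist for all square integrable
    predictable processes because the processes that have an integral form a closed
    subspace of L2 that contains the indicators of a generating pi-system
    ([L2_density], [adapted_integral_exists]). *)

Set Implicit Arguments.
Unset Strict Implicit.
Unset Printing Implicit Defensive.
Local Open Scope classical_set_scope.
Local Open Scope ring_scope.

(** * Square integrals and fast L2 convergence *)

Section square_integrals.
Context {d : measure_display} {T : measurableType d} {R : realType}.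
Variable mu : {measure set T -> \bar R}.
Implicit Types (D : set T) (f g h : T -> R).

Definition sqint D f : \bar R := (\int[mu]_(x in D) ((f x) ^+ 2)%:E)%E.

Lemma sqint_ge0 D f : (0 <= sqint D f)%E.
Proof. by apply: integral_ge0 => x _; rewrite lee_fin sqr_ge0. Qed.

Lemma measurable_sq D f : measurable_fun D f ->
  measurable_fun D (fun x => ((f x) ^+ 2)%:E).
Proof. by move=> mf; apply/measurable_EFinP; exact: measurable_funX. Qed.

Lemma eq_sqint D f g : {in D, f =1 g} -> sqint D f = sqint D g.
Proof. by move=> fg; apply: eq_integral => x xD; rewrite fg. Qed.

Lemma le_sqint D f g : measurable D -> measurable_fun D f -> measurable_fun D g ->
  (forall x, D x -> `|f x| <= `|g x|) -> (sqint D f <= sqint D g)%E.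
Proof.
move=> mD mf mg fg; apply: ge0_le_integral => //.
- by move=> x _; rewrite lee_fin sqr_ge0.
- exact: measurable_sq.
- exact: measurable_sq.
- by move=> x Dx; rewrite lee_fin -real_normK ?num_real// -[leRHS]real_normK ?num_real// lerXn2r ?nnegrE ?fg.
Qed.

Lemma sqintD D f g : measurable D -> measurable_fun D f -> measurable_fun D g ->
  (sqint D (fun x => f x + g x)%R <= 2%:E * sqint D f + 2%:E * sqint D g)%E.
Proof.
move=> mD mf mg; rewrite /sqint -!ge0_integralZl//; first last.
- by move=> x _; rewrite lee_fin sqr_ge0.
- exact: measurable_sq.
- by move=> x _; rewrite lee_fin sqr_ge0.
- exact: measurable_sq.
have me h : measurable_fun D h -> measurable_fun D (fun x => 2%:E * ((h x) ^+ 2)%:E)%E.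
  by move=> mh; apply: measurable_funeM; exact: measurable_sq.
rewrite -ge0_integralD//; first last.
- exact: me.
- by move=> x _; rewrite -EFinM lee_fin mulr_ge0 ?sqr_ge0.
- exact: me.
- by move=> x _; rewrite -EFinM lee_fin mulr_ge0 ?sqr_ge0.
apply: ge0_le_integral => //.
- by move=> x _; rewrite lee_fin sqr_ge0.
- by apply: measurable_sq; exact: measurable_funD.
- by apply: emeasurable_funD; exact: me.
- by move=> x _; rewrite -!EFinM -EFinD lee_fin; have := sqr_ge0 (f x - g x); nra.
Qed.

Lemma sqintZ D f c : measurable D -> measurable_fun D f ->
  (sqint D (fun x => c * f x)%R = (c ^+ 2)%:E * sqint D f)%E.
Proof.
move=> mD mf; rewrite /sqint -ge0_integralZl//.
- by apply: eq_integral => x _; rewrite -EFinM exprMn.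
- exact: measurable_sq.
- by move=> x _; rewrite lee_fin sqr_ge0.
- by rewrite lee_fin sqr_ge0.
Qed.

Lemma sqint_subC D f g : sqint D (fun x => f x - g x) = sqint D (fun x => g x - f x).
Proof. by apply: eq_integral => x _; congr EFin; ring. Qed.

Lemma sqint_tri D f g h : measurable D -> measurable_fun D f -> measurable_fun D g ->
  measurable_fun D h ->
  (sqint D (fun x => f x - h x)%R <=
   2%:E * sqint D (fun x => f x - g x)%R + 2%:E * sqint D (fun x => g x - h x)%R)%E.
Proof.
move=> mD mf mg mh; rewrite (_ : sqint D (fun x => f x - h x) =
  sqint D (fun x => (f x - g x) + (g x - h x))); last first.
  by apply: eq_sqint => x _; ring.
by apply: sqintD => //; exact: measurable_funB.
Qed.

(** The triangle inequality is replaced throughout by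
    (a + b)^2 <= 2 a^2 + 2 b^2, so that only integrals of squares of measurable
    functions, possibly infinite, ever occur. *)
Lemma sqint_tri_eps D f g h (a b : R) : measurable D -> measurable_fun D f ->
  measurable_fun D g -> measurable_fun D h ->
  (sqint D (fun x => f x - g x)%R <= a%:E)%E ->
  (sqint D (fun x => g x - h x)%R <= b%:E)%E ->
  (sqint D (fun x => f x - h x)%R <= (2 * a + 2 * b)%:E)%E.
Proof.
move=> mD mf mg mh fa gb; apply: le_trans (sqint_tri mD mf mg mh) _.
by rewrite [leRHS]EFinD [X in (_ <= X + _)%E]EFinM [X in (_ <= _ + X)%E]EFinM leeD// lee_pmul2l.
Qed.

Lemma sqint_ae_eq D f g : measurable D -> measurable_fun D f -> measurable_fun D g ->
  sqint D (fun x => f x - g x) = 0%E -> {ae mu, forall x, D x -> f x = g x}.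
Proof.
move=> mD mf mg; rewrite /sqint => fg0.
have : ae_eq mu D (fun x => ((f x - g x) ^+ 2)%:E) (cst 0%E).
  apply/(ae_eq_integral_abs mu mD); first by apply: measurable_sq; exact: measurable_funB.
  rewrite -fg0; apply: eq_integral => x _.
  by rewrite gee0_abs// lee_fin sqr_ge0.
apply: filterS => x /[swap] Dx /(_ Dx) /= -[] /eqP.
by rewrite expf_eq0 /= subr_eq0 => /eqP.
Qed.

Lemma sqint_le_all D f : (forall e : R, 0 < e -> (sqint D f <= e%:E)%E) ->
  sqint D f = 0%E.
Proof.
move=> H; apply/eqP; rewrite eq_le sqint_ge0 andbT.
by apply/lee_addgt0Pr => e e0; rewrite add0e; exact: H.
Qed.

End square_integrals.

Section almost_sure_limits.
Context {d : measure_display} {T : measurableType d} {R : realType}.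
Variable mu : {measure set T -> \bar R}.

Lemma nneseries_cvg_series (a : nat -> R) : (forall n, 0 <= a n) ->
  (\sum_(n <oo) (a n)%:E < +oo)%E -> cvgn (series a).
Proof.
move=> a0 aoo.
have sub n : (\sum_(0 <= i < n) (a i)%:E <= \sum_(n <oo) (a n)%:E)%E.
  by apply: nneseries_lim_ge => k _ _; rewrite lee_fin.
have fin : (\sum_(n <oo) (a n)%:E)%E \is a fin_num.
  rewrite ge0_fin_numE//; apply: nneseries_ge0 => n _ _; exact: a0.
apply: nondecreasing_is_cvgn.
  by apply/nondecreasing_seqP => n; rewrite /series/= big_nat_recr//= lerDl.
exists (fine (\sum_(n <oo) (a n)%:E)%E) => _ [n _ <-].
by rewrite -lee_fin fineK// /series /= -sumEFin.
Qed.

(** By monotone convergence the sum has a finite integral, hence is finite almost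
    everywhere. *)
Lemma ae_summable (f : nat -> T -> R) (C : R) :
  (forall n, measurable_fun setT (f n)) -> (forall n x, 0 <= f n x) ->
  (forall n, \int[mu]_x (f n x)%:E <= (C * 2^-1 ^+ n)%:E)%E ->
  {ae mu, forall x, cvgn (series (f ^~ x))}.
Proof.
move=> mf f0 fC.
have mEf n : measurable_fun setT (EFin \o f n) by apply/measurable_EFinP.
have h0 x : (0 <= \sum_(n <oo) (f n x)%:E)%E.
  by apply: nneseries_ge0 => n _ _; rewrite lee_fin.
have : mu.-integrable setT (fun x => \sum_(n <oo) (f n x)%:E)%E.
  apply/integrableP; split.
    apply: ge0_emeasurable_sum => [k x _ _|k _]; first by rewrite lee_fin.
    exact: mEf.
  under eq_integral do rewrite gee0_abs//.
  rewrite integral_nneseries//; last by move=> n x _; rewrite lee_fin.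
  have C0 : 0 <= C.
    have := fC 0%N; rewrite expr0 mulr1 -lee_fin; apply: le_trans.
    by apply: integral_ge0 => x _; rewrite lee_fin.
  apply: (@le_lt_trans _ _ (\sum_(n <oo) (C * 2^-1 ^+ n)%:E)%E).
    apply: lee_nneseries => [n _ _|n _]; last exact: fC.
    by apply: integral_ge0 => x _; rewrite lee_fin.
  rewrite (_ : \sum_(n <oo) _ = (2 * C)%:E)%E ?ltry//.
  have := cvg_geometric_series (a := C) (z := 2^-1).
  rewrite ger0_norm ?invr_ge0// invf_lt1 ?ltr1n// => /(_ isT) /cvg_lim hs.
  transitivity (limn (EFin \o series (geometric C (2^-1)))).
    congr (limn _); apply/funext => n /=; rewrite /series/= -sumEFin.
    by apply: eq_bigr => i _; rewrite /geometric/=.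
  rewrite EFin_lim; last first.
    by apply: is_cvg_geometric_series; rewrite ger0_norm ?invr_ge0// invf_lt1 ?ltr1n.
  by rewrite hs//; congr EFin; field.
move=> /(integrable_ae measurableT); apply: filterS => x /(_ I) fx.
apply: nneseries_cvg_series => //; rewrite -ge0_fin_numE//.
Qed.

(** A total limit of real sequences: measurable in a parameter whatever the
    sigma-algebra, which is what makes limits of adapted or predictable
    functions adapted or predictable. *)
Definition rlimsup (u : nat -> R) : R := fine (limn_esup (EFin \o u)).

Lemma rlimsup_cvg (u : nat -> R) l : u @ \oo --> l -> rlimsup u = l.
Proof.
move=> ul; rewrite /rlimsup.
have uel : (EFin \o u) @ \oo --> l%:E by apply: cvg_EFin => //; exact: nearW.
by rewrite is_cvg_limn_esupE ?(cvg_lim _ uel)//; apply/cvg_ex; exists l%:E.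
Qed.

Lemma measurable_rlimsup (D : set T) (Z : nat -> T -> R) : measurable D ->
  (forall n, measurable_fun D (Z n)) ->
  measurable_fun D (fun x => rlimsup (Z ^~ x)).
Proof.
move=> mD mZ; apply: (measurableT_comp (@fine_measurable R setT measurableT)).
by apply: measurable_fun_limn_esup => n; apply/measurable_EFinP.
Qed.

(** Geometrically fast L2 convergence is almost sure: the sum of the squared
    errors is integrable. *)
Lemma fast_L2_ae_cvg (Z : nat -> T -> R) (L : T -> R) (C : R) :
  (forall n, measurable_fun setT (Z n)) -> measurable_fun setT L ->
  (forall n, sqint mu setT (fun x => Z n x - L x)%R <= (C * 2^-1 ^+ n)%:E)%E ->
  {ae mu, forall x, Z n x @[n --> \oo] --> L x}.
Proof.
move=> mZ mL ZL.
have : {ae mu, forall x, cvgn (series (fun n => (Z n x - L x) ^+ 2))}.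
  apply: (@ae_summable (fun n x => (Z n x - L x) ^+ 2) C) => //.
    by move=> n; apply: measurable_funX; exact: measurable_funB.
  by move=> n x; rewrite sqr_ge0.
apply: filterS => x /cvg_series_cvg_0 c0.
apply/subr_cvg0.
have c0' : (fun n => Num.sqrt ((Z n x - L x) ^+ 2)) @ \oo --> (0 : R).
  rewrite -[X in _ --> X](@sqrtr0 R).
  by apply: continuous_cvg => //; exact: sqrt_continuous.
apply/norm_cvg0P; apply: cvg_trans c0'; apply: near_eq_cvg.
by apply: nearW => n; rewrite sqrtr_sqr.
Qed.

(** Geometrically fast Cauchy sequences of square integrable functions
    converge, almost surely and in L2, to their pointwise upper limit. *)
Lemma L2_complete (Z : nat -> T -> R) (C : R) :
  (forall n, measurable_fun setT (Z n)) ->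
  (forall n, sqint mu setT (fun x => Z n.+1 x - Z n x)%R <= (C * 8^-1 ^+ n)%:E)%E ->
  {ae mu, forall x, Z n x @[n --> \oo] --> rlimsup (Z ^~ x)} /\
  (forall n, sqint mu setT (fun x => rlimsup (Z ^~ x) - Z n x)%R <=
             (4 * C * 8^-1 ^+ n)%:E)%E.
Proof.
move=> mZ ZC.
have aeZ : {ae mu, forall x, Z n x @[n --> \oo] --> rlimsup (Z ^~ x)}.
  have : {ae mu, forall x, cvgn (series (fun n => 2 ^+ n * (Z n.+1 x - Z n x) ^+ 2))}.
    apply: (@ae_summable (fun n x => 2 ^+ n * (Z n.+1 x - Z n x) ^+ 2) C).
    - move=> n; apply: measurable_funM => //.
      by apply: measurable_funX; exact: measurable_funB.
    - by move=> n x; rewrite mulr_ge0 ?sqr_ge0 ?exprn_ge0.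
    - move=> n; under eq_integral do rewrite EFinM.
      rewrite ge0_integralZl//; first last.
      + by move=> x _; rewrite lee_fin sqr_ge0.
      + by apply: measurable_sq; exact: measurable_funB.
      apply: (@le_trans _ _ ((2 ^+ n)%:E * (C * 8^-1 ^+ n)%:E)%E).
        by rewrite lee_pmul2l ?lte_fin ?exprn_gt0//; exact: ZC.
      have C0 : 0 <= C.
        have := ZC 0%N; rewrite expr0 mulr1 -lee_fin; apply: le_trans.
        exact: sqint_ge0.
      rewrite -EFinM lee_fin mulrCA -exprMn ler_wpM2l// lerXn2r ?nnegrE//; lra.
  apply: filterS => x cx.
  suff [l Zl] : exists l : R, (fun n => Z n x) @ \oo --> l by rewrite (rlimsup_cvg Zl).
  pose u n := Z n.+1 x - Z n x.
  suff : cvgn (series u).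
    move=> /cvg_ex[l ul]; exists (l + Z 0%N x).
    have -> : (fun n => Z n x) = (fun n => series u n + Z 0%N x).
      by apply/funext => n; rewrite /series/= telescope_sumr// subrK.
    by apply: cvgD => //; exact: cvg_cst.
  apply: normed_cvg.
  have c2 : cvgn (series (geometric (1 : R) 2^-1)).
    by apply: is_cvg_geometric_series; rewrite ger0_norm ?invr_ge0// invf_lt1 ?ltr1n.
  have cc : cvgn (series (fun n => 1 * 2^-1 ^+ n + 2 ^+ n * (Z n.+1 x - Z n x) ^+ 2)).
    rewrite (_ : series _ = (fun n => series (geometric 1 2^-1) n +
      series (fun n => 2 ^+ n * (Z n.+1 x - Z n x) ^+ 2) n)); first exact: is_cvgD.
    by apply/funext => n; rewrite /series/= big_split.
  apply: (series_le_cvg _ _ _ cc) => n.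
  - by rewrite normr_ge0.
  - by apply: addr_ge0; apply: mulr_ge0 => //; rewrite ?sqr_ge0// exprn_ge0// invr_ge0.
  rewrite mul1r /= -/(u n).
  have e2 : 2^-1 ^+ n * 2 ^+ n = 1 :> R by rewrite -exprMn mulVf ?expr1n.
  have a0 : 0 < 2^-1 ^+ n :> R by rewrite exprn_gt0.
  have b0 : 0 < 2 ^+ n :> R by rewrite exprn_gt0.
  rewrite -[(u n) ^+ 2]real_normK ?num_real//.
  move: a0 b0 e2 (normr_ge0 (u n)); move: (2^-1 ^+ n) (2 ^+ n) `|u n| => a b c a0 b0 ab c0.
  have : 0 <= (a - c) ^+ 2 * b by rewrite mulr_ge0 ?sqr_ge0 ?ltW.
  have -> : (a - c) ^+ 2 * b = a * (a * b) - 2 * c * (a * b) + b * c ^+ 2 by ring.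
  rewrite ab; nra.
split=> // n.
have fin m : (sqint mu setT (fun x => Z (n + m)%N x - Z n x)%R <= (4 * C * 8^-1 ^+ n)%:E)%E.
  have C0 : 0 <= C.
    have := ZC 0%N; rewrite expr0 mulr1 -lee_fin; apply: le_trans.
    exact: sqint_ge0.
  elim: m n => [|m IH] n.
    rewrite addn0 /sqint integral0_eq ?lee_fin ?mulr_ge0// => x _.
    by rewrite subrr expr0n.
  apply: le_trans (sqint_tri_eps (g := Z n.+1) measurableT _ _ _ (b := C * 8^-1 ^+ n) (a := 4 * C * 8^-1 ^+ n.+1) _ _) _ => //.
    by rewrite -addSnnS; exact: IH.
  rewrite lee_fin exprS.
  have : 0 <= C * 8^-1 ^+ n by rewrite mulr_ge0.
  move: (8^-1 ^+ n) => a; lra.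
rewrite /sqint.
apply: (@le_trans _ _ (\int[mu]_x limn_einf (fun m => ((Z (n + m)%N x - Z n x) ^+ 2)%:E))%E).
  apply: ae_ge0_le_integral => //.
  - by move=> x _; rewrite lee_fin sqr_ge0.
  - apply: measurable_sq; apply: measurable_funB => //.
    exact: measurable_rlimsup.
  - move=> x _; rewrite limn_einf_lim; apply: lime_ge; first exact: is_cvg_einfs.
    apply: nearW => k; apply: le_ereal_inf_tmp => _ [m _ <-].
    by rewrite lee_fin sqr_ge0.
  - rewrite (_ : (fun x => _) = (fun x => - limn_esup (fun m => - ((Z (n + m)%N x - Z n x) ^+ 2)%:E))%E).
      apply: measurableT_comp => //; apply: measurable_fun_limn_esup => k.
      apply: measurableT_comp => //.
      by apply: measurable_sq; exact: measurable_funB.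
    by [].
  apply: filterS aeZ => x Zx _.
  rewrite (_ : limn_einf _ = ((rlimsup (Z^~ x) - Z n x) ^+ 2)%:E)//.
  have /cvg_limn_einf_sup[-> _]// : (fun m => ((Z (n + m)%N x - Z n x) ^+ 2)%:E) @ \oo -->
      ((rlimsup (Z^~ x) - Z n x) ^+ 2)%:E.
  apply: cvg_EFin; first exact: nearW.
  rewrite !expr2; suff cz : (fun m => Z (n + m)%N x - Z n x) @ \oo --> rlimsup (Z^~ x) - Z n x.
    exact: cvgM.
  apply: cvgB; last exact: cvg_cst.
  by apply: (cvg_comp (addn n) (Z ^~ x) _ Zx); exact: cvg_addnl.
apply: le_trans (fatou _ _ _ _) _ => //.
- by move=> k; apply: measurable_sq; exact: measurable_funB.
- by move=> k x _; rewrite lee_fin sqr_ge0.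
rewrite limn_einf_lim; apply: lime_le; first exact: is_cvg_einfs.
apply: nearW => m; apply: le_trans (fin m).
by apply: ereal_inf_lbound; exists m => /=.
Qed.

End almost_sure_limits.

(** * Density in L2 *)

(** Two sigma-algebras on one type have to be compared throughout; the smaller one
    is given by a generating family. *)
Local Notation gmeasurable_fun G D f :=
  (@measurable_fun _ _ (g_sigma_algebraType G) _ D f).

Section generated_measurability.
Context {d : measure_display} {X : measurableType d} {R : realType}.

Lemma sub_generated_measurable (G : set (set X)) :
  (forall A, G A -> measurable A) -> <<s G >> `<=` (@measurable d X).
Proof.
by move=> Gm; apply: smallest_sub; [exact: sigma_algebra_measurable|exact: Gm].
Qed.

Lemma generated_measurable_fun (G : set (set X)) (D : set X) (f : X -> R) :
  (forall A, G A -> measurable A) -> measurable D ->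
  gmeasurable_fun G D f -> <<s G >> D -> measurable_fun D f.
Proof.
move=> Gm mD mf GD _ C mC; apply: (sub_generated_measurable Gm).
exact: mf GD C mC.
Qed.

End generated_measurability.

Lemma indic_setD_sq {X : Type} {R : realType} (U F E : set X) (x : X) : F `<=` U ->
  (\1_(U `&` E) x - \1_(F `&` E) x) ^+ 2 <= \1_((U `\` F) `&` E) x :> R.
Proof.
move=> FU; rewrite !indicE !in_setI.
have -> : (x \in [set y | ~ F y]) = (x \notin F).
  apply/idP/idP => [/set_mem nFx|/negP nFx]; first by apply/negP => /set_mem.
  by apply: mem_set => /mem_set.
have : x \in F -> x \in U by rewrite !inE; exact: FU.
case: (x \in F) => [->//|_]; case: (x \in U); case: (x \in E) => //=;
  by rewrite ?subrr ?subr0 ?expr0n ?expr1n.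
Qed.

Section L2_density.
Context {d : measure_display} {X : measurableType d} {R : realType}.
Variable m : {measure set X -> \bar R}.
Variables (D : set X) (Pi : set (set X)) (Dn : nat -> set X) (V : (X -> R) -> Prop).
Hypothesis PiI : setI_closed Pi.
Hypothesis Pim : forall A, Pi A -> measurable A.
Hypothesis PiD : forall n, Pi (Dn n).
Hypothesis DnU : D = \bigcup_n Dn n.
Hypothesis Dn_nd : {homo Dn : n k / (n <= k)%N >-> (n <= k)%O}.
Hypothesis Dn_fin : forall n, (m (Dn n) < +oo)%E.
Hypothesis PiV : forall A, Pi A -> V \1_A.
Hypothesis Vlin : forall a f g, V f -> V g -> V (fun x => a * f x + g x).
Hypothesis Vlim : forall f : X -> R, measurable_fun D f ->
  (forall e : R, 0 < e -> exists2 g, V g &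
     measurable_fun D g /\ (sqint m D (fun x => f x - g x)%R <= e%:E)%E) -> V f.

Let mD : measurable D.
Proof. by rewrite DnU; apply: bigcupT_measurable => n; exact: Pim. Qed.

Let V0 : V (fun=> 0).
Proof.
have := Vlin (-1) (PiV (PiD 0%N)) (PiV (PiD 0%N)).
by congr V; apply/funext => x; ring.
Qed.

Let Vset n S : <<s Pi >> S -> measurable S /\ V \1_(S `&` Dn n).
Proof.
move: S; apply: (lambda_system_subset PiI (D := setT)) => //.
- split => //.
  + by split; [exact: measurableT|rewrite setTI; exact: PiV].
  + move=> A B BA [mA VA] [mB VB]; split; first exact: measurableD.
    have := Vlin (-1) VB VA; congr V; apply/funext => x.
    have -> : (A `\` B) `&` Dn n = (A `&` Dn n) `\` (B `&` Dn n).
      apply/seteqP; split=> y /=; first by move=> [[Ay nBy] Dy]; split=> // -[].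
      by move=> [[Ay Dy] nBy]; split => //; split => // By; exact: nBy.
    rewrite !indicE in_setD.
    case: (boolP (x \in B `&` Dn n)) => [xB|xB] /=; last by rewrite andbT mulr0 add0r.
    rewrite andbF (_ : x \in A `&` Dn n = true)/=; first by ring.
    by apply: mem_set; move: xB; rewrite inE => -[Bx Dx]; split => //; exact: BA.
  + move=> F Fnd FV.
    have mF k : measurable (F k) by have [] := FV k.
    split; first exact: bigcupT_measurable.
    have mU : measurable (\bigcup_k F k) by exact: bigcupT_measurable.
    have mDn : measurable (Dn n) by exact: Pim.
    apply: Vlim.
      by apply: measurable_funTS; apply: measurable_indic; exact: measurableI.
    move=> e e0.
    pose G k := ((\bigcup_k F k) `\` F k) `&` Dn n.
    have mG k : measurable (G k) by apply: measurableI => //; exact: measurableD.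
    have : (m \o G) k @[k --> \oo] --> m (\bigcap_k G k).
      apply: nonincreasing_cvg_mu => //.
      - by apply: le_lt_trans (Dn_fin n); apply: le_measure; rewrite ?inE//; apply: subIsetr.
      - exact: bigcap_measurableType.
      - move=> i j ij; apply/subsetPset => x [[Ux nFx] Dx]; split=> //; split => //.
        by move=> Fx; apply: nFx; move/subsetPset : (Fnd _ _ ij); apply.
    have -> : \bigcap_k G k = set0.
      rewrite -subset0 => x Gx; have [[[k _ Fx] _] _] := Gx 0%N I.
      by have [[_ /(_ Fx)]] := Gx k I.
    rewrite measure0 => /fine_cvgP[_] /cvgrPdist_lt /(_ _ e0)[k0 _ /(_ k0 (leqnn _))] /=.
    rewrite sub0r normrN => Ge.
    have [mFk VFk] := FV k0.
    exists \1_(F k0 `&` Dn n) => //; split.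
      by apply: measurable_funTS; apply: measurable_indic; exact: measurableI.
    have GD : (m (G k0) < +oo)%E.
      by apply: le_lt_trans (Dn_fin n); apply: le_measure; rewrite ?inE//; apply: subIsetr.
    apply: (@le_trans _ _ (m (G k0))); last first.
      by rewrite -(@fineK _ (m (G k0))) ?ge0_fin_numE// lee_fin; move: Ge; rewrite ger0_norm ?fine_ge0// => /ltW.
    have -> : m (G k0) = (\int[m]_x (\1_(G k0) x)%:E)%E by rewrite integral_indic// setIT.
    rewrite /sqint; apply: (@le_trans _ _ (\int[m]_(x in D) (\1_(G k0) x)%:E)%E); last first.
      apply: (@ge0_subset_integral _ _ _ m D setT) => //.
      by apply/measurable_EFinP; exact: measurable_indic.
    apply: ge0_le_integral => //.
    * by move=> x _; rewrite lee_fin sqr_ge0.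
    * apply: measurable_sq; apply: measurable_funB; apply: measurable_funTS; apply: measurable_indic; exact: measurableI.
    * by apply/measurable_EFinP; apply: measurable_funTS; exact: measurable_indic.
    * by move=> x Dx; rewrite lee_fin; apply: indic_setD_sq => y Fy; exists k0.
- by move=> A PiA; split; [exact: Pim|apply: PiV; exact: PiI].
Qed.

Let Vsum (I : Type) (s : seq I) (F : I -> X -> R) (c : I -> R) : (forall i, V (F i)) ->
  V (fun x => \sum_(i <- s) c i * F i x).
Proof.
move=> VF; elim: s => [|i s IH].
  by move: V0; congr V; apply/funext => x; rewrite big_nil.
have := Vlin (c i) (VF i) IH; congr V; apply/funext => x.
by rewrite big_cons.
Qed.

Import HBNNSimple.

Let X' : measurableType Pi.-sigma := g_sigma_algebraType Pi.

Let Vsfun n (g : {nnsfun X' >-> R}) : V (fun x : X' => g x * \1_(Dn n) x).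
Proof.
have VF (y : R) : V \1_((g @^-1` [set y]) `&` Dn n).
  have [] // := Vset n (S := g @^-1` [set y]).
  have : measurable (g @^-1` [set y]) by exact: measurable_funPTI.
  by [].
have := Vsum (finmap.enum_fset (fset_set (range g))) (fun y => y) VF.
congr V; apply/funext => x; rewrite (fimfunE g x) fsbig_finite//= mulr_suml.
apply: eq_bigr => y _.
by rewrite indicI /= mulrA.
Qed.

Let Vge0 (f : X -> R) : (forall x, D x -> 0 <= f x) ->
  (forall C, measurable C -> <<s Pi >> (D `&` f @^-1` C)) ->
  (sqint m D f < +oo)%E -> V f.
Proof.
move=> f0 mf ffin.
have mf' : measurable_fun D f.
  by move=> _ C mC; apply: (sub_generated_measurable Pim); exact: mf.
have GD : <<s Pi >> D by have := mf _ measurableT; rewrite preimage_setT setIT.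
pose fe : g_sigma_algebraType Pi -> \bar R := EFin \o f.
have mfe : gmeasurable_fun Pi D fe.
  apply/measurable_EFinP => _ C mC; exact: mf.
have mDg : @measurable _ (g_sigma_algebraType Pi) D by [].
pose g := nnsfun_approx mDg mfe.
have fe0 x : D x -> (0 <= fe x)%E by move=> Dx; rewrite lee_fin f0.
have gf x : D x -> (fun n => g n x) @ \oo --> f x.
  move=> Dx; have := @cvg_nnsfun_approx _ _ _ _ mDg _ mfe fe0 x Dx.
  by move=> /fine_cvgP[_].
have gle n x : D x -> g n x <= f x.
  by move=> Dx; rewrite -lee_fin /g nnsfun_approxE; exact: le_approx.
have mg n : @measurable_fun _ _ X _ setT (g n).
  apply: (generated_measurable_fun Pim) => //.
  exact: (@measurableT _ (g_sigma_algebraType Pi)).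
pose h n x := g n x * \1_(Dn n) x.
have mh n : measurable_fun D (h n).
  by apply: measurable_funTS; apply: measurable_funM => //; apply: measurable_indic; exact: Pim.
have hf x : D x -> (fun n => h n x) @ \oo --> f x.
  move=> Dx; apply: cvg_trans (gf x Dx); apply: near_eq_cvg.
  have [n0 _ Dn0] : (\bigcup_n Dn n) x by rewrite -DnU.
  exists n0 => // n /= n0n; rewrite /h indicE mem_set ?mulr1//.
  by move/subsetPset : (Dn_nd n0n); apply.
have hle n x : D x -> `|f x - h n x| <= f x.
  move=> Dx; rewrite ler_norml; have g0 : 0 <= g n x by [].
  have := gle n x Dx; have := f0 x Dx; rewrite /h indicE; case: (_ \in _) => /=; lra.
apply: Vlim => // e e0.
have : (sqint m D (fun x => f x - h n x)) @[n --> \oo] --> (\int[m]_(x in D) 0)%E.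
  have intf2 : m.-integrable D (fun x => ((f x) ^+ 2)%:E).
    apply/integrableP; split; first exact: measurable_sq.
    by under eq_integral do rewrite gee0_abs ?lee_fin ?sqr_ge0//.
  have [] // := @dominated_convergence _ _ _ m D mD
      (fun n x => ((f x - h n x) ^+ 2)%:E) (cst 0%E) (fun x => ((f x) ^+ 2)%:E).
  - by move=> n; apply: measurable_sq; exact: measurable_funB.
  - apply: aeW => x Dx; apply: cvg_EFin; first exact: nearW.
    rewrite [X in _ --> X](_ : _ = (f x - f x) * (f x - f x)); last by rewrite subrr mul0r.
    under eq_fun do rewrite expr2.
    by apply: cvgM; apply: cvgB; (exact: cvg_cst || exact: hf).
  - apply: aeW => x n Dx; rewrite gee0_abs ?lee_fin ?sqr_ge0//.
    by rewrite -real_normK ?num_real// lerXn2r ?nnegrE ?f0 ?hle.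
rewrite integral0 => /fine_cvgP[[k1 _ fin]] /cvgrPdist_lt /(_ _ e0)[k0 _ H].
pose k := maxn k1 k0.
have := H k (leq_maxr _ _); rewrite /= sub0r normrN => hk.
exists (h k); first exact: Vsfun.
split => //.
rewrite -(@fineK _ (sqint _ _ _)); last by apply: (fin k); exact: leq_maxl.
by rewrite lee_fin; apply: le_trans (ltW hk); exact: ler_norm.
Qed.

(** Functional monotone class theorem in L2: a closed subspace of L2(D, m)
    that contains the indicators of a pi-system contains every square
    integrable function that is measurable for the generated sigma-algebra. *)
Lemma L2_density (f : X -> R) :
  (forall C, measurable C -> <<s Pi >> (D `&` f @^-1` C)) ->
  (sqint m D f < +oo)%E -> V f.
Proof.
move=> mf ffin.
have mf' : measurable_fun D f.
  by move=> _ C mC; apply: (sub_generated_measurable Pim); exact: mf.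
have mfg : gmeasurable_fun Pi D f.
  by move=> _ C mC; exact: mf.
have GD : <<s Pi >> D by have := mf _ measurableT; rewrite preimage_setT setIT.
have key (s : R) : (s = 1 \/ s = -1) -> V (fun x => Num.max (s * f x) 0).
  move=> s1; apply: Vge0.
  - by move=> x _; rewrite le_max lexx orbT.
  - move=> C mC.
    have mm : gmeasurable_fun Pi D (fun x => Num.max (s * f x) 0).
      by apply: measurable_maxr => //; exact: measurable_funM.
    exact: mm.
  - apply: le_lt_trans ffin; apply: le_sqint => //.
      by apply: measurable_maxr => //; exact: measurable_funM.
    move=> x _; rewrite ger0_norm ?le_max ?lexx ?orbT// ge_max normr_ge0 andbT.
    by case: s1 => ->; rewrite ?mul1r ?ler_norm// mulN1r -normrN ler_norm.
have := Vlin (-1) (key (-1) (or_intror erefl)) (key 1 (or_introl erefl)).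
congr V; apply/funext => x; rewrite !mul1r.
by rewrite !maxEle; case: leP => ?; case: leP => ?; lra.
Qed.

End L2_density.

(** * Independence *)

Section independent_products.
Context {d : measure_display} {Omega : measurableType d} {R : realType}.
Variable P : probability Omega R.

(** Independence makes the joint law the product of the laws, so Fubini's
    theorem factors the mean and gives its existence. *)
Lemma indep_expectation (X Y : Omega -> R) :
  measurable_fun setT X -> measurable_fun setT Y ->
  (forall A B : set R, measurable A -> measurable B ->
     P (X @^-1` A `&` Y @^-1` B) = (P (X @^-1` A) * P (Y @^-1` B))%E) ->
  P.-integrable setT (EFin \o X) -> P.-integrable setT (EFin \o Y) ->
  P.-integrable setT (fun o => (X o * Y o)%:E) /\
  (\int[P]_o (X o * Y o)%:E = \int[P]_o (X o)%:E * \int[P]_o (Y o)%:E)%E.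
Proof.
move=> mX mY XY iX iY.
pose X' : {mfun Omega >-> R} := mfun_Sub (mem_set mX).
pose Y' : {mfun Omega >-> R} := mfun_Sub (mem_set mY).
pose dX := distribution P X'.
pose dY := distribution P Y'.
pose XY' o := (X o, Y o).
have mXY : measurable_fun setT XY' by exact: measurable_fun_pair.
pose Z' : {mfun Omega >-> (R * R)%type} := mfun_Sub (mem_set mXY).
pose dZ := distribution P Z'.
have prodE A : measurable A -> (dX \x dY)%E A = dZ A.
  move=> mA; apply: (@product_measure_unique _ _ _ _ R dX dY dZ) => //.
pose f (z : R * R) := (z.1 * z.2)%:E.
have mf : measurable_fun setT f.
  by apply/measurable_EFinP; apply: measurable_funM; [exact: measurable_fst|exact: measurable_snd].
have intX (g : R -> \bar R) : measurable_fun setT g -> (forall x, 0 <= g x)%E ->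
    (\int[dX]_x g x = \int[P]_o g (X o))%E.
  by move=> mg g0; rewrite /dX /distribution ge0_integral_pushforward.
have intY (g : R -> \bar R) : measurable_fun setT g -> (forall x, 0 <= g x)%E ->
    (\int[dY]_x g x = \int[P]_o g (Y o))%E.
  by move=> mg g0; rewrite /dY /distribution ge0_integral_pushforward.
have iidX : dX.-integrable setT EFin.
  apply/integrableP; split; first exact/measurable_EFinP.
  rewrite intX//; last by apply: measurableT_comp => //; exact/measurable_EFinP.
  by have /integrableP[_] := iX.
have iidY : dY.-integrable setT EFin.
  apply/integrableP; split; first exact/measurable_EFinP.
  rewrite intY//; last by apply: measurableT_comp => //; exact/measurable_EFinP.
  by have /integrableP[_] := iY.
have [Yfin] : (\int[dY]_y `|(y : R)%:E|)%E \is a fin_num /\ (\int[dY]_y (y : R)%:E)%E \is a fin_num.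
  split; last exact: integrable_fin_num.
  by apply: integrable_fin_num => //; exact: integrable_abse.
have if_ : (dX \x dY)%E.-integrable setT f.
  apply/integrable12ltyP => //.
  have inner (x : R) : (\int[dY]_y `|f (x, y)| =
      (fine (\int[dY]_y `|(y : R)%:E|))%:E * `|x%:E|)%E.
    have mn : measurable_fun setT (fun y : R => `|y|%:E).
      by apply/measurable_EFinP; exact: normr_measurable.
    under eq_integral do rewrite /f /= normrM EFinM.
    rewrite ge0_integralZl//.
    by rewrite (fineK Yfin) muleC.
  under eq_integral do rewrite inner.
  rewrite ge0_integralZl//; last 2 first.
    by apply: measurableT_comp => //; exact/measurable_EFinP.
    by rewrite lee_fin fine_ge0// integral_ge0.
  have /integrableP[_ fX] := iidX.
  by rewrite lte_mul_pinfty// ?lee_fin ?fine_ge0 ?integral_ge0.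
have ifZ : dZ.-integrable setT f.
  have /integrableP[_] := if_.
  move=> h; apply/integrableP; split => //.
  by move: h; rewrite (eq_measure_integral dZ)// => A mA _; exact: prodE.
move=> Yfin'.
have iXY : P.-integrable setT (f \o XY').
  apply/integrableP; split; first exact: measurableT_comp.
  have /integrableP[_] := ifZ.
  by rewrite /dZ /distribution ge0_integral_pushforward//; exact: measurableT_comp.
split; first exact: iXY.
transitivity (\int[dZ]_z f z)%E.
  by rewrite /dZ /distribution integral_pushforward.
rewrite -(eq_measure_integral dZ (m1 := (dX \x dY)%E)); last by move=> A mA _; exact: prodE.
rewrite -integral12_prod_meas1// /fubini_F.
have eX : (\int[dX]_x x%:E = \int[P]_o (X o)%:E)%E.
  by rewrite /dX /distribution integral_pushforward//; exact/measurable_EFinP.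
have eY : (\int[dY]_x x%:E = \int[P]_o (Y o)%:E)%E.
  by rewrite /dY /distribution integral_pushforward//; exact/measurable_EFinP.
rewrite -eX -eY -(fineK Yfin') muleC.
rewrite -integralZl//; apply: eq_integral => x _.
under eq_integral do rewrite /f /= EFinM.
by rewrite integralZl// fineK// muleC.
Qed.

End independent_products.

Section independent_sigma_algebra.
Context {d : measure_display} {Omega : measurableType d} {R : realType}.
Variable P : probability Omega R.

(** Dynkin's pi-lambda theorem: the sets that are independent of F form a lambda
    system. *)
Lemma indep_generated (G : set (set Omega)) (F : set Omega) :
  setI_closed G -> (forall S, G S -> measurable S) -> measurable F ->
  (forall S, G S -> P (S `&` F) = (P S * P F)%E) ->
  forall S, <<s G >> S -> measurable S /\ P (S `&` F) = (P S * P F)%E.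
Proof.
move=> GI Gm mF GF.
apply: (lambda_system_subset GI (D := setT)) => //; last first.
  by move=> S GS; split; [exact: Gm|exact: GF].
have PFfin : P F \is a fin_num by exact: fin_num_measure.
split => //.
- by split; [exact: measurableT|rewrite setTI probability_setT mul1e].
- move=> A B BA [mA PA] [mB PB]; split; first exact: measurableD.
  have -> : (A `\` B) `&` F = (A `&` F) `\` (B `&` F).
    apply/seteqP; split=> y /=; first by move=> [[Ay nBy] Dy]; split=> // -[].
    by move=> [[Ay Dy] nBy]; split => //; split => // By; exact: nBy.
  have fin S : measurable S -> (P S < +oo)%E by move=> mS; rewrite ltey_eq fin_num_measure.
  have mAF : measurable (A `&` F) by exact: measurableI.
  have mBF : measurable (B `&` F) by exact: measurableI.
  rewrite (measureD mAF mBF (fin _ mAF)) (measureD mA mB (fin _ mA)).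
  have -> : A `&` F `&` (B `&` F) = B `&` F.
    by apply/seteqP; split=> y /=; [move=> [_ []]|move=> [By Fy]; do 2 split => //; exact: BA].
  have -> : A `&` B = B by rewrite setIC; exact/setIidPl.
  transitivity (P (A `&` F) - P (B `&` F))%E; first by [].
  rewrite PA PB muleBl//; last by rewrite fin_num_adde_defr// fin_num_measure.
- move=> S ndS HS; have mS k : measurable (S k) by have [] := HS k.
  have mU : measurable (\bigcup_k S k) by exact: bigcupT_measurable.
  split => //.
  have c1 : (P \o (fun k => S k `&` F)) k @[k --> \oo] --> P ((\bigcup_k S k) `&` F).
    rewrite setI_bigcupl; apply: nondecreasing_cvg_mu => //.
    - by move=> k; exact: measurableI.
    - by apply: bigcupT_measurable => k; exact: measurableI.
    - by move=> i j ij; apply/subsetPset; apply: setSI; exact/subsetPset/ndS.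
  have c2 : (P \o (fun k => S k `&` F)) k @[k --> \oo] --> (P (\bigcup_k S k) * P F)%E.
    rewrite (_ : P \o _ = fun k => (P (S k) * P F)%E); last first.
      by apply/funext => k /=; have [] := HS k.
    by apply: cvgeZr => //; exact: nondecreasing_cvg_mu.
  exact: (cvg_unique _ c1 c2).
Qed.

End independent_sigma_algebra.

(** * Moments of Poisson counts *)

Section poisson_moments.
Context {R : realType}.
Variable (l : R).
Hypothesis l_ge0 : 0 <= l.

Let p k : \bar R := poisson_prob l k [set k].

Let pE k : p k = (if 0 < l then poisson_pmf l k else (k == 0%N)%:R)%:E.
Proof.
rewrite /p /poisson_prob; case: ifP => l0.
  by rewrite esum_set1// lee_fin poisson_pmf_ge0.
rewrite diracE (_ : (0%N \in [set k]) = (k == 0%N))//.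
by apply/idP/eqP => [/set_mem ->//|->]; exact: mem_set.
Qed.

Let p_ge0 k : (0 <= p k)%E.
Proof. exact: (measure_ge0 (poisson_prob l k)). Qed.

Let p_rec k : (k.+1%:R%:E * p k.+1 = l%:E * p k)%E.
Proof.
rewrite !pE /poisson_pmf; case: ifPn => [l0|l0].
  rewrite l0.
  rewrite -!EFinM; congr EFin; rewrite factS natrM exprS.
  have k0 : k.+1%:R != 0 :> R by rewrite pnatr_eq0.
  have f0 : (k`!)%:R != 0 :> R by rewrite pnatr_eq0 -lt0n fact_gt0.
  move: k.+1%:R k0 (k`!%:R) f0 => a a0 b b0.
  by field; rewrite a0 b0.
have -> : l = 0 by apply/eqP; rewrite eq_le l_ge0 andbT leNgt.
by rewrite mul0e mule0.
Qed.

Lemma poisson_mass : (\sum_(k <oo) p k = 1)%E.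
Proof.
have <- : poisson_prob l 0 setT = 1%E by exact: (probability_setT (poisson_prob l 0)).
rewrite (_ : setT = \bigcup_(k in setT) [set k]); last first.
  by apply/seteqP; split => // k _; exists k.
rewrite (measure_bigcup (poisson_prob l 0))//; last first.
  by apply/trivIsetP => i j _ _ ij; apply/seteqP; split => // x [/= -> ji]; rewrite ji eqxx in ij.
by rewrite [RHS](eq_eseriesl (Q := xpredT))// => i; rewrite in_setT.
Qed.

Let shift (f : nat -> \bar R) : (forall k, 0 <= f k)%E -> f 0%N = 0%E ->
  (\sum_(k <oo) f k = \sum_(k <oo) f k.+1)%E.
Proof.
move=> f0 f00; rewrite (nneseries_split 0%N 1%N)//.
rewrite big_nat1 f00 add0e add0n -(nneseries_addn 1)//.
by apply: eq_eseriesr => k _; rewrite addn1.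
Qed.

Lemma poisson_mean : (\sum_(k <oo) (k%:R)%:E * p k = l%:E)%E.
Proof.
rewrite shift//; last 2 first.
- by move=> k; rewrite mule_ge0.
- by rewrite mul0e.
under eq_eseriesr do rewrite p_rec.
by rewrite nneseriesZl// poisson_mass mule1.
Qed.

Lemma poisson_square : (\sum_(k <oo) ((k%:R) ^+ 2)%:E * p k = (l + l ^+ 2)%:E)%E.
Proof.
rewrite shift//; last 2 first.
- by move=> k; rewrite mule_ge0// lee_fin sqr_ge0.
- by rewrite expr0n/= mul0e.
transitivity (\sum_(k <oo) l%:E * (k%:R%:E * p k + p k))%E.
  apply: eq_eseriesr => k _; rewrite expr2 EFinM -muleA p_rec muleCA; congr (_ * _)%E.
  by rewrite -natr1 EFinD ge0_muleDl ?mul1e// lee_fin.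
rewrite nneseriesZl; last by move=> k _; rewrite adde_ge0// mule_ge0// lee_fin.
rewrite nneseriesD//; last by move=> k _ _; rewrite mule_ge0// lee_fin.
by rewrite poisson_mean poisson_mass -EFinD -EFinM; congr EFin; ring.
Qed.

End poisson_moments.

Section random_measure.
Context {R : realType} {d : measure_display} {Omega : measurableType d}.
Context {dE : measure_display} {E : measurableType dE}.
Variables (P : probability Omega R) (D : set E) (mu : {measure set E -> \bar R}).
Variable N : R.-ker Omega ~> E.

(** Stated on an arbitrary measurable space, because neither the isometry nor
    independence depends on how jumps are parametrized. *)
Definition poisson_on : Prop :=
  (forall A, measurable A -> A `<=` D -> (mu A < +oo)%E ->
     forall k : nat, P [set o | N o A = k%:R%:E] =
       poisson_prob (fine (mu A)) k [set k]) /\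
  (forall n (A : 'I_n -> set E), (forall i, measurable (A i) /\ A i `<=` D) ->
     trivIset setT A ->
     forall C : 'I_n -> set (\bar R), (forall i, measurable (C i)) ->
     P (\bigcap_(i in setT) [set o | C i (N o (A i))]) =
     (\prod_(i < n) P [set o | C i (N o (A i))])%E).

Hypothesis NP : poisson_on.

Definition centered (A : set E) (o : Omega) : R := fine (N o A) - fine (mu A).

Lemma measurable_count A : measurable A -> measurable_fun setT (N ^~ A).
Proof. by move=> mA; exact: measurable_kernel. Qed.

Lemma measurable_fine_count A : measurable A -> measurable_fun setT (fun o => fine (N o A)).
Proof.
by move=> mA; apply: (measurableT_comp (@fine_measurable R setT measurableT)); exact: measurable_count.
Qed.

Lemma measurable_centered A : measurable A -> measurable_fun setT (centered A).
Proof. by move=> mA; apply: measurable_funB => //; exact: measurable_fine_count. Qed.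

Lemma integral_probability_cst (c : R) : (\int[P]_o c%:E = c%:E)%E.
Proof.
transitivity (c%:E * P setT)%E; first exact: integral_cst.
by rewrite probability_setT mule1.
Qed.

Section second_moment.
Variable A : set E.
Hypotheses (mA : measurable A) (AD : A `<=` D) (Afin : (mu A < +oo)%E).

Let l := fine (mu A).

Let count_law k : P [set o | N o A = k%:R%:E] = poisson_prob l k [set k].
Proof. by have [+ _] := NP; exact. Qed.

Let count_integral (h : R -> R) : measurable_fun setT h -> (forall x, 0 <= h x) ->
  (\int[P]_o (h (fine (N o A)))%:E =
   \sum_(k <oo) (h k%:R)%:E * poisson_prob l k [set k])%E.
Proof.
move=> mh h0; pose F k := [set o | N o A = k%:R%:E].
have mF k : measurable (F k).
  have -> : F k = setT `&` (N ^~ A) @^-1` [set k%:R%:E] by rewrite setTI.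
  by apply: (measurable_count mA) => //; exact: emeasurable_set1.
have tF : trivIset setT F.
  apply/trivIsetP => i j _ _ ij; apply/seteqP; split => // o [/= Fi Fj].
  move: Fi; rewrite /F /= Fj => -[] /eqP.
  by rewrite eqr_nat => /eqP ji; rewrite ji eqxx in ij.
have mU : measurable (\bigcup_k F k) by exact: bigcupT_measurable.
have PU : P (\bigcup_k F k) = 1%E.
  rewrite (measure_bigcup P) => [|k _|]; [|exact: mF|by apply: sub_trivIset tF].
  rewrite -[RHS](poisson_mass l).
  rewrite (eq_eseriesl (Q := xpredT)); last by move=> i; rewrite in_setT.
  by apply: eq_eseriesr => i _; rewrite -count_law.
have mf : measurable_fun setT (fun o => (h (fine (N o A)))%:E).
  by apply/measurable_EFinP; apply: measurableT_comp => //; exact: measurable_fine_count.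
rewrite (@ge0_negligible_integral _ _ _ P setT (~` (\bigcup_k F k)))//; last 3 first.
- exact: measurableC.
- by move=> o _; rewrite lee_fin.
- transitivity (1 - P (\bigcup_k F k))%E; first exact: probability_setC.
  by rewrite PU subee.
rewrite setTD setCK ge0_integral_bigcup//; last 2 first.
- exact: measurable_funTS.
- by move=> o _; rewrite lee_fin.
apply: eq_eseriesr => k _; rewrite -count_law -/(F k) -integral_cst//.
by apply: eq_integral => o; rewrite inE /F /= => ->.
Qed.

Let count_mean : (\int[P]_o (fine (N o A))%:E = l%:E)%E.
Proof.
rewrite -[RHS](@poisson_mean R l (fine_ge0 (measure_ge0 mu A))).
transitivity (\int[P]_o (Num.max 0 (fine (N o A)))%:E)%E.
  by apply: eq_integral => o _; rewrite max_r// fine_ge0.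
rewrite (count_integral (h := Num.max 0)).
- by apply: eq_eseriesr => k _; rewrite max_r.
- exact: measurable_maxr.
- by move=> x; rewrite le_max lexx.
Qed.

Let count_square : (\int[P]_o ((fine (N o A)) ^+ 2)%:E = (l + l ^+ 2)%:E)%E.
Proof.
rewrite -[RHS](@poisson_square R l (fine_ge0 (measure_ge0 mu A))).
by rewrite (count_integral (h := fun x => x ^+ 2))// => x; rewrite sqr_ge0.
Qed.

Let count_integrable : P.-integrable setT (EFin \o (fun o => fine (N o A))).
Proof.
apply/integrableP; split; first by apply/measurable_EFinP; exact: measurable_fine_count.
rewrite (_ : (\int[P]_o _)%E = l%:E) ?ltry// -count_mean.
by apply: eq_integral => o _; rewrite /= ger0_norm// fine_ge0.
Qed.

(** The variance of a Poisson variable is its mean: this is what turns second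
    moments of counts into the intensity. *)
Lemma centered_square : sqint P setT (centered A) = mu A.
Proof.
have -> : mu A = l%:E by rewrite fineK// ge0_fin_numE.
have me : measurable_fun setT (fun o => ((centered A o) ^+ 2)%:E).
  by apply: measurable_sq; exact: measurable_centered.
have mc : measurable_fun setT (fun o => (fine (N o A))%:E).
  by apply/measurable_EFinP; exact: measurable_fine_count.
have l0 : 0 <= 2 * l by rewrite mulr_ge0// fine_ge0.
have X0 o : (0 <= (fine (N o A))%:E)%E by rewrite lee_fin fine_ge0.
have : (\int[P]_o (((centered A o) ^+ 2)%:E + (2 * l)%:E * (fine (N o A))%:E) =
        \int[P]_o (((fine (N o A)) ^+ 2)%:E + (l ^+ 2)%:E))%E.
  apply: eq_integral => o _; rewrite -EFinM -!EFinD; congr EFin.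
  by rewrite /centered -/l; ring.
rewrite ge0_integralD//; last 3 first.
- by move=> o _; rewrite lee_fin sqr_ge0.
- by move=> o _; rewrite mule_ge0// lee_fin.
- exact: measurable_funeM.
rewrite ge0_integralD//; last 2 first.
- by apply: measurable_sq; exact: measurable_fine_count.
- by move=> o _; rewrite lee_fin sqr_ge0.
rewrite ge0_integralZl ?lee_fin// count_mean count_square integral_probability_cst.
rewrite -EFinM -EFinD => /(congr1 (fun z => z - (2 * l * l)%:E)%E).
rewrite addeK// /sqint => ->; rewrite -EFinB; congr EFin; ring.
Qed.

Lemma centered_integrable : P.-integrable setT (EFin \o centered A).
Proof.
apply: (eq_integrable _ (fun o => (fine (N o A))%:E - l%:E)%E) => //.
apply: integrableB => //; exact: finite_measure_integrable_cst.
Qed.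

Lemma centered_mean : (\int[P]_o (centered A o)%:E = 0)%E.
Proof.
transitivity (\int[P]_o ((fine (N o A))%:E - l%:E))%E.
  by apply: eq_integral => o _.
rewrite integralB_EFin//; last exact: finite_measure_integrable_cst.
by rewrite count_mean integral_probability_cst subee.
Qed.

Lemma count_ae_fin : {ae P, forall o, N o A \is a fin_num}.
Proof.
pose F k := [set o | N o A = k%:R%:E].
have mF k : measurable (F k).
  have -> : F k = setT `&` (N ^~ A) @^-1` [set k%:R%:E] by rewrite setTI.
  by apply: (measurable_count mA) => //; exact: emeasurable_set1.
have tF : trivIset setT F.
  apply/trivIsetP => i j _ _ ij; apply/seteqP; split => // o [/= Fi Fj].
  move: Fi; rewrite /F /= Fj => -[] /eqP.
  by rewrite eqr_nat => /eqP ji; rewrite ji eqxx in ij.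
have mU : measurable (\bigcup_k F k) by exact: bigcupT_measurable.
have PU : P (\bigcup_k F k) = 1%E.
  rewrite (measure_bigcup P) => [|k _|]; [|exact: mF|by apply: sub_trivIset tF].
  rewrite -[RHS](poisson_mass l).
  rewrite (eq_eseriesl (Q := xpredT)); last by move=> i; rewrite in_setT.
  by apply: eq_eseriesr => i _; rewrite -count_law.
exists (~` (\bigcup_k F k)); split; first exact: measurableC.
  transitivity (1 - P (\bigcup_k F k))%E; first exact: probability_setC.
  by rewrite PU subee.
by move=> o /= nfin [k _ Fk]; apply: nfin; rewrite Fk.
Qed.

End second_moment.

End random_measure.

(** * Independence of disjoint sets of jumps *)

Lemma ae_sub_measure_le {d : measure_display} {T : measurableType d} {R : realType}
  (mu : {measure set T -> \bar R}) (A B : set T) : measurable A -> measurable B ->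
  {ae mu, forall x, A x -> B x} -> (mu A <= mu B)%E.
Proof.
move=> mA mB [n [mn n0 sub]].
have <- : mu (B `|` n) = mu B by exact: measureU0.
apply: le_measure; rewrite ?inE//; first exact: measurableU.
move=> x Ax; have [Bx|nBx] := pselect (B x); first by left.
by right; apply: sub => /= /(_ Ax).
Qed.

Lemma measurable_forall_fin {d : measure_display} {T : measurableType d} (K : finType)
  (S : K -> set T) : (forall k, measurable (S k)) -> measurable [set x | forall k, S k x].
Proof.
move=> mS; have -> : [set x | forall k, S k x] = \bigcap_(k in [set: K]) S k.
  by apply/seteqP; split => x /= h k; [move=> _|]; exact: h.
by apply: fin_bigcap_measurable => //; exact: finite_finset.
Qed.

Section independence_of_past.
Context {R : realType} {d : measure_display} {Omega : measurableType d}.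
Context {dE : measure_display} {E : measurableType dE}.
Variables (P : probability Omega R) (D : set E) (mu : {measure set E -> \bar R}).
Variable N : R.-ker Omega ~> E.
Hypothesis mD : measurable D.
Hypothesis NP : poisson_on P D mu N.

Let count_indep_fin (K : finType) (A : K -> set E) (C : K -> set (\bar R)) :
  (forall k, measurable (A k) /\ A k `<=` D) -> trivIset setT A ->
  (forall k, measurable (C k)) ->
  P [set o | forall k, C k (N o (A k))] =
  (\prod_(k : K) P [set o | C k (N o (A k))])%E.
Proof.
move=> mA tA mC.
have [_ /(_ #|K| (A \o enum_val) _ _ (C \o enum_val))] := NP.
move=> /(_ (fun i => mA (enum_val i))).
have tA' : trivIset setT (A \o @enum_val K K).
  apply/trivIsetP => i j _ _ ij; have /trivIsetP := tA; apply => //.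
  by apply/eqP => /enum_val_inj /eqP; exact/negP.
move=> /(_ tA' (fun i => mC (enum_val i))) => e.
transitivity (P (\bigcap_(i in [set: 'I_#|K|]) [set o | C (enum_val i) (N o (A (enum_val i)))])).
  congr (P _); apply/seteqP; split => o /= h k; first by move=> _; exact: h.
  by rewrite -(enum_rankK k); exact: h.
rewrite e (reindex_onto (@enum_val K K) enum_rank)/=; last by move=> k _; exact: enum_rankK.
by apply: eq_bigl => i; rewrite enum_valK eqxx.
Qed.

(** Splitting the sets A k into their atoms outside B makes the counts of the
    atoms and of B jointly independent. *)
Lemma counts_indep (K : finType) (A : K -> set E) (C : K -> set (\bar R))
    (B : set E) (C' : set (\bar R)) :
  (forall k, [/\ measurable (A k), A k `<=` D & A k `&` B = set0]) ->
  (forall k, measurable (C k)) ->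
  measurable B -> B `<=` D -> measurable C' ->
  P ([set o | forall k, C k (N o (A k))] `&` [set o | C' (N o B)]) =
  (P [set o | forall k, C k (N o (A k))] * P [set o | C' (N o B)])%E.
Proof.
move=> mA mC mB BD mC'.
pose atom (J : {set K}) : set E :=
  D `&` ~` B `&` [set q | forall k, if k \in J then A k q else ~ A k q].
have matom J : measurable (atom J).
  apply: measurableI; first by apply: measurableI => //; exact: measurableC.
  apply: (measurable_forall_fin (S := fun k => [set q | if k \in J then A k q else ~ A k q])) => k.
  have [mAk _ _] := mA k; case: (k \in J); first exact: mAk.
  exact: measurableC.
have atomD J : atom J `<=` D by move=> q [[]].
have atom_inj J J' q : atom J q -> atom J' q -> J = J'.
  move=> [_ h] [_ h']; apply/setP => k; move: (h k) (h' k).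
  by case: (k \in J); case: (k \in J').
have tatom : trivIset setT atom.
  by apply/trivIsetP => J J' _ _ /eqP JJ'; apply/seteqP; split => // q [q1 q2]; case: JJ'; exact: atom_inj q1 q2.
have mcount S (mS : measurable S) := measurable_kernel N S mS.
have mev S (c : set (\bar R)) : measurable S -> measurable c -> measurable [set o | c (N o S)].
  by move=> mS mc; rewrite -[X in measurable X]setTI; exact: mcount.
pose G : set (set Omega) := [set S | exists2 c : {set K} -> set (\bar R),
  (forall J, measurable (c J)) & S = [set o | forall J, c J (N o (atom J))]].
have GI : setI_closed G.
  move=> _ _ [c mc ->] [c' mc' ->]; exists (fun J => c J `&` c' J).
    by move=> J; exact: measurableI.
  by apply/seteqP; split => o /=; [move=> [h h'] J; split|move=> h; split => J; have [] := h J].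
have Gm S : G S -> measurable S.
  move=> [c mc ->]; apply: (measurable_forall_fin (S := fun J => [set o | c J (N o (atom J))])) => J.
  exact: mev.
have GF S : G S -> P (S `&` [set o | C' (N o B)]) = (P S * P [set o | C' (N o B)])%E.
  move=> [c mc ->].
  pose A' (j : option {set K}) := if j is Some J then atom J else B.
  have mA' j : measurable (A' j) /\ A' j `<=` D by case: j => [J|] /=; split.
  have tA' : trivIset setT A'.
    apply/trivIsetP => -[J|] [J'|] _ _ //= JJ'; apply/seteqP; split => // q /=.
    + by move=> [q1 q2]; move/eqP: JJ'; case; congr Some; exact: atom_inj q1 q2.
    + by move=> [[[_ ?] _] ?].
    + by move=> [? [[_ ?] _]].
  pose c1 (j : option {set K}) := if j is Some J then c J else C'.
  pose c2 (j : option {set K}) := if j is Some J then c J else setT.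
  have mc1 j : measurable (c1 j) by case: j.
  have mc2 j : measurable (c2 j) by case: j => //=; exact: measurableT.
  have e1 := count_indep_fin mA' tA' mc1.
  have e2 := count_indep_fin mA' tA' mc2.
  have s1 : [set o | forall J, c J (N o (atom J))] `&` [set o | C' (N o B)] =
      [set o | forall j, c1 j (N o (A' j))].
    apply/seteqP; split => o /=; first by move=> [h h'] [J|] /=.
    by move=> h; split; [move=> J; exact: (h (Some J))|exact: (h None)].
  have s2 : [set o | forall J, c J (N o (atom J))] = [set o | forall j, c2 j (N o (A' j))].
    apply/seteqP; split => o /=; first by move=> h [J|] /=.
    by move=> h J; exact: (h (Some J)).
  rewrite s1 s2 e1 e2 [LHS](bigD1 None)//= [X in (_ = X * _)%E](bigD1 None)//=.
  have -> : [set o : Omega | True] = setT by apply/seteqP.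
  rewrite probability_setT mul1e muleC; congr (_ * _)%E.
  by apply: eq_bigr => -[J|].
have mF : measurable [set o | C' (N o B)] by exact: mev.
have [|_ //] := indep_generated GI Gm mF GF (S := [set o | forall k, C k (N o (A k))]).
have mcG J : gmeasurable_fun G setT (fun o => N o (atom J)).
  move=> _ c mc; rewrite setTI; apply: sub_sigma_algebra.
  exists (fun J' => if J' == J then c else setT).
    by move=> J'; case: ifP => // _; exact: measurableT.
  apply/seteqP; split => o /=; last by move=> /(_ J); rewrite eqxx.
  by move=> co J'; case: ifPn => // /eqP ->.
have AE k o : N o (A k) = (\sum_(J \in [set J : {set K} | k \in J]) N o (atom J))%E.
  rewrite -measure_fin_bigcup//; last 2 first.
  - exact: finite_finset.
  - exact: sub_trivIset tatom.
  congr (N o _); apply/seteqP; split => q /=.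
    move=> Akq; have [mAk AkD AkB] := mA k.
    exists [set k' | `[< A k' q >]]%SET; first by rewrite /= inE; exact/asboolP.
    split; first split; first exact: AkD.
      by move=> Bq; have : (A k `&` B) q by []; rewrite AkB.
    by move=> k'; rewrite inE; case: asboolP.
  by move=> [J /= kJ [_ /(_ k)]]; rewrite kJ.
apply: (@measurable_forall_fin _ (g_sigma_algebraType G) K (fun k => [set o | C k (N o (A k))])) => k.
have : gmeasurable_fun G setT (fun o => N o (A k)).
  under eq_fun do rewrite AE.
  by apply: (@emeasurable_fsum _ (g_sigma_algebraType G)) => //; exact: finite_finset.
move=> /(_ _ (C k) (mC k)); rewrite setTI; apply.
exact: (@measurableT _ (g_sigma_algebraType G)).
Qed.

(** Taken up to null sets, so that all versions of an integral are measurable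
    together. *)
Definition count_events (B : set E) : set (set Omega) :=
  [set S | measurable S /\ exists (K : finType) (A : K -> set E) (C : K -> set (\bar R)),
    [/\ forall k, [/\ measurable (A k), A k `<=` D & A k `&` B = set0],
        forall k, measurable (C k)
      & {ae P, forall o, S o <-> forall k, C k (N o (A k))}]].

Definition outside (B : set E) : set (set Omega) := <<s count_events B >>.

Lemma count_eventsI B : setI_closed (count_events B).
Proof.
move=> S S' [mS [K [A [C [mA mC SC]]]]] [mS' [K' [A' [C' [mA' mC' SC']]]]].
split; first exact: measurableI.
exists (K + K')%type, (fun k => match k with inl k => A k | inr k => A' k end),
  (fun k => match k with inl k => C k | inr k => C' k end); split.
- by case.
- by case.
- apply: filterS2 SC SC' => o [h1 h2] [h1' h2']; split.
    by move=> [So S'o] [k|k]; [exact: h1|exact: h1'].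
  by move=> h; split; [apply: h2 => k; exact: (h (inl k))|apply: h2' => k; exact: (h (inr k))].
Qed.

(** Finitely many counts on one side pass, by the pi-lambda theorem, to the whole
    sigma-algebra. *)
Lemma outside_indep B C' S : measurable B -> B `<=` D -> measurable C' -> outside B S ->
  measurable S /\
  P (S `&` [set o | C' (N o B)]) = (P S * P [set o | C' (N o B)])%E.
Proof.
move=> mB BD mC' oS.
have mev S0 (c : set (\bar R)) : measurable S0 -> measurable c -> measurable [set o | c (N o S0)].
  by move=> mS mc; rewrite -[X in measurable X]setTI; exact: measurable_kernel.
have mF : measurable [set o | C' (N o B)] by exact: mev.
apply: (indep_generated (@count_eventsI B)) oS => //; first by move=> S'; case.
move=> S' [mS' [K [A [C [mA mC SC]]]]].
have mX : measurable [set o | forall k, C k (N o (A k))].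
  apply: (measurable_forall_fin (S := fun k => [set o | C k (N o (A k))])) => k.
  by apply: mev => //; have [] := mA k.
rewrite (_ : P S' = P [set o | forall k, C k (N o (A k))]); last first.
  apply/eqP; rewrite eq_le; apply/andP; split.
  - apply: ae_sub_measure_le => //.
    by apply: filterS SC => o [].
  - apply: ae_sub_measure_le => //.
    by apply: filterS SC => o [].
rewrite -counts_indep//.
apply/eqP; rewrite eq_le; apply/andP; split.
- apply: ae_sub_measure_le; [exact: measurableI|exact: measurableI|].
  by apply: filterS SC => o [h1 h2] [So Fo]; split => //; exact: h1.
- apply: ae_sub_measure_le; [exact: measurableI|exact: measurableI|].
  by apply: filterS SC => o [h1 h2] [So Fo]; split => //; exact: h2.
Qed.

End independence_of_past.

(** * The isometry for simple integrands *)

Section tensor_products.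
Context {d1 d2 : measure_display} {T1 : measurableType d1} {T2 : measurableType d2}.
Context {R : realType}.
Variables (m1 : {sigma_finite_measure set T1 -> \bar R})
          (m2 : {sigma_finite_measure set T2 -> \bar R}).

(** An integrand of the form f(x) g(y) is dominated by its absolute value, whose
    integral factors by Tonelli; Fubini then applies to the signed function. *)
Lemma integral_tensor (f : T1 -> R) (g : T2 -> R) :
  m1.-integrable setT (EFin \o f) -> m2.-integrable setT (EFin \o g) ->
  (m1 \x m2)%E.-integrable setT (fun z => (f z.1 * g z.2)%:E) /\
  (\int[(m1 \x m2)%E]_z (f z.1 * g z.2)%:E =
   (\int[m1]_x (f x)%:E) * (\int[m2]_y (g y)%:E))%E.
Proof.
move=> if_ ig.
have mf : measurable_fun setT f by apply/measurable_EFinP; exact: (measurable_int m1).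
have mg : measurable_fun setT g by apply/measurable_EFinP; exact: (measurable_int m2).
have mfg : measurable_fun setT (fun z : T1 * T2 => (f z.1 * g z.2)%:E).
  apply/measurable_EFinP; by apply: measurable_funM; exact: measurableT_comp.
have [gfin gfin'] : (\int[m2]_y `|(g y)%:E|)%E \is a fin_num /\ (\int[m2]_y (g y)%:E)%E \is a fin_num.
  split; last exact: integrable_fin_num.
  by apply: integrable_fin_num => //; exact: integrable_abse.
have mnf : measurable_fun setT (fun y => `|f y|%:E).
  by apply/measurable_EFinP; exact: measurableT_comp.
have mng : measurable_fun setT (fun y => `|g y|%:E).
  by apply/measurable_EFinP; exact: measurableT_comp.
have ifg : (m1 \x m2)%E.-integrable setT (fun z => (f z.1 * g z.2)%:E).
  apply/integrable12ltyP => //.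
  have inner x : (\int[m2]_y `|(f x * g y)%:E| =
      (fine (\int[m2]_y `|(g y)%:E|))%:E * `|f x|%:E)%E.
    under eq_integral do rewrite /= normrM EFinM.
    by rewrite ge0_integralZl// (fineK gfin) muleC.
  under eq_integral do rewrite inner.
  rewrite ge0_integralZl//; last by rewrite lee_fin fine_ge0// integral_ge0.
  have /integrableP[_ fX] := if_.
  by rewrite lte_mul_pinfty// ?lee_fin ?fine_ge0 ?integral_ge0.
split => //.
rewrite -integral12_prod_meas1// /fubini_F.
rewrite -[in RHS](fineK gfin') muleC -integralZl//; apply: eq_integral => x _.
under eq_integral do rewrite /= EFinM.
by rewrite integralZl// fineK// muleC.
Qed.

End tensor_products.

Section sums_over_lists.
Context {d : measure_display} {T : measurableType d} {R : realType}.
Variables (m : {measure set T -> \bar R}) (D : set T).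
Hypothesis mD : measurable D.

Lemma eq_sum_Forall {I : Type} {V : nmodType} (Good : I -> Prop) (s : seq I) (f g : I -> V) :
  List.Forall Good s -> (forall e, Good e -> f e = g e) ->
  \sum_(e <- s) f e = \sum_(e <- s) g e.
Proof.
move=> + fg; elim => [|e s' Ge _ IH]; first by rewrite !big_nil.
by rewrite !big_cons fg// IH.
Qed.

Lemma integral_sum_Forall {I : Type} (Good : I -> Prop) (s : seq I) (f : I -> T -> R) :
  (forall e, Good e -> m.-integrable D (EFin \o f e)) -> List.Forall Good s ->
  m.-integrable D (fun t => (\sum_(e <- s) f e t)%:E) /\
  (\int[m]_(t in D) (\sum_(e <- s) f e t)%:E = \sum_(e <- s) \int[m]_(t in D) (f e t)%:E)%E.
Proof.
move=> fG; elim => [|e s' Ge _ [IH1 IH2]].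
  have e0 : (fun t : T => (\sum_(e <- [::]) f e t)%:E) = cst 0%E.
    by apply/funext => t; rewrite big_nil.
  by rewrite e0 big_nil integral0; split => //; exact: integrable0.
have e1 : (fun t : T => (\sum_(e <- e :: s') f e t)%:E) =
    (fun t => (f e t)%:E + (\sum_(e <- s') f e t)%:E)%E.
  by apply/funext => t; rewrite big_cons EFinD.
rewrite e1 big_cons -IH2; split; first by apply: integrableD => //; exact: fG.
by rewrite integralD//; exact: fG.
Qed.

(** The square is expanded into the double sum of the mixed products, which is
    how covariances of pairs of terms enter. *)
Lemma sqint_sum {I : Type} (Good : I -> Prop) (s : seq I) (f : I -> T -> R) :
  (forall e e', Good e -> Good e' -> m.-integrable D (fun t => (f e t * f e' t)%:E)) ->
  List.Forall Good s ->
  sqint m D (fun t => \sum_(e <- s) f e t) =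
  (\sum_(e <- s) \sum_(e' <- s) \int[m]_(t in D) (f e t * f e' t)%:E)%E.
Proof.
move=> fG Gs; rewrite /sqint.
under eq_integral do rewrite expr2 mulr_suml.
have [] := @integral_sum_Forall I Good s (fun e t => f e t * \sum_(e' <- s) f e' t).
- move=> e Ge; rewrite (_ : EFin \o _ = fun t => (\sum_(e' <- s) f e t * f e' t)%:E); last first.
    by apply/funext => t /=; rewrite mulr_sumr.
  by have [] := @integral_sum_Forall I Good s (fun e' t => f e t * f e' t) (fun e' => fG e e' Ge) Gs.
- exact: Gs.
move=> _ ->; apply: (eq_sum_Forall Gs) => e Ge.
have [_ <-] := @integral_sum_Forall I Good s (fun e' t => f e t * f e' t) (fun e' => fG e e' Ge) Gs.
by apply: eq_integral => t _; rewrite mulr_sumr.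
Qed.

End sums_over_lists.

Section generated_up_to_null_sets.
Context {d : measure_display} {X : measurableType d} {R : realType}.
Variables (P : {measure set X -> \bar R}) (G : set (set X)).
Hypothesis Gm : forall S, G S -> measurable S.
Hypothesis Gnull : forall S, measurable S -> P S = 0%E -> <<s G >> S.

(** S' differs from S by two measurable sets inside a null set, and those belong
    to the generated sigma-algebra. *)
Lemma ae_generated (S S' : set X) : <<s G >> S -> measurable S' ->
  {ae P, forall o, S o <-> S' o} -> <<s G >> S'.
Proof.
move=> oS mS' [n [mn n0 sub]].
have mS := sub_generated_measurable Gm oS.
have null U : measurable U -> U `<=` n -> <<s G >> U.
  move=> mU Un; apply: Gnull => //.
  by apply/eqP; rewrite eq_le measure_ge0 andbT -n0; apply: le_measure; rewrite ?inE//.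
have -> : S' = (S `|` (S' `\` S)) `\` (S `\` S').
  apply/seteqP; split => o.
    move=> S'o; split; last by move=> [_ ].
    by have [So|nSo] := pselect (S o); [left|right].
  by move=> [[So|[//]] h]; apply: contrapT => nS'; apply: h.
apply: (@measurableD _ (g_sigma_algebraType G)).
  apply: (@measurableU _ (g_sigma_algebraType G)) => //.
  apply: null; first exact: measurableD.
  by move=> o [S'o nSo]; apply: sub => /= h; apply: nSo; apply/h.
apply: null; first exact: measurableD.
by move=> o [S'o nSo]; apply: sub => /= h; apply: nSo; apply/h.
Qed.

Lemma ae_generated_fun (Z Z' : X -> R) :
  gmeasurable_fun G setT Z -> measurable_fun setT Z' ->
  {ae P, forall o, Z o = Z' o} -> gmeasurable_fun G setT Z'.
Proof.
move=> mZ mZ' ZZ' mT C mC; rewrite setTI.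
apply: (@ae_generated (Z @^-1` C)).
- by have := mZ mT C mC; rewrite setTI.
- by rewrite -[Y in measurable Y]setTI; exact: mZ'.
- by apply: filterS ZZ' => o /= ->.
Qed.

(** Approximations chosen to converge geometrically fast converge almost
    everywhere, so the limit has a version that is measurable for the small
    sigma-algebra; the null sets in that sigma-algebra allow any version. *)
Lemma generated_fun_L2_limit (L : X -> R) : measurable_fun setT L ->
  (forall eps : R, 0 < eps -> exists2 Z : X -> R, gmeasurable_fun G setT Z &
     (sqint P setT (fun o => Z o - L o)%R <= eps%:E)%E) ->
  gmeasurable_fun G setT L.
Proof.
move=> mL HL.
have e0 n : 0 < 2^-1 ^+ n :> R by rewrite exprn_gt0.
pose Z n : X -> R := projT1 (cid2 (HL _ (e0 n))).
have mZ n : gmeasurable_fun G setT (Z n) by rewrite /Z; case: cid2.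
have hZ n : (sqint P setT (fun o => Z n o - L o)%R <= (1 * 2^-1 ^+ n)%:E)%E.
  by rewrite mul1r /Z; case: cid2.
have mZ' n : measurable_fun setT (Z n).
  apply: (generated_measurable_fun Gm measurableT (mZ n)).
  exact: (@measurableT _ (g_sigma_algebraType G)).
apply: (@ae_generated_fun (fun o => rlimsup (Z ^~ o))) => //.
  exact: (@measurable_rlimsup _ (g_sigma_algebraType G)).
by apply: filterS (fast_L2_ae_cvg mZ' mL hZ) => o; exact: rlimsup_cvg.
Qed.

End generated_up_to_null_sets.

Section outside_sigma_algebra.
Context {R : realType} {d : measure_display} {Omega : measurableType d}.
Context {dE : measure_display} {E : measurableType dE}.
Variables (P : probability Omega R) (D : set E).
Variable mu : {sigma_finite_measure set E -> \bar R}.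
Variable N : R.-ker Omega ~> E.
Hypothesis mD : measurable D.
Hypothesis NP : poisson_on P D mu N.

Local Notation outside := (outside P D N).
Local Notation count_events := (count_events P D N).
Local Notation Nt := (centered mu N).
Implicit Types (A B : set E).

Let mev (S : set E) (c : set (\bar R)) : measurable S -> measurable c -> measurable [set o | c (N o S)].
Proof. by move=> mS mc; rewrite -[X in measurable X]setTI; exact: measurable_kernel. Qed.

Lemma count_outside A B : measurable A -> A `<=` D -> A `&` B = set0 ->
  gmeasurable_fun (count_events B) setT (N ^~ A).
Proof.
move=> mA AD AB _ c mc; rewrite setTI; apply: sub_sigma_algebra.
split; first exact: mev.
exists unit, (fun=> A), (fun=> c); split => //.
by apply: aeW => o; split; [move=> co []|move=> /(_ tt)].
Qed.

Lemma centered_outside A B : measurable A -> A `<=` D -> A `&` B = set0 ->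
  gmeasurable_fun (count_events B) setT (Nt A).
Proof.
move=> mA AD AB; apply: (@measurable_funB _ (g_sigma_algebraType (count_events B))) => //.
by apply: (measurableT_comp (@fine_measurable R setT measurableT)); exact: count_outside.
Qed.

Lemma outside_measurable_fun B (Z : Omega -> R) :
  gmeasurable_fun (count_events B) setT Z -> measurable_fun setT Z.
Proof.
move=> mZ; apply: (generated_measurable_fun _ _ mZ) => //; first by move=> A [].
exact: (@measurableT _ (g_sigma_algebraType (count_events B))).
Qed.

(** A null set agrees almost surely with the event that the count of the empty
    set lies in the empty set. *)
Lemma null_outside B (S : set Omega) : measurable S -> P S = 0%E -> outside B S.
Proof.
move=> mS S0; apply: sub_sigma_algebra; split => //.
exists unit, (fun=> set0), (fun=> set0); split => //.
- by move=> _; split => //; exact: set0I.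
- by exists S; split => // o /= nS; apply: contrapT => So; apply: nS; split => // /(_ tt).
Qed.

Lemma ae_outside_fun B (Z Z' : Omega -> R) :
  gmeasurable_fun (count_events B) setT Z -> measurable_fun setT Z' ->
  {ae P, forall o, Z o = Z' o} -> gmeasurable_fun (count_events B) setT Z'.
Proof. by apply: ae_generated_fun; [move=> S []|exact: null_outside]. Qed.

Let outside_expectation B (Z : Omega -> R) (h : \bar R -> R) :
  measurable B -> B `<=` D -> measurable_fun setT h ->
  gmeasurable_fun (count_events B) setT Z ->
  P.-integrable setT (EFin \o Z) -> P.-integrable setT (fun o => (h (N o B))%:E) ->
  P.-integrable setT (fun o => (Z o * h (N o B))%:E) /\
  (\int[P]_o (Z o * h (N o B))%:E = \int[P]_o (Z o)%:E * \int[P]_o (h (N o B))%:E)%E.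
Proof.
move=> mB BD mh mZ iZ ih.
apply: (@indep_expectation _ _ _ P Z (fun o => h (N o B))) => //.
- exact: outside_measurable_fun mZ.
- by apply: measurableT_comp => //; exact: measurable_kernel.
move=> C C' mC mC'.
have mhC : measurable (h @^-1` C') by rewrite -[X in measurable X]setTI; exact: mh.
have [|_] := outside_indep mD NP mB BD mhC (S := Z @^-1` C); last by [].
have := mZ (@measurableT _ (g_sigma_algebraType (count_events B))) C mC.
by rewrite setTI.
Qed.

(** Z and the centered count of B are independent, and the latter has mean 0. *)
Lemma outside_mean B (Z : Omega -> R) : measurable B -> B `<=` D -> (mu B < +oo)%E ->
  gmeasurable_fun (count_events B) setT Z -> P.-integrable setT (EFin \o Z) ->
  P.-integrable setT (fun o => (Z o * Nt B o)%:E) /\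
  (\int[P]_o (Z o * Nt B o)%:E = 0)%E.
Proof.
move=> mB BD Bfin mZ iZ.
have [] := @outside_expectation B Z (fun x => fine x - fine (mu B)) mB BD _ mZ iZ.
- by apply: measurable_funB => //; exact: fine_measurable.
- exact: (centered_integrable NP mB BD Bfin).
move=> h1 h2; split; first exact: h1.
rewrite h2 [X in (_ * X)%E](_ : _ = 0%E) ?mule0//.
exact: (centered_mean NP mB BD Bfin).
Qed.

(** Z and the squared centered count of B are independent. *)
Lemma outside_square B (Z : Omega -> R) : measurable B -> B `<=` D -> (mu B < +oo)%E ->
  gmeasurable_fun (count_events B) setT Z -> P.-integrable setT (EFin \o Z) ->
  P.-integrable setT (fun o => (Z o * (Nt B o) ^+ 2)%:E) /\
  (\int[P]_o (Z o * (Nt B o) ^+ 2)%:E = \int[P]_o (Z o)%:E * mu B)%E.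
Proof.
move=> mB BD Bfin mZ iZ.
have [] := @outside_expectation B Z (fun x => (fine x - fine (mu B)) ^+ 2) mB BD _ mZ iZ.
- by apply: measurable_funX; apply: measurable_funB => //; exact: fine_measurable.
- apply/integrableP; split.
    by apply: measurable_sq; exact: measurable_centered.
  rewrite (_ : (\int[P]_o _)%E = mu B)//.
  transitivity (sqint P setT (Nt B)); last exact: (centered_square NP).
  by apply: eq_integral => o _; rewrite gee0_abs// lee_fin sqr_ge0.
move=> h1 h2; split; first exact: h1.
etransitivity; first exact: h2.
by congr (_ * _)%E; exact: (centered_square NP).
Qed.

(** The finite part is not additive where one of the counts is infinite, which
    happens on a null set only. *)
Lemma centeredD A B : measurable A -> A `<=` D -> (mu A < +oo)%E ->
  measurable B -> B `<=` D -> (mu B < +oo)%E -> A `&` B = set0 ->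
  {ae P, forall o, Nt (A `|` B) o = Nt A o + Nt B o}.
Proof.
move=> mA AD Af mB BD Bf AB.
apply: filterS2 (count_ae_fin NP mA AD Af) (count_ae_fin NP mB BD Bf) => o fA fB.
have e1 : N o (A `|` B) = (N o A + N o B)%E by exact: measureU.
have e2 : mu (A `|` B) = (mu A + mu B)%E by exact: measureU.
have cE S : Nt S o = fine (N o S) - fine (mu S) by [].
have fmA : mu A \is a fin_num by rewrite ge0_fin_numE.
have fmB : mu B \is a fin_num by rewrite ge0_fin_numE.
by rewrite !cE e1 e2 !fineD//; ring.
Qed.

Lemma bounded_mul_integrable (Z X : Omega -> R) : measurable_fun setT Z ->
  (exists M : R, forall o, `|Z o| <= M) -> P.-integrable setT (EFin \o X) ->
  P.-integrable setT (fun o => (Z o * X o)%:E).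
Proof.
move=> mZ [M ZM] iX.
have mX : measurable_fun setT X by apply/measurable_EFinP; exact: (measurable_int P).
apply: (@le_integrable _ _ _ P setT measurableT _ (fun o => (M * `|X o|)%:E)) => //.
- by apply/measurable_EFinP; exact: measurable_funM.
- move=> o _; have M0 : 0 <= M := le_trans (normr_ge0 _) (ZM o).
  by rewrite /= lee_fin normrM [leRHS]ger0_norm ?mulr_ge0// ler_wpM2r.
- have := integrableZl measurableT M (integrable_abse iX).
  exact.
Qed.

(** Orthogonality of increments: only the common part of A and A' contributes. *)
Lemma centered_covariance A A' (Z : Omega -> R) :
  measurable A -> A `<=` D -> (mu A < +oo)%E ->
  measurable A' -> A' `<=` D -> (mu A' < +oo)%E ->
  (exists M : R, forall o, `|Z o| <= M) ->
  (forall B, measurable B -> B `<=` A' -> gmeasurable_fun (count_events B) setT Z) ->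
  P.-integrable setT (fun o => (Z o * (Nt A o * Nt A' o))%:E) /\
  (\int[P]_o (Z o * (Nt A o * Nt A' o))%:E = \int[P]_o (Z o)%:E * mu (A `&` A'))%E.
Proof.
move=> mA AD Af mA' AD' Af' bZ ZA'.
pose p := A `\` A'; pose q := A `&` A'; pose r := A' `\` A.
have mp : measurable p by exact: measurableD.
have mq : measurable q by exact: measurableI.
have mr : measurable r by exact: measurableD.
have pD : p `<=` D by apply: subset_trans AD; exact: subIsetl.
have qD : q `<=` D by apply: subset_trans AD; exact: subIsetl.
have rD : r `<=` D by apply: subset_trans AD'; exact: subIsetl.
have pf : (mu p < +oo)%E.
  by apply: le_lt_trans Af; apply: le_measure; rewrite ?inE//; exact: subIsetl.
have qf : (mu q < +oo)%E.
  by apply: le_lt_trans Af; apply: le_measure; rewrite ?inE//; exact: subIsetl.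
have rf : (mu r < +oo)%E.
  by apply: le_lt_trans Af'; apply: le_measure; rewrite ?inE//; exact: subIsetl.
have pq : p `&` q = set0 by rewrite -subset0 => x [[_ ?] []].
have pr : p `&` r = set0 by rewrite -subset0 => x [[_ ?] []].
have qr : q `&` r = set0 by rewrite -subset0 => x [[? _] []].
have Zq : gmeasurable_fun (count_events q) setT Z by apply: ZA' => //; exact: subIsetr.
have Zr : gmeasurable_fun (count_events r) setT Z by apply: ZA' => //; exact: subIsetl.
have mZ : measurable_fun setT Z by exact: outside_measurable_fun Zq.
have iZ : P.-integrable setT (EFin \o Z).
  rewrite (_ : EFin \o Z = fun o => (Z o * cst 1 o)%:E); last by apply/funext => o /=; rewrite mulr1.
  by apply: bounded_mul_integrable => //; exact: finite_measure_integrable_cst.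
have iZp : P.-integrable setT (EFin \o (fun o => Z o * Nt p o)).
  by apply: bounded_mul_integrable => //; exact: (centered_integrable NP).
have iZq : P.-integrable setT (EFin \o (fun o => Z o * Nt q o)).
  by apply: bounded_mul_integrable => //; exact: (centered_integrable NP).
have Zpq : gmeasurable_fun (count_events q) setT (fun o => Z o * Nt p o).
  apply: (@measurable_funM _ (g_sigma_algebraType (count_events q))) => //.
  exact: centered_outside.
have Zpr : gmeasurable_fun (count_events r) setT (fun o => Z o * Nt p o).
  apply: (@measurable_funM _ (g_sigma_algebraType (count_events r))) => //.
  exact: centered_outside.
have Zqr : gmeasurable_fun (count_events r) setT (fun o => Z o * Nt q o).
  apply: (@measurable_funM _ (g_sigma_algebraType (count_events r))) => //.
  exact: centered_outside.
have [i1 e1] := outside_mean mq qD qf Zpq iZp.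
have [i2 e2] := outside_mean mr rD rf Zpr iZp.
have [i3 e3] := outside_mean mr rD rf Zqr iZq.
have [i4 e4] := outside_square mq qD qf Zq iZ.
pose W o := ((Z o * Nt p o * Nt q o)%:E + (Z o * Nt p o * Nt r o)%:E +
  (Z o * Nt q o * Nt r o)%:E + (Z o * (Nt q o) ^+ 2)%:E)%E.
have iW : P.-integrable setT W by do 3 apply: integrableD => //.
have eW : (\int[P]_o W o = \int[P]_o (Z o)%:E * mu q)%E.
  rewrite /W integralD//; last by do 2 apply: integrableD => //.
  rewrite integralD//; last by apply: integrableD.
  by rewrite integralD// e1 e2 e3 e4 !add0e.
have mZA : measurable_fun setT (fun o => (Z o * (Nt A o * Nt A' o))%:E).
  apply/measurable_EFinP; apply: measurable_funM => //.
  by apply: measurable_funM; exact: measurable_centered.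
have aeW' : ae_eq P setT (fun o => (Z o * (Nt A o * Nt A' o))%:E) W.
  have -> : A = p `|` q by rewrite setUC setUIDK.
  have h1 := centeredD mp pD pf mq qD qf pq.
  have h2 := centeredD mq qD qf mr rD rf qr.
  have -> : A' = q `|` r by rewrite /q setIC setUIDK.
  apply: filterS2 h1 h2 => o -> -> _; rewrite /W -!EFinD; congr EFin; ring.
split.
  apply/integrableP; split => //.
  rewrite (@ae_eq_integral _ _ _ P setT (fun o => `|W o|)%E)//.
  - by have /integrableP[] := iW.
  - exact: measurableT_comp.
  - by apply: measurableT_comp => //; exact: (measurable_int P).
  - exact: ae_eq_abse.
rewrite (@ae_eq_integral _ _ _ P setT W)//; exact: (measurable_int P).
Qed.

(** The isometry for simple integrands. The terms are ordered by [start]; the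
    coefficients of a term and of all earlier ones depend only on what happens
    outside the support of that term. *)
Lemma simple_isometry (I : Type) (Good : I -> Prop) (start : I -> R)
    (Y : I -> Omega -> R) (A : I -> set E) (s : seq I) :
  (forall e, Good e -> [/\ measurable (A e), A e `<=` D, (mu (A e) < +oo)%E
                         & exists M : R, forall o, `|Y e o| <= M]) ->
  (forall e e', Good e -> Good e' -> start e <= start e' ->
     forall B, measurable B -> B `<=` A e' ->
       gmeasurable_fun (count_events B) setT (Y e) /\
       gmeasurable_fun (count_events B) setT (Y e')) ->
  List.Forall Good s ->
  sqint P setT (fun o => \sum_(e <- s) Y e o * Nt (A e) o) =
  sqint (P \x mu)%E (setT `*` D) (fun z => \sum_(e <- s) Y e z.1 * \1_(A e) z.2).
Proof.
move=> GA GF Gs.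
have bY e e' : Good e -> Good e' -> exists M : R, forall o, `|Y e o * Y e' o| <= M.
  move=> /GA[_ _ _ [M HM]] /GA[_ _ _ [M' HM']]; exists (M * M') => o.
  by rewrite normrM ler_pM.
have cov e e' : Good e -> Good e' ->
    P.-integrable setT (fun o => (Y e o * Nt (A e) o * (Y e' o * Nt (A e') o))%:E) /\
    (\int[P]_o (Y e o * Nt (A e) o * (Y e' o * Nt (A e') o))%:E =
     \int[P]_o (Y e o * Y e' o)%:E * mu (A e `&` A e'))%E.
  wlog ee' : e e' / start e <= start e'.
    move=> H Ge Ge'; have [ee'|/ltW ee'] := leP (start e) (start e'); first exact: H.
    have [h1 h2] := H e' e ee' Ge' Ge; split.
      by move: h1; congr (P.-integrable _ _); apply/funext => o; rewrite mulrC.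
    rewrite setIC -(eq_integral _ _ (fun o _ => congr1 EFin (mulrC (Y e' o) (Y e o)))).
    by rewrite -h2; apply: eq_integral => o _; rewrite mulrC.
  move=> Ge Ge'; have [mA AD Af _] := GA _ Ge; have [mA' AD' Af' _] := GA _ Ge'.
  have ZB B : measurable B -> B `<=` A e' ->
      gmeasurable_fun (count_events B) setT (fun o => Y e o * Y e' o).
    move=> mB BA; have [h1 h2] := GF _ _ Ge Ge' ee' B mB BA.
    exact: (@measurable_funM _ (g_sigma_algebraType (count_events B))).
  have [h1 h2] := centered_covariance mA AD Af mA' AD' Af' (bY _ _ Ge Ge') ZB.
  split; first by move: h1; congr (P.-integrable _ _); apply/funext => o; congr EFin; ring.
  by rewrite -h2; apply: eq_integral => o _; congr EFin; ring.
have mYY e e' : Good e -> Good e' -> P.-integrable setT (EFin \o (fun o => Y e o * Y e' o)).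
  move=> Ge Ge'; have [mA AD Af _] := GA _ Ge; have [mA' AD' Af' _] := GA _ Ge'.
  have mY e1 : Good e1 -> measurable_fun setT (Y e1).
    move=> Ge1; have [_ h2] := GF _ _ Ge1 Ge1 (lexx _) set0 measurable0 (@sub0set _ _).
    exact: outside_measurable_fun h2.
  rewrite (_ : EFin \o _ = fun o => ((Y e o * Y e' o) * cst 1 o)%:E); last by apply/funext => o /=; rewrite mulr1.
  apply: bounded_mul_integrable; last exact: finite_measure_integrable_cst.
    by apply: measurable_funM; exact: mY.
  exact: bY.
have mSD : measurable (setT `*` D : set (Omega * E)) by exact: measurableX.
have tens e e' : Good e -> Good e' ->
    (P \x mu)%E.-integrable (setT `*` D)
      (fun z => (Y e z.1 * \1_(A e) z.2 * (Y e' z.1 * \1_(A e') z.2))%:E) /\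
    (\int[(P \x mu)%E]_(z in setT `*` D) (Y e z.1 * \1_(A e) z.2 * (Y e' z.1 * \1_(A e') z.2))%:E =
     \int[P]_o (Y e o * Y e' o)%:E * mu (A e `&` A e'))%E.
  move=> Ge Ge'; have [mA AD Af _] := GA _ Ge; have [mA' AD' Af' _] := GA _ Ge'.
  have mAA : measurable (A e `&` A e') by exact: measurableI.
  have fAA : (mu (A e `&` A e') < +oo)%E.
    by apply: le_lt_trans Af; apply: le_measure; rewrite ?inE//; exact: subIsetl.
  have i1 : mu.-integrable setT (EFin \o (\1_(A e `&` A e') : E -> R)).
    apply/integrableP; split; first by apply/measurable_EFinP; exact: measurable_indic.
    under eq_integral do rewrite /= ger0_norm//.
    by rewrite integral_indic// setIT.
  have [h1 h2] := integral_tensor (mYY _ _ Ge Ge') i1.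
  have eE z : (Y e z.1 * Y e' z.1 * \1_(A e `&` A e') z.2)%:E =
      (Y e z.1 * \1_(A e) z.2 * (Y e' z.1 * \1_(A e') z.2))%:E.
    by rewrite indicI /=; congr EFin; ring.
  split.
    apply: (@integrableS _ _ _ (P \x mu)%E setT) => //.
    by move: h1; congr (_.-integrable _ _); apply/funext => z; exact: eE.
  transitivity (\int[(P \x mu)%E]_z (Y e z.1 * Y e' z.1 * \1_(A e `&` A e') z.2)%:E)%E; last first.
    by rewrite h2 integral_indic// setIT.
  rewrite integral_mkcond; apply: eq_integral => z _; rewrite patchE eE.
  case: ifPn => // /negP zD; rewrite indicE memNset ?mulr0 ?mul0r//.
  by move=> /AD zD'; apply: zD; apply: mem_set; split.
rewrite (sqint_sum measurableT (fun e e' Ge Ge' => (cov e e' Ge Ge').1) Gs).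
rewrite (sqint_sum mSD (fun e e' Ge Ge' => (tens e e' Ge Ge').1) Gs).
apply: (eq_sum_Forall Gs) => e Ge; apply: (eq_sum_Forall Gs) => e' Ge'.
by have [_ ->] := cov _ _ Ge Ge'; have [_ ->] := tens _ _ Ge Ge'.
Qed.

End outside_sigma_algebra.

(** * Integrals as L2 limits *)

Section tonelli_on_rectangles.
Context {d1 d2 : measure_display} {T1 : measurableType d1} {T2 : measurableType d2}.
Context {R : realType}.
Variables (m1 : {sigma_finite_measure set T1 -> \bar R})
          (m2 : {sigma_finite_measure set T2 -> \bar R}).

Let patch_measurable (D1 : set T1) (D2 : set T2) (f : T1 * T2 -> \bar R) :
  measurable D1 -> measurable D2 -> measurable_fun (D1 `*` D2) f ->
  measurable_fun setT (f \_ (D1 `*` D2)).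
Proof. by move=> mD1 mD2 mf; apply/(measurable_restrictT _ _).1 => //; exact: measurableX. Qed.

Lemma tonelli_rectangle (D1 : set T1) (D2 : set T2) (f : T1 * T2 -> \bar R) :
  measurable D1 -> measurable D2 -> measurable_fun (D1 `*` D2) f ->
  (forall z, 0 <= f z)%E ->
  (\int[(m1 \x m2)%E]_(z in D1 `*` D2) f z =
   \int[m1]_(x in D1) \int[m2]_(y in D2) f (x, y))%E.
Proof.
move=> mD1 mD2 mf f0.
rewrite integral_mkcond fubini_tonelli1//; first last.
- by move=> z; rewrite patchE; case: ifP.
- exact: patch_measurable.
rewrite [RHS]integral_mkcond; apply: eq_integral => x _.
rewrite /fubini_F patchE; case: ifPn => [/set_mem Dx|nDx].
  rewrite [RHS]integral_mkcond; apply: eq_integral => y _.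
  rewrite !patchE /=; have -> : ((x, y) \in D1 `*` D2) = (y \in D2) => //.
  by apply/idP/idP => /set_mem; [move=> [_ /=] ?; exact: mem_set|move=> Dy; apply: mem_set; split].
rewrite integral0_eq// => y _; rewrite patchE ifF//.
by apply/negP => /set_mem[/= Dx _]; move/negP: nDx; apply; exact: mem_set.
Qed.

Lemma measurable_tonelli_rectangle (D1 : set T1) (D2 : set T2) (f : T1 * T2 -> \bar R) :
  measurable D1 -> measurable D2 -> measurable_fun (D1 `*` D2) f ->
  (forall z, 0 <= f z)%E ->
  measurable_fun D1 (fun x => \int[m2]_(y in D2) f (x, y))%E.
Proof.
move=> mD1 mD2 mf f0.
have h := measurable_fun_fubini_tonelli_F (m2 := m2) (f \_ (D1 `*` D2))
  (patch_measurable mD1 mD2 mf) _.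
have {}h : measurable_fun setT (fubini_F m2 (f \_ (D1 `*` D2))).
  by apply: h => z; rewrite patchE; case: ifP.
apply: (eq_measurable_fun (fubini_F m2 (f \_ (D1 `*` D2)))); last exact: measurable_funTS.
move=> x /set_mem Dx; rewrite /fubini_F [RHS]integral_mkcond; apply: eq_integral => y _.
rewrite !patchE /=; have -> : ((x, y) \in D1 `*` D2) = (y \in D2) => //.
by apply/idP/idP => /set_mem; [move=> [_ /=] ?; exact: mem_set|move=> Dy; apply: mem_set; split].
Qed.

End tonelli_on_rectangles.

Section geometric_bounds.
Context {R : realType}.

(** Simple sums with errors eps/30 lose eps in the four triangle inequalities of
    the isometry below. *)
Lemma isometry_constant (eps K : R) : 0 < eps ->
  2 * (eps / 30) + 2 * (2 * (2 * (2 * (eps / 30) + 2 * K) + 2 * (eps / 30)) + 2 * (eps / 30))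
  <= 16 * K + eps.
Proof. lra. Qed.

Lemma geometric_step (x : R) : 0 < x -> 2 * (8^-1 * x) + 2 * x <= 4 * x.
Proof. lra. Qed.

Lemma geometric_small (eps : R) : 0 < eps ->
  exists2 n, 8^-1 ^+ n <= eps & 4 * 64 * 8^-1 ^+ n <= eps.
Proof.
move=> eps0; have : (fun n => 256 * 8^-1 ^+ n : R) @ \oo --> (0 : R).
  by apply: cvg_geometric; rewrite ger0_norm ?invr_ge0// invf_lt1 ?ltr1n.
move=> /cvgrPdist_lt /(_ _ eps0)[n _ /(_ n (leqnn n))] /=.
have e0 : 0 < 8^-1 ^+ n :> R by rewrite exprn_gt0.
rewrite sub0r normrN ger0_norm; last by rewrite mulr_ge0// ltW.
by move=> neps; exists n; lra.
Qed.

End geometric_bounds.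

Section stochastic_integral.
Context {R : realType} {d : measure_display} {Omega : measurableType d}.
Local Notation Rm := (measurableTypeR R).
Local Notation E := (Rm * (Rm * Rm))%type.
Variables (P : probability Omega R) (D : set E).
Variable mu : {sigma_finite_measure set E -> \bar R}.
Variable N : R.-ker Omega ~> E.
Hypothesis mD : measurable D.
Hypothesis NP : poisson_on P D mu N.

Local Notation elem := (@elementary R d Omega).
Implicit Types (e : elem) (s : seq elem).
Implicit Types (H : Omega -> E -> R) (I : Omega -> R).

Local Notation Q := (P \x mu)%E.
Local Notation QD := (setT `*` D).

Definition scale_elementary (c : R) e : elem :=
  Elementary (fun o => c * el_coef e o) (el_start e) (el_stop e) (el_space e) (el_jump e).

Definition simple_sum s (o : Omega) : R :=
  \sum_(e <- s) el_coef e o * centered mu N (el_support e) o.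

(** What the isometry for simple integrands requires of its terms; the second
    clause says that coefficients do not anticipate the jumps in the support. *)
Definition admissible (Good : elem -> Prop) : Prop :=
  [/\ forall e, Good e -> [/\ measurable (el_support e), el_support e `<=` D,
        (mu (el_support e) < +oo)%E & exists M : R, forall o, `|el_coef e o| <= M],
      forall e e', Good e -> Good e' -> el_start e <= el_start e' ->
        forall B, measurable B -> B `<=` el_support e' ->
        gmeasurable_fun (count_events P D N B) setT (el_coef e) /\
        gmeasurable_fun (count_events P D N B) setT (el_coef e')
    & forall c e, Good e -> Good (scale_elementary c e)].

(** Errors below every eps, rather than a sequence of approximations, make
    linearity and completeness immediate. *)
Definition integral_of (Good : elem -> Prop) H I : Prop :=
  [/\ measurable_fun setT I, measurable_fun QD (fun z => H z.1 z.2)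
    & forall eps : R, 0 < eps -> exists s, [/\ List.Forall Good s,
        (sqint Q QD (fun z => simple_integrand s z.1 z.2 - H z.1 z.2)%R <= eps%:E)%E
      & (sqint P setT (fun o => simple_sum s o - I o)%R <= eps%:E)%E]].

Lemma integral_of_sub (Good Good' : elem -> Prop) H I :
  (forall e, Good e -> Good' e) -> integral_of Good H I -> integral_of Good' H I.
Proof.
move=> GG' [mI mH HI]; split => // eps eps0; have [s [Gs h1 h2]] := HI _ eps0.
by exists s; split => //; apply: List.Forall_impl Gs.
Qed.

Variable Good : elem -> Prop.
Hypothesis GA : admissible Good.

Let mQD : measurable (QD : set (Omega * E)). Proof. exact: measurableX. Qed.

Lemma measurable_coef e : Good e -> measurable_fun setT (el_coef e).
Proof.
move=> Ge; have [_ + _] := GA.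
move=> /(_ _ _ Ge Ge (lexx _) set0 measurable0 (@sub0set _ _))[h _].
exact: outside_measurable_fun h.
Qed.

Lemma measurable_simple_sum s : List.Forall Good s -> measurable_fun setT (simple_sum s).
Proof.
rewrite /simple_sum; elim => [|e s' Ge _ IH].
  by under eq_fun do rewrite big_nil; exact: measurable_cst.
under eq_fun do rewrite big_cons; apply: measurable_funD => //.
apply: measurable_funM; first exact: measurable_coef.
by apply: measurable_centered; have [/(_ _ Ge)[]] := GA.
Qed.

Lemma measurable_simple_integrand s : List.Forall Good s ->
  measurable_fun setT (fun z : Omega * E => simple_integrand s z.1 z.2).
Proof.
rewrite /simple_integrand; elim => [|e s' Ge _ IH].
  by under eq_fun do rewrite big_nil; exact: measurable_cst.
under eq_fun do rewrite big_cons; apply: measurable_funD => //.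
apply: measurable_funM.
  by apply: measurableT_comp; [exact: measurable_coef|exact: measurable_fst].
apply: measurableT_comp; last exact: measurable_snd.
by apply: measurable_indic; have [/(_ _ Ge)[]] := GA.
Qed.

Lemma Forall_scale c s : List.Forall Good s ->
  List.Forall Good [seq scale_elementary c e | e <- s].
Proof.
by elim => [|e s' Ge _ IH] /=; constructor => //; have [_ _] := GA; apply.
Qed.

Lemma simple_sum_lin c s s' o :
  simple_sum ([seq scale_elementary c e | e <- s] ++ s') o = c * simple_sum s o + simple_sum s' o.
Proof.
rewrite /simple_sum big_cat /= big_map mulr_sumr; congr (_ + _).
by apply: eq_bigr => e _; rewrite /= mulrA.
Qed.

Lemma simple_integrand_lin c s s' o q :
  simple_integrand ([seq scale_elementary c e | e <- s] ++ s') o q =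
  c * simple_integrand s o q + simple_integrand s' o q.
Proof.
rewrite /simple_integrand big_cat /= big_map mulr_sumr; congr (_ + _).
by apply: eq_bigr => e _; rewrite /= mulrA.
Qed.

Lemma simple_sum_isometry s : List.Forall Good s ->
  sqint P setT (simple_sum s) = sqint Q QD (fun z => simple_integrand s z.1 z.2).
Proof. by have [G1 G2 _] := GA; exact: (simple_isometry mD NP G1 G2). Qed.

Let mQDs s : List.Forall Good s -> measurable_fun QD (fun z : Omega * E => simple_integrand s z.1 z.2).
Proof. by move=> Gs; apply: measurable_funTS; exact: measurable_simple_integrand. Qed.

(** The isometry passes to limits; the constant comes from using
    (a + b)^2 <= 2 a^2 + 2 b^2 as the triangle inequality. *)
Lemma integral_isometry H H' I I' (K : R) : integral_of Good H I -> integral_of Good H' I' ->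
  (sqint Q QD (fun z => H z.1 z.2 - H' z.1 z.2)%R <= K%:E)%E ->
  (sqint P setT (fun o => I o - I' o)%R <= (16 * K)%:E)%E.
Proof.
move=> [mI mH HI] [mI' mH' HI'] HK; apply/lee_addgt0Pr => eps eps0.
pose a := eps / 30.
have a0 : 0 < a by rewrite divr_gt0.
have [s [Gs hs is_]] := HI _ a0; have [s' [Gs' hs' is']] := HI' _ a0.
have GS := Forall_scale (-1) Gs'.
pose S := [seq scale_elementary (-1) e | e <- s'] ++ s.
have GSS : List.Forall Good S by apply/List.Forall_app; split.
have e1 : sqint P setT (fun o => simple_sum s o - simple_sum s' o) =
          sqint Q QD (fun z => simple_integrand s z.1 z.2 - simple_integrand s' z.1 z.2).
  rewrite (@eq_sqint _ _ _ P setT _ (simple_sum S)); last first.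
    by move=> o _; rewrite /S simple_sum_lin; ring.
  rewrite simple_sum_isometry//; apply: eq_sqint => z _.
  by rewrite /S simple_integrand_lin; ring.
have m1 := measurable_simple_sum Gs; have m2 := measurable_simple_sum Gs'.
have n1 := mQDs Gs; have n2 := mQDs Gs'.
have q1 : (sqint Q QD (fun z => simple_integrand s z.1 z.2 - H' z.1 z.2)%R <= (2 * a + 2 * K)%:E)%E.
  exact: sqint_tri_eps hs HK.
have q2 : (sqint Q QD (fun z => simple_integrand s z.1 z.2 - simple_integrand s' z.1 z.2)%R
    <= (2 * (2 * a + 2 * K) + 2 * a)%:E)%E.
  by apply: sqint_tri_eps q1 _ => //; rewrite sqint_subC.
rewrite -e1 in q2.
have q3 := sqint_tri_eps measurableT m1 m2 mI' q2 is'.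
rewrite sqint_subC in is_.
have q4 := sqint_tri_eps measurableT mI m1 mI' is_ q3.
apply: le_trans q4 _; by rewrite -EFinD lee_fin; exact: isometry_constant.
Qed.

Lemma integral_of_unique H H' I I' : integral_of Good H I -> integral_of Good H' I' ->
  sqint Q QD (fun z => H z.1 z.2 - H' z.1 z.2) = 0%E ->
  {ae P, forall o, I o = I' o}.
Proof.
move=> HI HI' HH'.
have := integral_isometry (K := 0) HI HI'; rewrite HH' lexx mulr0 => /(_ isT) h.
have [mI _ _] := HI; have [mI' _ _] := HI'.
have e0 : sqint P setT (fun o => I o - I' o) = 0%E.
  by apply/eqP; rewrite eq_le h sqint_ge0.
by have := sqint_ae_eq measurableT mI mI' e0; apply: filterS => o; apply.
Qed.

Lemma integral_of_lin a H H' I I' : integral_of Good H I -> integral_of Good H' I' ->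
  integral_of Good (fun o q => a * H o q + H' o q) (fun o => a * I o + I' o).
Proof.
move=> [mI mH HI] [mI' mH' HI']; split.
- by apply: measurable_funD => //; exact: measurable_funM.
- by apply: measurable_funD => //; exact: measurable_funM.
move=> eps eps0.
pose b := eps / (2 * a ^+ 2 + 2).
have a2 : 0 <= a ^+ 2 by exact: sqr_ge0.
have b0 : 0 < b by rewrite divr_gt0//; lra.
have bE : 2 * (a ^+ 2 * b) + 2 * b = eps.
  rewrite /b; field; apply: lt0r_neq0; lra.
have [s [Gs hs is_]] := HI _ b0; have [s' [Gs' hs' is']] := HI' _ b0.
exists ([seq scale_elementary a e | e <- s] ++ s'); split.
- by apply/List.Forall_app; split => //; exact: Forall_scale.
- have n1 := mQDs Gs; have n2 := mQDs Gs'.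
  rewrite (@eq_sqint _ _ _ Q QD _ (fun z => a * (simple_integrand s z.1 z.2 - H z.1 z.2) +
      (simple_integrand s' z.1 z.2 - H' z.1 z.2))); last first.
    by move=> z _; rewrite simple_integrand_lin; ring.
  apply: le_trans (sqintD _ _ _ _) _ => //.
  - by apply: measurable_funM => //; exact: measurable_funB.
  - exact: measurable_funB.
  rewrite sqintZ//; last exact: measurable_funB.
  rewrite -bE [leRHS]EFinD; apply: leeD.
    rewrite [leRHS]EFinM lee_pmul2l// [leRHS]EFinM.
    by apply: lee_wpmul2l; rewrite ?lee_fin.
  by rewrite [leRHS]EFinM lee_pmul2l.
- have n1 := measurable_simple_sum Gs; have n2 := measurable_simple_sum Gs'.
  rewrite (@eq_sqint _ _ _ P setT _ (fun o => a * (simple_sum s o - I o) + (simple_sum s' o - I' o))); last first.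
    by move=> z _; rewrite simple_sum_lin; ring.
  apply: le_trans (sqintD _ _ _ _) _ => //.
  - by apply: measurable_funM => //; exact: measurable_funB.
  - exact: measurable_funB.
  rewrite sqintZ//; last exact: measurable_funB.
  rewrite -bE [leRHS]EFinD; apply: leeD.
    rewrite [leRHS]EFinM lee_pmul2l// [leRHS]EFinM.
    by apply: lee_wpmul2l; rewrite ?lee_fin.
  by rewrite [leRHS]EFinM lee_pmul2l.
Qed.

(** Both the integrand and the integral may be replaced by L2 limits, because a
    simple sum close to an approximation is close to the limit. *)
Lemma integral_of_lim H I : measurable_fun setT I ->
  measurable_fun QD (fun z => H z.1 z.2) ->
  (forall eps : R, 0 < eps -> exists H' I', [/\ integral_of Good H' I',
     (sqint Q QD (fun z => H' z.1 z.2 - H z.1 z.2)%R <= eps%:E)%E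
   & (sqint P setT (fun o => I' o - I o)%R <= eps%:E)%E]) ->
  integral_of Good H I.
Proof.
move=> mI mH HH; split => // eps eps0.
have e4 : 0 < eps / 4 by rewrite divr_gt0.
have [H' [I' [[mI' mH' HI'] h1 h2]]] := HH _ e4.
have [s [Gs hs is_]] := HI' _ e4.
have ee : 2 * (eps / 4) + 2 * (eps / 4) = eps by field.
exists s; split => //; rewrite -ee.
- by apply: sqint_tri_eps hs h1 => //; exact: mQDs.
- by apply: sqint_tri_eps is_ h2 => //; exact: measurable_simple_sum.
Qed.

Lemma integral_of_ae H H' I I' : integral_of Good H I -> measurable_fun setT I' ->
  measurable_fun QD (fun z => H' z.1 z.2) ->
  sqint Q QD (fun z => H z.1 z.2 - H' z.1 z.2) = 0%E ->
  sqint P setT (fun o => I o - I' o) = 0%E -> integral_of Good H' I'.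
Proof.
move=> HI mI' mH' e1 e2; apply: integral_of_lim => // eps eps0.
by exists H, I; split => //; rewrite ?e1 ?e2 lee_fin ltW.
Qed.

(** Completeness: limits of integrands have integrals, and these are
    measurable for any sigma-algebra that makes the approximations so. *)
Lemma integral_of_complete (G : set (set Omega)) H : (forall A, G A -> measurable A) ->
  measurable_fun QD (fun z => H z.1 z.2) ->
  (forall eps : R, 0 < eps -> exists H' I', [/\ integral_of Good H' I',
     gmeasurable_fun G setT I' &
     (sqint Q QD (fun z => H' z.1 z.2 - H z.1 z.2)%R <= eps%:E)%E]) ->
  exists2 I, integral_of Good H I & gmeasurable_fun G setT I.
Proof.
move=> Gm mH HH.
have e8 n : 0 < 8^-1 ^+ n :> R by rewrite exprn_gt0.
pose HI n := cid (HH _ (e8 n)).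
pose H_ n := projT1 (HI n).
pose I_ n := projT1 (cid (projT2 (HI n))).
have HIP n : [/\ integral_of Good (H_ n) (I_ n), gmeasurable_fun G setT (I_ n) &
    (sqint Q QD (fun z => H_ n z.1 z.2 - H z.1 z.2)%R <= (8^-1 ^+ n)%:E)%E].
  exact: (projT2 (cid (projT2 (HI n)))).
have mI_ n : measurable_fun setT (I_ n) by have [[]] := HIP n.
have mH_ n : measurable_fun QD (fun z => H_ n z.1 z.2) by have [[]] := HIP n.
have stepI n : (sqint P setT (fun o => I_ n.+1 o - I_ n o)%R <= (64 * 8^-1 ^+ n)%:E)%E.
  have [i1 _ q1] := HIP n.+1; have [i0 _ q0] := HIP n.
  have q : (sqint Q QD (fun z => H_ n.+1 z.1 z.2 - H_ n z.1 z.2)%R <= (4 * 8^-1 ^+ n)%:E)%E.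
    rewrite sqint_subC in q0.
    apply: le_trans (sqint_tri_eps mQD (mH_ _) mH (mH_ _) q1 q0) _.
    by rewrite lee_fin exprS; exact: geometric_step.
  by apply: le_trans (integral_isometry i1 i0 q) _; rewrite lee_fin mulrA -natrM.
have [_ limI] := L2_complete mI_ stepI.
have mI : measurable_fun setT (fun o => rlimsup (I_ ^~ o)).
  exact: measurable_rlimsup.
exists (fun o => rlimsup (I_ ^~ o)).
  apply: integral_of_lim => // eps eps0.
  have [n n1 n2] := geometric_small eps0.
  exists (H_ n), (I_ n); have [i0 _ q0] := HIP n; split => //.
    by apply: le_trans q0 _; rewrite lee_fin.
  by rewrite sqint_subC; apply: le_trans (limI n) _; rewrite lee_fin.
apply: (@measurable_rlimsup _ (g_sigma_algebraType G)).
  exact: (@measurableT _ (g_sigma_algebraType G)).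
by move=> n; have [_] := HIP n.
Qed.

End stochastic_integral.

(** * The intensity of the jumps *)

Section sigma_finite_copies.
Context {d : measure_display} {T : measurableType d} {R : realType}.

(** A measure known to be sigma-finite, packed so that Tonelli's theorem
    applies to it. *)
Definition sigma_finite_copy (m : {measure set T -> \bar R}) (_ : sigma_finite setT m) :
  set T -> \bar R := m.

Variables (m : {measure set T -> \bar R}) (sf : sigma_finite setT m).

HB.instance Definition _ := isMeasure.Build _ _ _ (sigma_finite_copy sf)
  (measure0 m) (measure_ge0 m) (@measure_semi_sigma_additive _ _ _ m).
HB.instance Definition _ := Measure_isSigmaFinite.Build _ _ _ (sigma_finite_copy sf) sf.

Lemma sigma_finite_copyE : m = (sigma_finite_copy sf : {measure set T -> \bar R}).
Proof. exact: eq_measure. Qed.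

End sigma_finite_copies.

Section sigma_finite_products.
Context {d1 d2 : measure_display} {T1 : measurableType d1} {T2 : measurableType d2}.
Context {R : realType}.
Variables (m1 : {sigma_finite_measure set T1 -> \bar R})
          (m2 : {sigma_finite_measure set T2 -> \bar R}).

Lemma sigma_finite_product : sigma_finite setT (m1 \x m2)%E.
Proof.
have /sigma_finiteP[F [TF ndF Foo]] := sigma_finiteT m1.
have /sigma_finiteP[G [TG ndG Goo]] := sigma_finiteT m2.
exists (fun n => F n `*` G n).
  apply/seteqP; split => // -[x y] _.
  have [n _ Fnx] : (\bigcup_i F i) x by rewrite -TF.
  have [k _ Gky] : (\bigcup_i G i) y by rewrite -TG.
  exists (maxn n k) => //; split => /=.
  - by move: x Fnx; exact/subsetPset/ndF/leq_maxl.
  - by move: y Gky; exact/subsetPset/ndG/leq_maxr.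
move=> k; have [? ?] := Foo k; have [? ?] := Goo k.
split; first exact: measurableX.
by rewrite product_measure1E// lte_mul_pinfty// ge0_fin_numE.
Qed.

Definition product_sf : {sigma_finite_measure set (T1 * T2)%type -> \bar R} :=
  sigma_finite_copy sigma_finite_product.

End sigma_finite_products.

Lemma measurable_fun_pair_in {d d1 d2 : measure_display} {T : measurableType d}
  {T1 : measurableType d1} {T2 : measurableType d2} (D : set T) (f : T -> T1) (g : T -> T2) :
  measurable D -> measurable_fun D f -> measurable_fun D g ->
  measurable_fun D (fun x => (f x, g x)).
Proof.
move=> mD mf mg.
apply: (eq_measurable_fun (fun x => ((f \_ D) x, (g \_ D) x))).
  by move=> x xD; rewrite !patchE xD.
by apply: measurable_funTS; apply: measurable_fun_pair; [exact: (measurable_restrictT f mD).1|exact: (measurable_restrictT g mD).1].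
Qed.

Section bounded_functions.
Context {R : realType} {T : Type}.

Lemma bounded_onP (f : T -> R) (A : set T) :
  [bounded f x | x in A] <-> exists M : R, forall x, A x -> `|f x| <= M.
Proof.
split => [[M0 [_ HM]]|[M HM]]; first by exists (M0 + 1); apply: HM; rewrite ltrDl.
exists M; split; first exact: num_real.
by move=> x Mx y Ay; apply: le_trans (HM y Ay) (ltW Mx).
Qed.

Lemma cvge0_le (u : nat -> \bar R) (eps : R) : (forall n, 0 <= u n)%E ->
  u @ \oo --> 0%E -> 0 < eps -> \forall n \near \oo, (u n <= eps%:E)%E.
Proof.
move=> u0 /fine_cvgP[fu /cvgrPdist_le cu] e0.
near=> n.
have un : u n \is a fin_num by near: n.
rewrite -(fineK un) lee_fin; apply: le_trans (ler_norm _) _.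
by rewrite -normrN -sub0r; near: n; exact: cu.
Unshelve. all: by end_near. Qed.

Lemma cvge0_inv (u : nat -> \bar R) : (forall n, 0 <= u n <= (n.+1%:R^-1)%:E)%E ->
  u @ \oo --> 0%E.
Proof.
move=> hu; apply: (@squeeze_cvge _ _ _ _ (cst 0%E) u (fun n => (n.+1%:R^-1)%:E)).
- by apply: nearW => n; exact: hu.
- exact: cvg_cst.
- by apply: cvg_EFin; [exact: nearW|exact: cvg_harmonic].
Qed.

End bounded_functions.

Section jumps_away_from_zero.
Context {R : realType}.
Local Notation Rm := (measurableTypeR R).
Variable nu : {measure set Rm -> \bar R}.

(** The second moment only controls the jump measure away from 0; these sets
    exhaust the nonzero jumps. *)
Definition away (n : nat) : set Rm := [set z | n.+1%:R^-1 <= `|z|].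

Lemma measurable_away n : measurable (away n).
Proof.
have -> : away n = setT `&` (fun z : Rm => `|z|) @^-1` `[n.+1%:R^-1, +oo[%classic.
  by rewrite setTI; apply/seteqP; split => z /=; rewrite in_itv/= andbT.
by apply: normr_measurable => //; exact: measurable_itv.
Qed.

Hypothesis nu_moment : finite_second_moment nu.

(** Markov's inequality for the square of the jump size. *)
Lemma away_fin n : (nu (away n) < +oo)%E.
Proof.
have mA := measurable_away n.
have mz2 : measurable_fun setT (fun z : Rm => (z ^+ 2)%:E).
  by apply/measurable_EFinP; exact: measurable_funX.
have c0 : 0 <= n.+1%:R ^+ 2 :> R by rewrite sqr_ge0.
apply: (@le_lt_trans _ _ ((n.+1%:R ^+ 2)%:E * \int[nu]_z (z ^+ 2)%:E)%E); last first.
  by apply: lte_mul_pinfty.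
rewrite -ge0_integralZl//; last first.
  by move=> z _; rewrite lee_fin sqr_ge0.
have -> : nu (away n) = (\int[nu]_z (\1_(away n) z)%:E)%E by rewrite integral_indic// setIT.
apply: ge0_le_integral => //.
- by apply/measurable_EFinP; exact: measurable_indic.
- exact: measurable_funeM.
- move=> z _; rewrite -EFinM lee_fin indicE; case: (boolP (z \in away n)) => [/set_mem zn|_]; last first.
    by rewrite mulr_ge0// sqr_ge0.
  have h1 : 1 <= n.+1%:R * `|z| by rewrite -ler_pdivrMl ?ltr0n// mulr1.
  by rewrite -[z ^+ 2]real_normK ?num_real// -exprMn; exact: exprn_ege1.
Qed.

Lemma levy_sigma_finite : levy_measure nu -> sigma_finite setT nu.
Proof.
move=> [nu0 _]; exists (fun n => [set 0] `|` away n).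
  apply/seteqP; split => // z _; have [->|z0] := eqVneq z 0; first by exists 0%N => //; left.
  have z0' : 0 < `|z| by rewrite normr_gt0.
  have [n nz] : exists n, n.+1%:R^-1 < `|z|.
    by apply: (@filter_ex _ \oo); exact: (near_infty_natSinv_lt (PosNum z0')).
  by exists n => //; right; exact: ltW.
move=> n; have m0 : measurable ([set 0] : set Rm) by exact: measurable_set1.
have mA := measurable_away n.
split; first exact: measurableU.
apply: le_lt_trans (measureU2 _ m0 mA) _.
have h : (nu [set 0%R] <= 0)%E by rewrite nu0.
by apply: lte_add_pinfty; [exact: le_lt_trans h _|exact: away_fin].
Qed.

End jumps_away_from_zero.

Section jump_measure.
Context {R : realType}.
Local Notation Rm := (measurableTypeR R).
Local Notation E := (Rm * (Rm * Rm))%type.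
Local Notation leb := (@lebesgue_measure R).
Variables (T : R) (nu : {sigma_finite_measure set Rm -> \bar R}).

Definition jump_measure : {sigma_finite_measure set E -> \bar R} :=
  product_sf leb (product_sf leb nu).

Lemma intensityE A : measurable A -> intensity nu A = jump_measure A.
Proof.
move=> mA; symmetry; apply: (@product_measure_unique _ _ _ _ _ leb (product_sf leb nu) (intensity nu)) => //.
move=> B C mB mC; rewrite /intensity /= product_measure2E//; congr (_ * _)%E.
symmetry; apply: (@product_measure_unique _ _ _ _ _ leb nu (leb \x^ nu)%E) => //.
by move=> B' C' mB' mC'; rewrite /= product_measure2E.
Qed.

Lemma integral_intensity D (f : E -> \bar R) :
  (\int[intensity nu]_(q in D) f q = \int[jump_measure]_(q in D) f q)%E.
Proof. by apply: eq_measure_integral => A mA _; exact: intensityE. Qed.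

Lemma measurable_jump_domain : measurable (jump_domain T).
Proof.
apply: measurableX; first exact: measurable_itv.
by apply: measurableX; [exact: measurableT|apply: measurableC; exact: measurable_set1].
Qed.

Lemma measurable_space_time : measurable (space_time T : set (Rm * Rm)).
Proof. by apply: measurableX; [exact: measurable_itv|exact: measurableT]. Qed.

(** The intensity is a product measure, so Tonelli's theorem separates the jump
    sizes from space-time. *)
Lemma jump_integral (h : Rm * Rm -> R) : measurable_fun (space_time T) h ->
  (forall p, 0 <= h p) ->
  (\int[jump_measure]_(q in jump_domain T) (h (q.1, q.2.1) * q.2.2 ^+ 2)%:E =
   (\int[nu]_z (z ^+ 2)%:E) * \int[area]_(p in space_time T) (h p)%:E)%E.
Proof.
move=> mh h0.
have v0 : (0 <= \int[nu]_z (z ^+ 2)%:E)%E by apply: integral_ge0 => z _; rewrite lee_fin sqr_ge0.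
have mI : measurable (`[0, T]%classic : set Rm) by exact: measurable_itv.
have mZ : measurable ([set~ 0] : set Rm) by apply: measurableC; exact: measurable_set1.
have mXZ : measurable ((setT : set Rm) `*` ([set~ 0] : set Rm)) by exact: measurableX.
have mz2 : measurable_fun setT (fun z : Rm => (z ^+ 2)%:E).
  by apply/measurable_EFinP; exact: measurable_funX.
have mH : measurable_fun (jump_domain T) (fun q : E => (h (q.1, q.2.1) * q.2.2 ^+ 2)%:E).
  apply/measurable_EFinP; apply: measurable_funM.
    apply: (measurable_comp (F := space_time T)) => //; first exact: measurable_space_time.
    - by move=> _ [q [/= q1 _] <-].
    - apply: measurable_funTS; apply: measurable_fun_pair; first exact: measurable_fst.
      by apply: measurableT_comp; [exact: measurable_fst|exact: measurable_snd].
  apply: measurable_funTS; apply: measurable_funX.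
  by apply: measurableT_comp; [exact: measurable_snd|exact: measurable_snd].
rewrite (@tonelli_rectangle _ _ _ _ _ leb (product_sf leb nu))//; last first.
  by move=> q; rewrite lee_fin mulr_ge0 ?sqr_ge0.
rewrite (@tonelli_rectangle _ _ _ _ _ leb leb _ _ (fun p => (h p)%:E))//; last first.
  exact/measurable_EFinP.
have hs t : `[0, T]%classic t -> measurable_fun setT (fun x : Rm => (h (t, x))%:E).
  move=> tT; apply/measurable_EFinP.
  apply: (measurable_comp (F := space_time T)) => //; first exact: measurable_space_time.
  by move=> _ [x _ <-].
rewrite -ge0_integralZl//; last 2 first.
- apply: (measurable_tonelli_rectangle leb (D2 := setT) (f := fun p => (h p)%:E)) => //.
  exact/measurable_EFinP.
- by move=> t _; apply: integral_ge0 => x _; rewrite lee_fin.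
apply: eq_integral => t /set_mem tT.
rewrite (@tonelli_rectangle _ _ _ _ _ leb nu)//; first last.
- by move=> q; rewrite lee_fin mulr_ge0 ?sqr_ge0.
- apply/measurable_EFinP; apply: measurable_funM => /=.
    have /measurable_EFinP hst := hs t tT.
    exact: (measurable_funTS (measurableT_comp hst measurable_fst)).
  by apply: measurable_funTS; apply: measurable_funX; exact: measurable_snd.
rewrite -ge0_integralZl//; last 2 first.
- exact: hs.
- by move=> x _; rewrite lee_fin.
apply: eq_integral => x _ /=.
under eq_integral do rewrite EFinM.
rewrite ge0_integralZl//; last 3 first.
- exact: measurable_funTS.
- by move=> z _; rewrite lee_fin sqr_ge0.
- by rewrite lee_fin.
rewrite muleC; congr (_ * _)%E.
rewrite integral_mkcond; apply: eq_integral => z _; rewrite patchE.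
case: ifPn => // /negP z0; have -> : z = 0; last by rewrite expr0n.
by apply: contrapT => zn; apply: z0; apply: mem_set.
Qed.

Lemma jump_measure_box (A B C : set Rm) : measurable A -> measurable B -> measurable C ->
  jump_measure (A `*` (B `*` C)) = (leb A * (leb B * nu C))%E.
Proof.
move=> mA mB mC.
transitivity (leb A * (product_sf leb nu) (B `*` C))%E.
  by apply: product_measure1E => //; exact: measurableX.
by congr (_ * _)%E; exact: product_measure1E.
Qed.

End jump_measure.

Section elementary_classes.
Context {R : realType} {d : measure_display} {Omega : measurableType d}.
Local Notation Rm := (measurableTypeR R).
Local Notation E := (Rm * (Rm * Rm))%type.
Local Notation leb := (@lebesgue_measure R).
Variables (P : probability Omega R) (T : R) (nu : {sigma_finite_measure set Rm -> \bar R}).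
Variable N : R.-ker Omega ~> E.
Variable mu : {sigma_finite_measure set E -> \bar R}.
Hypothesis muE : forall A, measurable A -> intensity nu A = mu A.
Hypothesis NP : poisson_random_measure P T nu N.
Local Notation elem := (@elementary R d Omega).
Local Notation J := (jump_domain T).
Local Notation outside := (outside P J N).

Lemma poisson_onP : poisson_on P J mu N.
Proof.
have [N1 _ N3] := NP; split => // A mA AD Af k.
have Af' : (intensity nu A < +oo)%E by rewrite muE.
by rewrite (N1 A mA AD Af' k) (muE mA).
Qed.

Lemma compensatedE A o : measurable A -> compensated nu N A o = centered mu N A o.
Proof. by move=> mA; rewrite /compensated /centered muE. Qed.

Lemma integral_intensity_mu D (f : E -> \bar R) :
  (\int[intensity nu]_(q in D) f q = \int[mu]_(q in D) f q)%E.
Proof. by apply: eq_measure_integral => A mA _; exact: muE. Qed.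

(** Phrased through the sigma-algebra outside a set of later jumps, of which the
    count of that set is independent. *)
Definition nonanticipating (F : R -> set (set Omega)) : Prop :=
  (forall a b, a <= b -> F a `<=` F b) /\
  (forall a B, measurable B -> B `<=` J -> (forall q, B q -> a < q.1) -> F a `<=` outside B).

Lemma lebesgue_bounded_fin (B : set R) : bounded_borel B -> (leb B < +oo)%E.
Proof.
move=> [mB /bounded_onP[M BM]].
apply: (@le_lt_trans _ _ (leb `[- M, M]%classic)).
  apply: le_measure; rewrite ?inE//.
  by move=> x Bx; rewrite /= in_itv/= -ler_norml; exact: BM.
by rewrite lebesgue_measure_itv/=; case: ifP => _; rewrite ?ltry// -EFinB ltry.
Qed.

Lemma support_finite (a b : R) (B C : set R) : bounded_borel B -> measurable C -> (nu C < +oo)%E ->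
  (mu (`]a, b]%classic `*` (B `*` C)) < +oo)%E.
Proof.
move=> bB mC fC; have [mB _] := bB.
rewrite -muE; last first.
  by apply: measurableX; [exact: measurable_itv|exact: measurableX].
rewrite intensityE; last first.
  by apply: measurableX; [exact: measurable_itv|exact: measurableX].
rewrite jump_measure_box//.
have fB := lebesgue_bounded_fin bB.
apply: lte_mul_pinfty => //.
- by rewrite lebesgue_measure_itv/=; case: ifP => _; rewrite -?EFinB.
- by apply: lte_mul_pinfty => //; rewrite ge0_fin_numE.
Qed.

Lemma elementary_support (F : R -> set (set Omega)) e : is_elementary T nu F e ->
  [/\ measurable (el_support e), el_support e `<=` J & (mu (el_support e) < +oo)%E].
Proof.
move=> [[/andP[a0 ab] bT] _ bB [mC C0 fC]]; split.
- apply: measurableX; first exact: measurable_itv.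
  by apply: measurableX => //; have [] := bB.
- move=> [t [x z]] [/= + [_ Cz]]; rewrite in_itv/= => /andP[at_ tb]; split => /=.
    by rewrite in_itv/= (ltW (lt_trans a0 at_)) (le_trans tb bT).
  by split => // z0; apply: C0; rewrite -z0.
- exact: support_finite.
Qed.

(** The coefficient of a term is known at the start of its time interval, and
    nothing known then depends on the jumps in its support. *)
Lemma admissible_elementary F : nonanticipating F ->
  admissible P J mu N (is_elementary T nu F).
Proof.
move=> [Fmono Fout]; split.
- move=> e Ge; have [h1 h2 h3] := elementary_support Ge; split => //.
  have [_ [_ /bounded_onP[M HM]] _ _] := Ge; exists M => o; exact: HM.
- move=> e e' Ge Ge' ee' B mB BA.
  have [_ AD _] := elementary_support Ge'.
  have BJ : B `<=` J by apply: subset_trans AD.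
  have Bt q : B q -> el_start e' < q.1.
    by move=> /BA; case: q => t xz [/=]; rewrite in_itv/= => /andP[].
  have [_ [Fe _] _ _] := Ge; have [_ [Fe' _] _ _] := Ge'.
  split => _ C mC; rewrite setTI; apply: (Fout (el_start e')) => //.
    by apply: Fmono ee' _ _; exact: Fe.
  exact: Fe'.
- move=> c e [h1 [Fe /bounded_onP[M HM]] h3 h4]; split => //; split.
    move=> C mC; have : measurable ((fun y : R => c * y) @^-1` C).
      by rewrite -[X in measurable X]setTI; apply: mulrl_measurable.
    exact: Fe.
  apply/bounded_onP; exists (`|c| * M) => o _.
  by rewrite normrM ler_wpM2l// HM.
Qed.

(** Sequences of simple integrands converging along both integrals are the same
    as simple integrands with arbitrarily small errors; iterated integrals are
    integrals for the product by Tonelli. *)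
Lemma compensated_integralP F H I : nonanticipating F ->
  measurable_fun (setT `*` J) (fun z : Omega * E => H z.1 z.2) ->
  compensated_integral P T nu N F H I <->
  integral_of P J mu N (is_elementary T nu F) H I.
Proof.
move=> naF mH; have adm := admissible_elementary naF.
have mJ := measurable_jump_domain T.
have eqH s : List.Forall (is_elementary T nu F) s ->
    (\int[P]_o \int[intensity nu]_(q in J) ((simple_integrand s o q - H o q) ^+ 2)%:E =
     sqint (P \x mu)%E (setT `*` J) (fun z => simple_integrand s z.1 z.2 - H z.1 z.2)%R)%E.
  move=> Gs; rewrite /sqint (@tonelli_rectangle _ _ _ _ _ P mu setT J)//; last 2 first.
  - apply: measurable_sq; apply: measurable_funB => //.
    by apply: measurable_funTS; exact: (measurable_simple_integrand adm).
  - by move=> z; rewrite lee_fin sqr_ge0.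
  by apply: eq_integral => o _; rewrite integral_intensity_mu.
have eqI s : List.Forall (is_elementary T nu F) s ->
    (\int[P]_o ((simple_integral nu N s o - I o) ^+ 2)%:E =
     sqint P setT (fun o => simple_sum mu N s o - I o)%R)%E.
  move=> Gs; apply: eq_sqint => o _; congr (_ - _).
  apply: (eq_sum_Forall Gs) => e Ge; rewrite compensatedE//.
  by have [] := elementary_support Ge.
split.
  move=> [mI [S [GS SH SI]]]; split => // eps eps0.
  have [n [h1 h2]] : exists n,
     ((\int[P]_o \int[intensity nu]_(q in J) ((simple_integrand (S n) o q - H o q) ^+ 2)%:E <= eps%:E) /\
     (\int[P]_o ((simple_integral nu N (S n) o - I o) ^+ 2)%:E <= eps%:E))%E.
    have H0 n : (0 <= \int[P]_o \int[intensity nu]_(q in J) ((simple_integrand (S n) o q - H o q) ^+ 2)%:E)%E.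
      by apply: integral_ge0 => o _; apply: integral_ge0 => q _; rewrite lee_fin sqr_ge0.
    have I0 n : (0 <= \int[P]_o ((simple_integral nu N (S n) o - I o) ^+ 2)%:E)%E.
      by apply: integral_ge0 => o _; rewrite lee_fin sqr_ge0.
    have [n _ h1] := cvge0_le H0 SH eps0.
    have [m _ h2] := cvge0_le I0 SI eps0.
    by exists (maxn n m); split; [apply: h1; exact: leq_maxl|apply: h2; exact: leq_maxr].
  by exists (S n); rewrite -eqH// -eqI//; split.
move=> [mI _ HI]; split => //.
have e0 n : 0 < n.+1%:R^-1 :> R by rewrite invr_gt0.
pose S n := projT1 (cid (HI _ (e0 n))).
have SP n := projT2 (cid (HI _ (e0 n))).
exists S; split.
- by move=> n; have [] := SP n.
- apply: cvge0_inv => n; have [Gs h1 h2] := SP n.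
  by rewrite eqH// sqint_ge0.
- apply: cvge0_inv => n; have [Gs h1 h2] := SP n.
  by rewrite eqI// sqint_ge0.
Qed.

End elementary_classes.

(** * Deterministic integrals *)

Section deterministic_integrals.
Context {R : realType} {d : measure_display} {Omega : measurableType d}.
Local Notation Rm := (measurableTypeR R).
Local Notation E := (Rm * (Rm * Rm))%type.
Local Notation leb := (@lebesgue_measure R).
Variables (P : probability Omega R) (T : R) (nu : {sigma_finite_measure set Rm -> \bar R}).
Variable N : R.-ker Omega ~> E.
Variable mu : {sigma_finite_measure set E -> \bar R}.
Hypothesis muE : forall A, measurable A -> intensity nu A = mu A.
Hypothesis NP : poisson_random_measure P T nu N.
Hypothesis nu_moment : finite_second_moment nu.
Local Notation elem := (@elementary R d Omega).
Local Notation J := (jump_domain T).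
Local Notation outside := (outside P J N).
Local Notation Q := (P \x mu)%E.
Local Notation QJ := (setT `*` J).

Let NPJ : poisson_on P J mu N := poisson_onP muE NP.
Let mJ : measurable J := measurable_jump_domain T.

Definition trivial_filtration (t : R) : set (set Omega) := [set set0; setT].

Lemma nonanticipating_trivial : nonanticipating P T N trivial_filtration.
Proof.
split=> [a b _ S //|a B mB BJ Ba S [->|->]].
- exact: (@measurable0 _ (g_sigma_algebraType (count_events P J N B))).
- exact: (@measurableT _ (g_sigma_algebraType (count_events P J N B))).
Qed.

(** The time interval is recorded so that integrals over (0, t] can be seen to
    depend on the jumps up to time t only. *)
Definition det_elementary (a b : R) (e : elem) : Prop :=
  [/\ is_elementary T nu trivial_filtration e, a <= el_start e & el_stop e <= b].

Lemma admissible_trivial : admissible P J mu N (is_elementary T nu trivial_filtration).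
Proof. exact: (admissible_elementary muE nonanticipating_trivial). Qed.

Lemma admissible_det a b : admissible P J mu N (det_elementary a b).
Proof.
have [h1 h2 h3] := admissible_trivial; split.
- by move=> e [Ge _ _]; exact: h1.
- by move=> e e' [Ge _ _] [Ge' _ _]; exact: h2.
- by move=> c e [Ge ea eb]; split => //; exact: h3.
Qed.

Definition slab (a b : R) : set E := `]a, b]%classic `*` ([set: Rm] `*` [set~ 0]).

(** The supports of deterministic elementary integrands: bounded away from time
    0, bounded in space and of finite jump intensity. *)
Definition boxes (a b : R) : set (set E) :=
  [set A | exists (a' b' : R) (B C : set R), [/\ a <= a', 0 < a', b' <= b, bounded_borel B &
     [/\ measurable C, ~ C 0, (nu C < +oo)%E & A = `]a', b']%classic `*` (B `*` C)]]].

Lemma boxes_measurable a b A : boxes a b A -> measurable A.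
Proof.
move=> [a' [b' [B [C [_ _ _ [mB _] [mC _ _ ->]]]]]].
by apply: measurableX; [exact: measurable_itv|exact: measurableX].
Qed.

Lemma boxesI a b : setI_closed (boxes a b).
Proof.
move=> A1 A2 [a1 [b1 [B1 [C1 [h1 h2 h3 [mB1 bB1] [mC1 n1 f1 ->]]]]]].
move=> [a2 [b2 [B2 [C2 [k1 k2 k3 [mB2 bB2] [mC2 n2 f2 ->]]]]]].
exists (Num.max a1 a2), (Num.min b1 b2), (B1 `&` B2), (C1 `&` C2); split.
- by rewrite le_max h1.
- by rewrite lt_max h2.
- by rewrite ge_min h3.
- split; first exact: measurableI.
  apply/bounded_onP; have /bounded_onP[M HM] := bB1.
  by exists M => x [B1x _]; exact: HM.
- split.
  + exact: measurableI.
  + by move=> [].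
  + by apply: le_lt_trans f1; apply: le_measure; rewrite ?inE//; exact: measurableI.
  + apply/seteqP; split => -[t [x z]] /=; rewrite !in_itv/= gt_max le_min.
      by move=> [[/andP[t1 t2] [x1 z1]] [/andP[t3 t4] [x2 z2]]]; split; [apply/and3P; split => //; exact/andP|].
    by move=> [/and3P[/andP[t1 t2] t3 t4] [[x1 x2] [z1 z2]]]; split; split => //; apply/andP.
Qed.

(** Boxes of finite intensity filling out a product set as n grows. *)
Let slab_approx (a b a' : R) (B C : set Rm) (n : nat) : set E :=
  `]Num.max a' n.+1%:R^-1, b]%classic `*`
    ((B `&` `[- n%:R, n%:R]%classic) `*` (C `&` away n)).

Let slab_approx_box a b a' (B C : set R) n : a <= a' -> measurable B -> measurable C ->
  boxes a b (slab_approx a b a' B C n).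
Proof.
move=> aa' mB mC; have mA := @measurable_away R n.
exists (Num.max a' n.+1%:R^-1), b, (B `&` `[- n%:R, n%:R]%classic), (C `&` away n); split => //.
- by rewrite le_max aa'.
- by rewrite lt_max invr_gt0 ltr0n orbT.
- split; first by apply: measurableI => //; exact: measurable_itv.
  by apply/bounded_onP; exists n%:R => x [_ /=]; rewrite in_itv/= -ler_norml.
- split; [by apply: (@measurableI _ Rm)| | |by []].
  + by move=> [_]; rewrite /away /= normr0 leNgt invr_gt0 ltr0n.
  + by apply: le_lt_trans (away_fin nu_moment n); apply: le_measure; rewrite ?inE//; apply: (@measurableI _ Rm).
Qed.

Let slab_approxU (a b a' : R) (B C : set R) : 0 <= a' ->
  `]a', b]%classic `*` (B `*` (C `&` [set~ 0])) = \bigcup_n slab_approx a b a' B C n.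
Proof.
move=> a'0; apply/seteqP; split => -[t [x z]] /=.
  rewrite in_itv/= => -[/andP[a't tb] [Bx [Cz z0]]].
  have t0 : 0 < t by apply: le_lt_trans a't.
  have z0' : 0 < `|z| by rewrite normr_gt0; exact/eqP.
  have [n [h1 h2 h3]] : exists n, [/\ n.+1%:R^-1 < t, n.+1%:R^-1 < `|z| & `|x| <= n%:R].
    apply: (@filter_ex _ \oo); near=> n; split.
    - near: n; exact: (near_infty_natSinv_lt (PosNum t0)).
    - near: n; exact: (near_infty_natSinv_lt (PosNum z0')).
    - near: n; exact: nbhs_infty_ger.
  exists n => //; split => /=; first by rewrite in_itv/= gt_max a't h1 tb.
  by split; split => //; [rewrite /= in_itv/= -ler_norml|exact: ltW].
move=> [n _ [/=]]; rewrite in_itv/= gt_max => /andP[/andP[a't _] tb] [[Bx _] [Cz zn]].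
split; first by rewrite in_itv/= a't tb.
split => //; split => // z0; move: zn; rewrite /away /= z0 normr0 leNgt invr_gt0 ltr0n.
by [].
Unshelve. all: by end_near. Qed.

Let slab_generated (a b a' : R) (B C : set R) : 0 <= a -> a <= a' -> measurable B -> measurable C ->
  <<s boxes a b >> (`]a', b]%classic `*` (B `*` (C `&` [set~ 0]))).
Proof.
move=> a0 aa' mB mC; rewrite (slab_approxU a); last exact: le_trans aa'.
apply: (@bigcupT_measurable _ (g_sigma_algebraType (boxes a b))) => n.
by apply: sub_sigma_algebra; exact: slab_approx_box.
Qed.

Lemma measurable_slab a b : measurable (slab a b).
Proof.
apply: measurableX; first exact: measurable_itv.
by apply: measurableX => //; apply: measurableC; exact: measurable_set1.
Qed.

Lemma slab_measurable_generated a b (f : E -> R) : 0 <= a -> measurable_fun (slab a b) f ->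
  forall C, measurable C -> <<s boxes a b >> (slab a b `&` f @^-1` C).
Proof.
move=> a0 mf C mC.
have slabE : slab a b = `]a, b]%classic `*` (setT `*` (setT `&` [set~ 0])) by rewrite setTI.
have mS : @measurable _ (g_sigma_algebraType (boxes a b)) (slab a b).
  by rewrite slabE; exact: slab_generated.
have m1 : gmeasurable_fun (boxes a b) (slab a b) (fun q : E => q.1).
  apply: (measurability _ (RGenOInfty.measurableE R)) => _ [_ [c ->] <-].
  have -> : slab a b `&` (fun q : E => q.1) @^-1` `]c, +oo[%classic =
      `]Num.max a c, b]%classic `*` (setT `*` (setT `&` [set~ 0])).
    apply/seteqP; split => -[t [x z]]; rewrite /slab /= !in_itv/= gt_max andbT.
      by move=> [[/andP[h1 h2] [_ h3]] h4]; split; [rewrite h1 h4|split].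
    by move=> [/andP[/andP[h1 h2] h3] [_ [_ h4]]]; split => //; split; [rewrite h1 h3|split].
  by apply: slab_generated => //; rewrite le_max lexx.
have m2 : gmeasurable_fun (boxes a b) (slab a b) (fun q : E => q.2.1).
  move=> _ B mB.
  have -> : slab a b `&` (fun q : E => q.2.1) @^-1` B =
      `]a, b]%classic `*` (B `*` (setT `&` [set~ 0])).
    apply/seteqP; split => -[t [x z]] /=; first by move=> [[h1 [_ h3]] h4]; do 2 split => //.
    by move=> [h1 [h2 [_ h4]]]; do 2 split => //.
  exact: slab_generated.
have m3 : gmeasurable_fun (boxes a b) (slab a b) (fun q : E => q.2.2).
  move=> _ B mB.
  have -> : slab a b `&` (fun q : E => q.2.2) @^-1` B =
      `]a, b]%classic `*` (setT `*` (B `&` [set~ 0])).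
    apply/seteqP; split => -[t [x z]] /=; first by move=> [[h1 [_ h3]] h4]; do 3 split => //.
    by move=> [h1 [h2 [h3 h4]]]; do 2 split => //.
  exact: slab_generated.
have mid : @measurable_fun _ _ (g_sigma_algebraType (boxes a b)) E (slab a b) id.
  have : @measurable_fun _ _ (g_sigma_algebraType (boxes a b)) E (slab a b)
      (fun q => (q.1, (q.2.1, q.2.2))).
    apply: (@measurable_fun_pair_in _ _ _ (g_sigma_algebraType (boxes a b))) => //.
    exact: (@measurable_fun_pair_in _ _ _ (g_sigma_algebraType (boxes a b))).
  by apply: eq_measurable_fun => -[t [x z]].
have mfC := mf (measurable_slab a b) C mC.
have := mid mS _ mfC; congr (<<s _ >>).
by apply/seteqP; split => q; [move=> [_ h]|move=> h; split => //; case: h].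
Qed.

Lemma sqint0 {d' : measure_display} {X : measurableType d'} (m : {measure set X -> \bar R})
  (D : set X) (f : X -> R) : (forall x, D x -> f x = 0) -> sqint m D f = 0%E.
Proof. by move=> f0; apply: integral0_eq => x Dx; rewrite f0// expr0n. Qed.

Lemma slab_sub a b : 0 <= a -> b <= T -> slab a b `<=` J.
Proof.
move=> a0 bT [t [x z]] [/=]; rewrite in_itv/= => /andP[at_ tb] [_ z0].
by split => //=; rewrite in_itv/= (ltW (le_lt_trans a0 at_)) (le_trans tb bT).
Qed.

Lemma slab_indic_measurable a b (h : E -> R) : 0 <= a -> b <= T -> measurable_fun (slab a b) h ->
  measurable_fun J (fun q => h q * \1_(`]a, b]%classic) q.1).
Proof.
move=> a0 bT mh.
apply: (eq_measurable_fun (h \_ (slab a b))); last first.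
  by apply: measurable_funTS; exact: (measurable_restrictT h (measurable_slab a b)).1.
move=> [t [x z]] /set_mem[/= tJ [_ z0]]; rewrite patchE indicE.
have -> : ((t, (x, z)) \in slab a b) = (t \in `]a, b]%classic).
  by apply/idP/idP => /set_mem; [move=> [/= ? _]; exact: mem_set|move=> tab; apply: mem_set; split].
by case: ifPn => _; rewrite ?mulr1 ?mulr0.
Qed.

Lemma sqint_det (h : E -> R) : measurable_fun J h ->
  sqint Q QJ (fun z => h z.2) = sqint mu J h.
Proof.
move=> mh; rewrite /sqint (@tonelli_rectangle _ _ _ _ _ P mu setT J (fun z => ((h z.2) ^+ 2)%:E))//.
- by rewrite /= integral_cst//= probability_setT mule1.
- apply: measurable_sq.
  apply: (measurable_comp (F := J)) => //; first by move=> _ [z [_ Jz] <-].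
  by apply: measurable_funTS; exact: measurable_snd.
- by move=> z; rewrite lee_fin sqr_ge0.
Qed.

Lemma sqint_slab a b (h : E -> R) : 0 <= a -> b <= T -> measurable_fun (slab a b) h ->
  sqint Q QJ (fun z => h z.2 * \1_(`]a, b]%classic) z.2.1) = sqint mu (slab a b) h.
Proof.
move=> a0 bT mh; rewrite (sqint_det (slab_indic_measurable a0 bT mh)).
rewrite /sqint [LHS]integral_mkcond [RHS]integral_mkcond; apply: eq_integral => q _.
rewrite !patchE; case: ifPn => [/set_mem qJ|nJ]; last first.
  by rewrite ifF//; apply/negP => /set_mem /(slab_sub a0 bT) qJ; move/negP: nJ; apply; exact: mem_set.
have -> : (q \in slab a b) = (q.1 \in `]a, b]%classic).
  by apply/idP/idP => /set_mem; [move=> [/= ? _]; exact: mem_set|move=> tab; apply: mem_set; case: qJ => _ []].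
by rewrite indicE; case: ifPn => _; rewrite ?mulr1 ?mulr0 ?expr0n.
Qed.

Lemma measurable_snd_J (h : E -> R) : measurable_fun J h -> measurable_fun (QJ : set (Omega * E)) (fun z => h z.2).
Proof.
move=> mh; apply: (measurable_comp (F := J)) => //; first by move=> _ [z [_ Jz] <-].
by apply: measurable_funTS; exact: measurable_snd.
Qed.

(** The indicators of boxes have integrals, and every square integrable function
    is a limit of linear combinations of such indicators. *)
Lemma det_integral_exists a b (f : E -> R) : 0 <= a -> b <= T ->
  measurable_fun (slab a b) f -> (sqint mu (slab a b) f < +oo)%E ->
  exists I, integral_of P J mu N (det_elementary a b)
    (fun _ q => f q * \1_(`]a, b]%classic) q.1) I.
Proof.
move=> a0 bT mf ffin.
have adm := admissible_det a b.
pose V (g : E -> R) := measurable_fun (slab a b) g /\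
  exists I, integral_of P J mu N (det_elementary a b)
    (fun _ q => g q * \1_(`]a, b]%classic) q.1) I.
pose Dn n := slab_approx a b a setT setT n.
suff [] : V f by [].
apply: (@L2_density _ _ _ mu (slab a b) (boxes a b) Dn V).
- exact: boxesI.
- exact: boxes_measurable.
- by move=> n; apply: slab_approx_box.
- by rewrite -slab_approxU// setTI.
- move=> n k nk; apply/subsetPset => -[t [x z]] [/=]; rewrite !in_itv/= !gt_max.
  have nk' : k.+1%:R^-1 <= n.+1%:R^-1 :> R by rewrite lef_pV2 ?posrE ?ltr0n// ler_nat.
  have nk2 : n%:R <= k%:R :> R by rewrite ler_nat.
  move=> /andP[/andP[h1 h2] h3] [[_ /= h4] [_ h5]]; split.
    by rewrite /= in_itv/= gt_max h1 (le_lt_trans nk' h2) h3.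
  split; split => //=; last exact: le_trans h5.
  by move: h4; rewrite !in_itv/= -!ler_norml => /le_trans; apply.
- move=> n; suff fin A : boxes a b A -> (mu A < +oo)%E by apply: fin; apply: slab_approx_box.
  by move=> [a' [b' [B [C [_ _ _ bB [mC _ fC ->]]]]]]; exact: (support_finite muE).
- move=> A bA; split; first by apply: measurable_funTS; apply: measurable_indic; exact: boxes_measurable bA.
  have [a' [b' [B [C [aa' a'0 b'b bB [mC C0 fC AE]]]]]] := bA.
  have Aab q : (\1_A q * \1_(`]a, b]%classic) q.1 : R) = \1_A q.
    rewrite !indicE; case: (boolP (q \in A)) => [/set_mem Aq|_]; last by rewrite mul0r.
    rewrite mem_set ?mulr1//; move: Aq; rewrite AE => -[/= + _].
    by rewrite !in_itv/= => /andP[h1 h2]; rewrite (le_lt_trans aa' h1) (le_trans h2 b'b).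
  have mA := boxes_measurable bA.
  have mQA : measurable_fun (QJ : set (Omega * E)) (fun z => \1_A z.2 * \1_(`]a, b]%classic) z.2.1 : R).
    by under eq_fun do rewrite Aab; apply: measurable_snd_J; apply: measurable_funTS; exact: measurable_indic.
  have [a'b'|b'a'] := ltP a' b'.
    pose e : elem := Elementary (fun=> 1) a' b' B C.
    have Ge : det_elementary a b e.
      split => //; split => //=.
      + by rewrite a'0 a'b' (le_trans b'b bT).
      + split; last by apply/bounded_onP; exists 1 => o _; rewrite normr1.
        move=> D mD; have [D1|D1] := pselect (D 1).
          by right; apply/seteqP; split.
        by left; apply/seteqP; split.
    exists (centered mu N A); split => //.
      exact: measurable_centered.
    move=> eps eps0; exists [:: e]; split.
    + by constructor.
    + rewrite sqint0 ?lee_fin ?ltW// => z _.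
      by rewrite /simple_integrand big_seq1 /= Aab AE mul1r subrr.
    + rewrite sqint0 ?lee_fin ?ltW// => o _.
      by rewrite /simple_sum big_seq1 /= AE mul1r subrr.
  have A0 : A = set0.
    rewrite AE -subset0 => -[t xz] [/=]; rewrite in_itv/= => /andP[h1 h2].
    by have := lt_le_trans h1 (le_trans h2 b'a'); rewrite ltxx.
  exists (fun=> 0); split => //.
  move=> eps eps0; exists [::]; split => //.
  + rewrite sqint0 ?lee_fin ?ltW// => z _.
    by rewrite /simple_integrand big_nil Aab A0 indic0 subrr.
  + rewrite sqint0 ?lee_fin ?ltW// => o _.
    by rewrite /simple_sum big_nil subrr.
- move=> c g h [mg [I HI]] [mh [I' HI']]; split.
    by apply: measurable_funD => //; exact: measurable_funM.
  exists (fun o => c * I o + I' o).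
  have := integral_of_lin mJ adm c HI HI'; congr integral_of.
  by apply/funext => o; apply/funext => q; rewrite mulrA -mulrDl.
- move=> g mg Vg; split => //.
  have [|||I HI _] := integral_of_complete mJ NPJ adm (G := @measurable _ Omega)
      (H := fun _ q => g q * \1_(`]a, b]%classic) q.1) _ _ _ => //.
  + apply: (@measurable_snd_J (fun q => g q * \1_(`]a, b]%classic) q.1)).
    exact: slab_indic_measurable.
  + move=> eps eps0; have [h [mh [I HI]] [mh' ghe]] := Vg _ eps0.
    exists (fun _ q => h q * \1_(`]a, b]%classic) q.1), I; split => //.
      move=> _ C mC; rewrite setTI; apply: sub_sigma_algebra.
      by rewrite -[X in measurable X]setTI; have [mI _ _] := HI; exact: mI.
    rewrite (@eq_sqint _ _ _ Q QJ _ (fun z => (h z.2 - g z.2) * \1_(`]a, b]%classic) z.2.1)).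
      rewrite (sqint_slab (h := fun q => h q - g q))//; last exact: measurable_funB.
      by rewrite sqint_subC.
    by move=> z _; rewrite mulrBl.
  + by exists I.
- exact: slab_measurable_generated.
- exact: ffin.
Qed.

End deterministic_integrals.

(** * The noise and its filtration *)

Lemma indicator_split {R : realDomainType} (a b t : R) : 0 <= a -> a <= b ->
  \1_(`]a, b]%classic) t = \1_(`]0, b]%classic) t - \1_(`]0, a]%classic) t :> R.
Proof.
move=> a0 ab; rewrite !indicE !mem_setE !in_itv/=.
have [ta|at_] := leP t a.
  by rewrite (le_trans ta ab) !andbT subrr.
by rewrite (le_lt_trans a0 at_) /= subr0.
Qed.

Section levy_noise_and_filtration.
Context {R : realType} {d : measure_display} {Omega : measurableType d}.
Local Notation Rm := (measurableTypeR R).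
Local Notation E := (Rm * (Rm * Rm))%type.
Local Notation leb := (@lebesgue_measure R).
Variables (P : probability Omega R) (T : R) (nu : {sigma_finite_measure set Rm -> \bar R}).
Variable N : R.-ker Omega ~> E.
Variable mu : {sigma_finite_measure set E -> \bar R}.
Hypothesis muE : forall A, measurable A -> intensity nu A = mu A.
Hypothesis NP : poisson_random_measure P T nu N.
Hypothesis nu_moment : finite_second_moment nu.
Local Notation elem := (@elementary R d Omega).
Local Notation J := (jump_domain T).
Local Notation outside := (outside P J N).
Local Notation Q := (P \x mu)%E.
Local Notation QJ := (setT `*` J).

Let NPJ : poisson_on P J mu N := poisson_onP muE NP.
Let mJ : measurable J := measurable_jump_domain T.
Let mQJ : measurable (QJ : set (Omega * E)). Proof. exact: measurableX. Qed.

Lemma null_time_zero : mu ([set 0] `*` (setT `*` setT)) = 0%E.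
Proof.
rewrite -muE; last by apply: measurableX => //; exact: measurableX.
rewrite intensityE; last by apply: measurableX => //; exact: measurableX.
by rewrite jump_measure_box// lebesgue_measure_set1 mul0e.
Qed.

(** The intensity does not charge time 0, where elementary integrands vanish. *)
Lemma sqint_after_zero (H : Omega * E -> R) : measurable_fun QJ H ->
  (forall z, QJ z -> 0 < z.2.1 -> H z = 0) -> sqint Q QJ H = 0%E.
Proof.
move=> mH H0; rewrite /sqint.
have mZ : measurable (setT `*` ([set 0] `*` (setT `*` setT)) : set (Omega * E)).
  by apply: measurableX => //; apply: measurableX => //; exact: measurableX.
rewrite (@ge0_negligible_integral _ _ _ Q QJ (setT `*` ([set 0] `*` (setT `*` setT))))//.
- apply: integral0_eq => z [[_ zJ] n0]; rewrite (H0 z) ?expr0n//.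
  have [/= + _] := zJ; rewrite in_itv/= => /andP[t0 _]; rewrite lt_neqAle t0 andbT.
  by apply/eqP => t0'; apply: n0; split => //; split.
- exact: measurable_sq.
- by move=> z _; rewrite lee_fin sqr_ge0.
- rewrite /= product_measure1E//; last by apply: measurableX => //; exact: measurableX.
  by rewrite null_time_zero mule0.
Qed.

(** The time indicator is left out because it is used with [0, t], with (0, t] and
    with (a, b]. *)
Definition noise_integrand (B : set R) (q : E) : R := q.2.2 * \1_B q.2.1.

Lemma measurable_noise_integrand B : measurable (B : set Rm) ->
  measurable_fun setT (noise_integrand B).
Proof.
move=> mB; apply: measurable_funM; first by apply: measurableT_comp; exact: measurable_snd.
apply: measurableT_comp; first exact: measurable_indic.
by apply: measurableT_comp; [exact: measurable_fst|exact: measurable_snd].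
Qed.

Lemma noise_integrand_fin B : bounded_borel B -> (sqint mu J (noise_integrand B) < +oo)%E.
Proof.
move=> bB; have [mB _] := bB.
have -> : sqint mu J (noise_integrand B) =
    (\int[mu]_(q in J) ((fun p : Rm * Rm => \1_B p.2 : R) (q.1, q.2.1) * q.2.2 ^+ 2)%:E)%E.
  apply: eq_integral => q _; rewrite /noise_integrand exprMn mulrC /=; congr (_ * _)%:E.
  by rewrite indicE; case: (_ \in _); rewrite ?expr0n ?expr1n.
rewrite -(integral_intensity_mu muE) integral_intensity.
have mB2 : measurable_fun setT (fun p : Rm * Rm => \1_B p.2 : R).
  by apply: measurableT_comp; [exact: measurable_indic|exact: measurable_snd].
rewrite (@jump_integral _ T nu (fun p : Rm * Rm => \1_B p.2 : R)); last 2 first.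
- exact: measurable_funTS.
- by move=> p; rewrite indicE; case: (_ \in _).
have -> : (\int[area]_(p in space_time T) (\1_B p.2)%:E)%E = area (`[0, T]%classic `*` B : set (Rm * Rm)).
  have mTB : measurable (`[0%R, T]%classic `*` B : set (Rm * Rm)).
    by apply: measurableX => //; exact: measurable_itv.
  transitivity (\int[area]_p (\1_(`[0%R, T]%classic `*` B) p)%:E)%E; last first.
    by rewrite integral_indic// setIT.
  rewrite integral_mkcond; apply: eq_integral => -[t x] _; rewrite patchE !indicE.
  case: ifPn => [/set_mem[/= tT _]|nT].
    congr (_%:R%:E); congr nat_of_bool; apply/idP/idP => /set_mem; first by move=> Bx; apply: mem_set; split.
    by move=> [_ ?]; exact: mem_set.
  rewrite memNset// => -[tT _]; move/negP: nT; apply; exact: mem_set.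
have -> : area (`[0%R, T]%classic `*` B : set (Rm * Rm)) = (leb `[0%R, T]%classic * leb B)%E.
  by apply: product_measure1E => //; exact: measurable_itv.
have fB := lebesgue_bounded_fin bB.
apply: lte_mul_pinfty => //.
- by apply: integral_ge0 => z _; rewrite lee_fin sqr_ge0.
- rewrite ge0_fin_numE//; by apply: integral_ge0 => z _; rewrite lee_fin sqr_ge0.
apply: lte_mul_pinfty => //.
by rewrite lebesgue_measure_itv/=; case: ifP => _; rewrite -?EFinB.
Qed.

(** Square integrability of the jump sizes on a bounded set makes the density
    argument for deterministic integrands applicable. *)
Lemma increment_exists a b B : 0 <= a -> b <= T -> bounded_borel B ->
  exists I, integral_of P J mu N (det_elementary T nu a b)
    (fun _ q => noise_integrand B q * \1_(`]a, b]%classic) q.1) I.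
Proof.
move=> a0 bT bB; have [mB _] := bB.
have mf := measurable_noise_integrand mB.
apply: (det_integral_exists muE NP nu_moment a0 bT); first exact: measurable_funTS.
apply: le_lt_trans (noise_integrand_fin bB).
apply: ge0_subset_integral => //.
- exact: measurable_slab.
- by apply: measurable_sq; exact: measurable_funTS.
- by move=> q _; rewrite lee_fin sqr_ge0.
- exact: slab_sub.
Qed.

Let NA0 := nonanticipating_trivial P T N.

Let admT := admissible_trivial P T N muE.

Let mnoise t B : measurable (B : set Rm) ->
  measurable_fun QJ (fun z : Omega * E => z.2.2.2 * (\1_(`[0, t]%classic : set R) z.2.1 * \1_B z.2.2.1) : R).
Proof.
move=> mB; apply: (@measurable_snd_J _ _ _ T (fun q : E => q.2.2 * (\1_(`[0, t]%classic : set R) q.1 * \1_B q.2.1) : R)).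
apply: measurable_funTS; apply: measurable_funM.
  by apply: measurableT_comp; exact: measurable_snd.
apply: measurable_funM.
  apply: measurableT_comp; first by apply: measurable_indic; exact: measurable_itv.
  exact: measurable_fst.
apply: measurableT_comp; first exact: measurable_indic.
by apply: measurableT_comp; [exact: measurable_fst|exact: measurable_snd].
Qed.

Let mincr a b B : measurable (B : set Rm) ->
  measurable_fun QJ (fun z : Omega * E => noise_integrand B z.2 * \1_(`]a, b]%classic : set R) z.2.1 : R).
Proof.
move=> mB; apply: (@measurable_snd_J _ _ _ T (fun q : E => noise_integrand B q * \1_(`]a, b]%classic : set R) q.1 : R)).
apply: measurable_funTS; apply: measurable_funM; first exact: measurable_noise_integrand.
apply: measurableT_comp; first by apply: measurable_indic; exact: measurable_itv.
exact: measurable_fst.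
Qed.

Lemma levy_noiseP t B L : measurable (B : set Rm) ->
  levy_noise P T nu N t B L <->
  integral_of P J mu N (is_elementary T nu (@trivial_filtration _ _ _))
    (fun _ q => q.2.2 * (\1_(`[0, t]%classic : set R) q.1 * \1_B q.2.1)) L.
Proof. by move=> mB; exact: (compensated_integralP muE L NA0 (mnoise t mB)). Qed.

Let noise_eq t B (z : Omega * E) : QJ z -> 0 < z.2.1 ->
  noise_integrand B z.2 * \1_(`]0, Num.min t T]%classic : set R) z.2.1 =
  z.2.2.2 * (\1_(`[0, t]%classic : set R) z.2.1 * \1_B z.2.2.1).
Proof.
move=> [_ [/= + _]] z0; rewrite in_itv/= => /andP[_ zT].
rewrite /noise_integrand -mulrA; congr (_ * _); rewrite mulrC; congr (_ * _).
rewrite !indicE; congr (_%:R); congr nat_of_bool; apply/idP/idP => /set_mem /=;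
  by rewrite in_itv/= => h; apply: mem_set; move: h; rewrite /= in_itv/= le_min z0 (ltW z0) zT andbT.
Qed.

(** The jump domain ends at T and time 0 is a null set, so that integrating over
    [0, t] amounts to integrating over (0, min(t, T)]. *)
Lemma levy_noise_of_increment t B I : measurable (B : set Rm) ->
  integral_of P J mu N (det_elementary T nu 0 (Num.min t T))
    (fun _ q => noise_integrand B q * \1_(`]0, Num.min t T]%classic) q.1) I ->
  levy_noise P T nu N t B I.
Proof.
move=> mB HI; apply/levy_noiseP => //.
have HI' := integral_of_sub (Good' := is_elementary T nu (@trivial_filtration _ _ _)) (fun e Ge => let: And3 G _ _ := Ge in G) HI.
have [mI _ _] := HI.
apply: (integral_of_ae mJ admT HI' mI); first exact: mnoise.
- apply: sqint_after_zero; first by apply: measurable_funB; [exact: mincr|exact: mnoise].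
  by move=> z zJ z0; rewrite noise_eq// subrr.
- by rewrite sqint0// => o _; rewrite subrr.
Qed.

Lemma levy_noise_increment t B L I : measurable (B : set Rm) ->
  levy_noise P T nu N t B L ->
  integral_of P J mu N (det_elementary T nu 0 (Num.min t T))
    (fun _ q => noise_integrand B q * \1_(`]0, Num.min t T]%classic) q.1) I ->
  {ae P, forall o, L o = I o}.
Proof.
move=> mB /levy_noiseP-/(_ mB) HL HI.
have HI' := integral_of_sub (Good' := is_elementary T nu (@trivial_filtration _ _ _)) (fun e Ge => let: And3 G _ _ := Ge in G) HI.
apply: (integral_of_unique mJ NPJ admT HL HI').
apply: sqint_after_zero; first by apply: measurable_funB; [exact: mnoise|exact: mincr].
by move=> z zJ z0; rewrite noise_eq// subrr.
Qed.

(** Simple sums over boxes before time b depend on jumps before time b, and the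
    property passes to L2 limits. *)
Lemma det_integral_outside a b H I B : integral_of P J mu N (det_elementary T nu a b) H I ->
  measurable B -> B `<=` J -> (forall q, B q -> b < q.1) ->
  gmeasurable_fun (count_events P J N B) setT I.
Proof.
move=> [mI _ HI] mB BJ Bb.
apply: (generated_fun_L2_limit (P := P)) => //; first by move=> S [].
  by move=> S mS S0; exact: null_outside.
move=> eps eps0; have [s [Gs _ h]] := HI _ eps0; exists (simple_sum mu N s) => //.
elim: Gs => [|e s' [Ge _ eb] _ IH]; rewrite /simple_sum.
  under eq_fun do rewrite big_nil; exact: measurable_cst.
under eq_fun do rewrite big_cons.
have [mA AJ _] := elementary_support muE Ge.
apply: (@measurable_funD _ (g_sigma_algebraType (count_events P J N B))) => //.
apply: (@measurable_funM _ (g_sigma_algebraType (count_events P J N B))).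
  have [_ [Fe _] _ _] := Ge.
  by move=> _ C mC; rewrite setTI; have [_ NAo] := NA0; apply: (NAo b) => //; exact: Fe.
apply: centered_outside => //.
apply/seteqP; split => // -[t xz] [[/= + _] /Bb/=].
by rewrite in_itv/= => /andP[_ te] bt; have := lt_le_trans bt (le_trans te eb); rewrite ltxx.
Qed.

Definition noise_events (t : R) : set (set Omega) :=
  [set S | exists s B L C,
         [/\ 0 <= s <= t, bounded_borel B, levy_noise P T nu N s B L,
             measurable C & S = L @^-1` C] ].

Lemma noise_events_measurable t S : noise_events t S -> measurable S.
Proof.
move=> [s [B [L [C [_ _ [mL _] mC ->]]]]].
by rewrite -[X in measurable X]setTI; exact: mL.
Qed.

Lemma noise_filtration_mono a b : a <= b -> noise_filtration P T nu N a `<=` noise_filtration P T nu N b.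
Proof.
move=> ab; apply: sub_sigma_algebra2 => S [s [B [L [C [/andP[s0 sa] bB HL mC ->]]]]].
by exists s, B, L, C; split => //; rewrite s0 (le_trans sa ab).
Qed.

(** For s <= a every version of L_s(B) agrees almost surely with an integral over
    (0, s], which is determined by the jumps outside any set of later jumps. *)
Lemma noise_filtration_outside a B : measurable B -> B `<=` J -> (forall q, B q -> a < q.1) ->
  noise_filtration P T nu N a `<=` outside B.
Proof.
move=> mB BJ Ba; apply: smallest_sub; first exact: smallest_sigma_algebra.
move=> S [s [A [L [C [/andP[s0 sa] bA HL mC ->]]]]].
have [mA _] := bA.
have minT : Num.min s T <= T by rewrite ge_min lexx orbT.
have [I HI] := increment_exists (lexx 0) minT bA.
have mI : gmeasurable_fun (count_events P J N B) setT I.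
  apply: (det_integral_outside HI) => // q Bq.
  by apply: le_lt_trans (Ba q Bq); rewrite ge_min sa.
have [mL _] := HL.
have aeq := levy_noise_increment mA HL HI.
suff : gmeasurable_fun (count_events P J N B) setT L.
  move=> /(_ (@measurableT _ (g_sigma_algebraType _)) C mC); by rewrite setTI.
apply: ae_outside_fun mI mL _; apply: filterS aeq => o -> //.
Qed.

Lemma nonanticipating_noise : nonanticipating P T N (noise_filtration P T nu N).
Proof. by split; [exact: noise_filtration_mono|exact: noise_filtration_outside]. Qed.

(** The indicator of a null set is a version of the noise of the empty set. *)
Lemma null_noise_filtration t S : 0 <= t -> measurable S -> P S = 0%E -> noise_filtration P T nu N t S.
Proof.
move=> t0 mS S0; apply: sub_sigma_algebra.
have bB0 : bounded_borel (set0 : set R) by split => //; apply/bounded_onP; exists 0.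
exists 0, set0, (\1_S), [set 1]; split => //.
- by rewrite lexx.
- apply/levy_noiseP => //; split.
  + exact: measurable_indic.
  + exact: mnoise.
  + move=> eps eps0; exists [::]; split => //.
    * rewrite sqint0 ?lee_fin ?ltW// => z _.
      by rewrite /simple_integrand big_nil indic0 !mulr0 subrr.
    * apply: (@le_trans _ _ 0%E); last by rewrite lee_fin ltW.
      rewrite /sqint; have -> : (\int[P]_o ((simple_sum mu N [::] o - \1_S o) ^+ 2)%:E = \int[P]_o (\1_S o)%:E)%E.
        apply: eq_integral => o _; rewrite /simple_sum big_nil sub0r sqrrN indicE.
        by case: (_ \in _); rewrite ?expr0n ?expr1n.
      have -> : (\int[P]_o (\1_S o)%:E = P S)%E by rewrite integral_indic// setIT.
      by rewrite S0.
- apply/seteqP; split => o /=; first by move=> So; rewrite indicE mem_set.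
  by rewrite indicE; case: (boolP (o \in S)) => [/set_mem//|_ /= /eqP]; rewrite eq_sym oner_eq0.
Qed.

Lemma noise_filtration_measurable t S : noise_filtration P T nu N t S -> measurable S.
Proof. by apply: sub_generated_measurable => A; exact: noise_events_measurable. Qed.

(** The integral over (a, b] is almost surely the difference of the noises at
    times b and a. *)
Lemma increment_adapted a b B I : 0 <= a -> a <= b -> b <= T -> bounded_borel B ->
  integral_of P J mu N (det_elementary T nu a b)
    (fun _ q => noise_integrand B q * \1_(`]a, b]%classic) q.1) I ->
  gmeasurable_fun (noise_events b) setT I.
Proof.
move=> a0 ab bT bB HI; have [mB _] := bB.
have [La HLa] := increment_exists (lexx 0) (le_trans ab bT) bB.
have [Lb HLb] := increment_exists (lexx 0) bT bB.
have mL s L : 0 <= s <= b -> levy_noise P T nu N s B L -> gmeasurable_fun (noise_events b) setT L.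
  move=> sb HL _ C mC; rewrite setTI; apply: sub_sigma_algebra.
  by exists s, B, L, C; split.
have aT : a <= T := le_trans ab bT.
have HLa' : levy_noise P T nu N a B La.
  by apply: levy_noise_of_increment => //; rewrite (min_l aT).
have HLb' : levy_noise P T nu N b B Lb.
  by apply: levy_noise_of_increment => //; rewrite (min_l bT).
have mLa := mL a La ltac:(by rewrite a0 ab) HLa'.
have mLb := mL b Lb ltac:(by rewrite lexx (le_trans a0 ab)) HLb'.
have [mI _ _] := HI.
apply: (@ae_generated_fun _ _ _ P (noise_events b) _ _ (fun o => Lb o - La o)) => //.
- exact: noise_events_measurable.
- by move=> S mS S0; apply: null_noise_filtration => //; exact: le_trans ab.
- exact: (@measurable_funB _ (g_sigma_algebraType (noise_events b))).
have sub c e H K : integral_of P J mu N (det_elementary T nu c e) H K ->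
    integral_of P J mu N (is_elementary T nu (@trivial_filtration _ _ _)) H K.
  by apply: integral_of_sub => el [].
have HD := integral_of_lin mJ admT (-1) (sub _ _ _ _ HLa) (sub _ _ _ _ HLb).
have := integral_of_unique mJ NPJ admT (sub _ _ _ _ HI) HD.
rewrite sqint0 => [/(_ erefl)|].
  by apply: filterS => o ->; rewrite mulN1r addrC.
move=> z _; rewrite (indicator_split _ a0 ab) -/(noise_integrand B z.2).
by move: (noise_integrand B z.2) (\1_(`]0, b]) _) (\1_(`]0, a]) _) => x y w; ring.
Qed.

End levy_noise_and_filtration.

(** * Integrals of adapted processes *)

Lemma scale_small {R : realFieldType} (K eps : R) : 0 <= K -> 0 < eps -> K * (eps / (K + 1)) <= eps.
Proof.
by move=> K0 eps0; rewrite mulrA ler_pdivrMr ?ltr_wpDl// mulrC ler_wpM2l ?lerDl ?ler01 ?ltW.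
Qed.

Section adapted_integrands.
Context {R : realType} {d : measure_display} {Omega : measurableType d}.
Local Notation Rm := (measurableTypeR R).
Local Notation E := (Rm * (Rm * Rm))%type.
Local Notation S := (Omega * (Rm * Rm))%type.
Local Notation leb := (@lebesgue_measure R).
Variables (P : probability Omega R) (T : R) (nu : {sigma_finite_measure set Rm -> \bar R}).
Variable N : R.-ker Omega ~> E.
Variable mu : {sigma_finite_measure set E -> \bar R}.
Hypothesis muE : forall A, measurable A -> intensity nu A = mu A.
Hypothesis NP : poisson_random_measure P T nu N.
Hypothesis nu_moment : finite_second_moment nu.
Local Notation elem := (@elementary R d Omega).
Local Notation J := (jump_domain T).
Local Notation Q := (P \x mu)%E.
Local Notation QJ := (setT `*` J).
Local Notation F := (noise_filtration P T nu N).

Let NPJ : poisson_on P J mu N := poisson_onP muE NP.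
Let mJ : measurable J := measurable_jump_domain T.
Let mQJ : measurable (QJ : set (Omega * E)). Proof. exact: measurableX. Qed.
Let admF : admissible P J mu N (is_elementary T nu F) :=
  admissible_elementary muE (nonanticipating_noise muE NP nu_moment).

Definition planar : {sigma_finite_measure set (Rm * Rm)%type -> \bar R} := product_sf leb leb.
Definition process_measure := (P \x planar)%E.
Local Notation M := process_measure.

Definition jump_variance : R := fine (\int[nu]_z (z ^+ 2)%:E).

Lemma jump_varianceE : (\int[nu]_z (z ^+ 2)%:E)%E = jump_variance%:E.
Proof.
by rewrite fineK// ge0_fin_numE//; apply: integral_ge0 => z _; rewrite lee_fin sqr_ge0.
Qed.

Lemma jump_variance_ge0 : 0 <= jump_variance.
Proof. by apply: fine_ge0; apply: integral_ge0 => z _; rewrite lee_fin sqr_ge0. Qed.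

Let PD : set S := setT `*` space_time T.
Let mPD : measurable PD.
Proof. by apply: measurableX => //; exact: measurable_space_time. Qed.

Definition jump_integrand (X : S -> R) (o : Omega) (q : E) : R := X (o, (q.1, q.2.1)) * q.2.2.

Let mproj : measurable_fun setT (fun z : Omega * E => (z.1, (z.2.1, z.2.2.1)) : S).
Proof.
apply: measurable_fun_pair; first exact: measurable_fst.
apply: measurable_fun_pair.
  by apply: measurableT_comp; [exact: measurable_fst|exact: measurable_snd].
apply: measurableT_comp; first exact: measurable_fst.
by apply: measurableT_comp; exact: measurable_snd.
Qed.

Lemma measurable_jump_integrand X : measurable_fun PD X ->
  measurable_fun QJ (fun z : Omega * E => jump_integrand X z.1 z.2).
Proof.
move=> mX; apply: measurable_funM.
  apply: (measurable_comp (F := PD)) => //; first by move=> _ [z [_ [/= zT _]] <-].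
  exact: measurable_funTS.
apply: measurable_funTS; apply: measurableT_comp; first exact: measurable_snd.
by apply: measurableT_comp; exact: measurable_snd.
Qed.

(** The isometry of the Ito integral, at the level of integrands. *)
Lemma sqint_jump_integrand X : measurable_fun PD X ->
  sqint Q QJ (fun z => jump_integrand X z.1 z.2) = (jump_variance%:E * sqint M PD X)%E.
Proof.
move=> mX; rewrite /sqint.
have mX2 := measurable_sq mX.
rewrite (@tonelli_rectangle _ _ _ _ _ P mu setT J (fun z => (jump_integrand X z.1 z.2 ^+ 2)%:E))//; last 2 first.
- by apply: measurable_sq; exact: measurable_jump_integrand.
- by move=> z; rewrite lee_fin sqr_ge0.
have mst := measurable_space_time T.
rewrite [in RHS](@tonelli_rectangle _ _ _ _ _ P planar setT (space_time T) (fun z => (X z ^+ 2)%:E))//; last first.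
  by move=> z; rewrite lee_fin sqr_ge0.
rewrite -ge0_integralZl//; last 3 first.
- apply: (measurable_tonelli_rectangle planar (D2 := space_time T) (f := fun z => (X z ^+ 2)%:E)) => //.
  by move=> z; rewrite lee_fin sqr_ge0.
- by move=> o _; apply: integral_ge0 => q _; rewrite lee_fin sqr_ge0.
- by rewrite lee_fin jump_variance_ge0.
apply: eq_integral => o _ /=.
have mXo : measurable_fun (space_time T) (fun p : Rm * Rm => X (o, p)).
  apply: (measurable_comp (F := PD)) => //; last by apply: measurable_funTS; exact: pair1_measurable.
  by move=> _ [p pT <-].
have := @jump_integral _ T nu (fun p => X (o, p) ^+ 2) _ _.
rewrite jump_varianceE => <-; last 2 first.
- exact: measurable_funX.
- by move=> p; rewrite sqr_ge0.
rewrite -integral_intensity (integral_intensity_mu muE).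
by apply: eq_integral => q _; rewrite /jump_integrand /= exprMn.
Qed.

(** A factor known at time a may be moved into the coefficients of simple
    integrands supported after a; boundedness keeps the L2 errors small. *)
Lemma adapted_increment a b B Y I : 0 < a -> bounded_borel B -> bounded_adapted (F a) Y ->
  integral_of P J mu N (det_elementary T nu a b)
    (fun _ q => noise_integrand B q * \1_(`]a, b]%classic) q.1) I ->
  integral_of P J mu N (is_elementary T nu F)
    (fun o q => Y o * (noise_integrand B q * \1_(`]a, b]%classic) q.1)) (fun o => Y o * I o).
Proof.
move=> a0 bB [FY /bounded_onP[K YK]] [mI mH HI].
have mY : measurable_fun setT Y.
  by move=> _ C mC; rewrite setTI; apply: (noise_filtration_measurable (P := P) (T := T) (nu := nu) (N := N) (t := a)); exact: FY.
have mYQ : measurable_fun QJ (fun z : Omega * E => Y z.1).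
  by apply: measurable_funTS; apply: measurableT_comp => //; exact: measurable_fst.
split; [exact: measurable_funM|exact: measurable_funM|].
move=> eps eps0.
have K1 : 0 < K ^+ 2 + 1 by rewrite ltr_wpDl// sqr_ge0.
have [s [Gs hs is_]] := HI _ (divr_gt0 eps0 K1).
pose times (e : elem) : elem :=
  Elementary (fun o => Y o * el_coef e o) (el_start e) (el_stop e) (el_space e) (el_jump e).
have admD := admissible_det P T N muE a b.
have leK x y : `|y| <= K -> `|y * x| <= `|K * x| :> R.
  by move=> yK; rewrite !normrM ler_wpM2r// (le_trans yK)// ler_norm.
have epsK : ((K ^+ 2)%:E * (eps / (K ^+ 2 + 1))%:E <= eps%:E)%E.
  by rewrite -EFinM lee_fin scale_small// sqr_ge0.
have K2 : (0 <= (K ^+ 2)%:E)%E by rewrite lee_fin sqr_ge0.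
exists [seq times e | e <- s]; split.
- elim: Gs => [|e s' [Ge ae _] _ IH] /=; constructor => //.
  have [h1 [Fe /bounded_onP[L HL]] h3 h4] := Ge.
  split => //; split.
    have h : gmeasurable_fun (noise_events P T nu N (el_start e)) setT (el_coef (times e)).
      apply: (@measurable_funM _ (g_sigma_algebraType (noise_events P T nu N (el_start e)))).
        move=> _ C mC; rewrite setTI; apply: (noise_filtration_mono ae).
        exact: FY.
      move=> _ C mC; rewrite setTI; case: (Fe C mC) => ->.
        exact: (@measurable0 _ (g_sigma_algebraType (noise_events P T nu N (el_start e)))).
      exact: (@measurableT _ (g_sigma_algebraType (noise_events P T nu N (el_start e)))).
    by move=> C mC; have := h (@measurableT _ (g_sigma_algebraType _)) C mC; rewrite setTI.
  by apply/bounded_onP; exists (K * L) => o _; rewrite /= normrM ler_pM// ?YK// HL.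
- have e1 z : simple_integrand [seq times e | e <- s] z.1 z.2 = Y z.1 * simple_integrand s z.1 z.2.
    rewrite /simple_integrand big_map mulr_sumr; apply: eq_bigr => e _ /=; by rewrite mulrA.
  rewrite (@eq_sqint _ _ _ Q QJ _ (fun z => Y z.1 * (simple_integrand s z.1 z.2 - noise_integrand B z.2 * \1_(`]a, b]%classic) z.2.1))); last first.
    by move=> z _; rewrite e1 mulrBr.
  have ms : measurable_fun QJ (fun z : Omega * E => simple_integrand s z.1 z.2 - noise_integrand B z.2 * \1_(`]a, b]%classic) z.2.1).
    by apply: measurable_funB => //; apply: measurable_funTS; exact: (measurable_simple_integrand admD).
  apply: le_trans (le_sqint (g := fun z => K * (simple_integrand s z.1 z.2 - noise_integrand B z.2 * \1_(`]a, b]%classic) z.2.1)) _ _ _ _ _) _ => //.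
  + exact: measurable_funM.
  + exact: measurable_funM.
  + by move=> z _; apply: leK; exact: YK.
  rewrite sqintZ//; apply: le_trans epsK; exact: lee_wpmul2l.
- have e1 o : simple_sum mu N [seq times e | e <- s] o = Y o * simple_sum mu N s o.
    rewrite /simple_sum big_map mulr_sumr; apply: eq_bigr => e _ /=; by rewrite mulrA.
  rewrite (@eq_sqint _ _ _ P setT _ (fun o => Y o * (simple_sum mu N s o - I o))); last first.
    by move=> z _; rewrite e1 mulrBr.
  have ms : measurable_fun setT (fun o => simple_sum mu N s o - I o).
    by apply: measurable_funB => //; exact: (measurable_simple_sum admD).
  apply: le_trans (le_sqint (g := fun o => K * (simple_sum mu N s o - I o)) _ _ _ _ _) _ => //.
  + exact: measurable_funM.
  + exact: measurable_funM.
  + by move=> z _; apply: leK; exact: YK.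
  rewrite sqintZ//; apply: le_trans epsK; exact: lee_wpmul2l.
Qed.

Definition past (t : R) : set S := setT `*` (`]0, t]%classic `*` setT).

(** The boxes are kept away from time 0, as the supports of elementary
    integrands have to be; time 0 is a null set of the process measure. *)
Definition past_boxes (t : R) : set (set S) :=
  [set A | exists U a b B, [/\ F a U, 0 < a, b <= t, bounded_borel B
     & A = U `*` (`]a, b]%classic `*` B)]].

Lemma measurable_past t : measurable (past t).
Proof. by apply: measurableX => //; apply: measurableX => //; exact: measurable_itv. Qed.

Lemma past_boxes_measurable t A : past_boxes t A -> measurable A.
Proof.
move=> [U [a [b [B [FU _ _ [mB _] ->]]]]]; apply: measurableX.
  exact: noise_filtration_measurable FU.
by apply: measurableX => //; exact: measurable_itv.
Qed.

Lemma past_boxesI t : setI_closed (past_boxes t).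
Proof.
move=> A1 A2 [U1 [a1 [b1 [B1 [F1 h1 k1 [mB1 bB1] ->]]]]] [U2 [a2 [b2 [B2 [F2 h2 k2 [mB2 bB2] ->]]]]].
exists (U1 `&` U2), (Num.max a1 a2), (Num.min b1 b2), (B1 `&` B2); split.
- apply: (@measurableI _ (g_sigma_algebraType (noise_events P T nu N (Num.max a1 a2)))).
    by apply: noise_filtration_mono F1; rewrite le_max lexx.
  by apply: noise_filtration_mono F2; rewrite le_max lexx orbT.
- by rewrite lt_max h1.
- by rewrite ge_min k1.
- split; first exact: measurableI.
  apply/bounded_onP; have /bounded_onP[K HK] := bB1.
  by exists K => x [B1x _]; exact: HK.
- apply/seteqP; split => -[om [s x]] /=; rewrite !in_itv/= gt_max le_min.
    by move=> [[u1 [/andP[s1 s2] x1]] [u2 [/andP[s3 s4] x2]]]; split => //; split => //; rewrite s1 s2 s3 s4.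
  by move=> [[u1 u2] [/andP[/andP[s1 s2] /andP[s3 s4]] [x1 x2]]]; split; split => //; split => //; apply/andP.
Qed.

Let Dn t n : set S := setT `*` (`]n.+1%:R^-1, t]%classic `*` `[- n%:R, n%:R]%classic).

Let bounded_itvcc (n : nat) : bounded_borel (`[- n%:R, n%:R]%classic : set R).
Proof.
split; first exact: measurable_itv.
by apply/bounded_onP; exists n%:R => x /=; rewrite in_itv/= -ler_norml.
Qed.

Let Dn_box t n : past_boxes t (Dn t n).
Proof.
exists setT, (n.+1%:R^-1), t, (`[- n%:R, n%:R]%classic); split => //.
exact: (@measurableT _ (g_sigma_algebraType (noise_events P T nu N n.+1%:R^-1))).
Qed.

Let DnU t : past t = \bigcup_n Dn t n.
Proof.
apply/seteqP; split => -[om [s x]] /=.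
  move=> [_ [/= + _]]; rewrite in_itv/= => /andP[s0 st].
  have [n [h1 h3]] : exists n, n.+1%:R^-1 < s /\ `|x| <= n%:R.
    apply: (@filter_ex _ \oo); near=> n; split.
    - near: n; exact: (near_infty_natSinv_lt (PosNum s0)).
    - near: n; exact: nbhs_infty_ger.
  exists n => //; split => //; split => /=; rewrite in_itv/= ?h1//.
  by rewrite -ler_norml.
move=> [n _ [_ [/= + _]]]; rewrite in_itv/= => /andP[h1 h2]; split => //; split => //=.
by rewrite in_itv/= h2 (lt_trans _ h1).
Unshelve. all: by end_near. Qed.

Lemma past_generated t : <<s past_boxes t >> (past t).
Proof.
rewrite DnU; apply: (@bigcupT_measurable _ (g_sigma_algebraType (past_boxes t))) => n.
by apply: sub_sigma_algebra; exact: Dn_box.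
Qed.

Lemma past_sub t : t <= T -> past t `<=` PD.
Proof.
move=> tT [om [s x]] [_ [/= + _]]; rewrite in_itv/= => /andP[s0 st].
by split => //; split => //=; rewrite in_itv/= (ltW s0) (le_trans st tT).
Qed.

Lemma planar_box (A B : set Rm) : measurable A -> measurable B ->
  planar (A `*` B) = (leb A * leb B)%E.
Proof. exact: product_measure1E. Qed.

Lemma process_measure_box (U : set Omega) (A B : set Rm) : measurable U -> measurable A ->
  measurable B -> M (U `*` (A `*` B)) = (P U * (leb A * leb B))%E.
Proof.
move=> mU mA mB; rewrite -planar_box//.
by apply: product_measure1E => //; exact: measurableX.
Qed.

Lemma past_restrict t (X : S -> R) : t <= T -> measurable_fun (past t) X ->
  measurable_fun PD (fun p => X p * \1_(`]0, t]%classic) p.2.1).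
Proof.
move=> tT mX; apply: (eq_measurable_fun (X \_ (past t))); last first.
  by apply: measurable_funTS; exact: (measurable_restrictT X (measurable_past t)).1.
move=> [om [s x]] _; rewrite patchE indicE.
have -> : ((om, (s, x)) \in past t) = (s \in `]0, t]%classic).
  by apply/idP/idP => /set_mem; [move=> [_ [/= ? _]]; exact: mem_set|move=> ?; apply: mem_set; split].
by case: ifPn => _; rewrite ?mulr1 ?mulr0.
Qed.

Lemma sqint_past t (X : S -> R) : t <= T -> measurable_fun (past t) X ->
  sqint M PD (fun p => X p * \1_(`]0, t]%classic) p.2.1) = sqint M (past t) X.
Proof.
move=> tT mX; rewrite /sqint [LHS]integral_mkcond [RHS]integral_mkcond; apply: eq_integral => p _.
rewrite !patchE; case: ifPn => [/set_mem pD|nD]; last first.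
  by rewrite ifF//; apply/negP => /set_mem /(past_sub tT) pD; move/negP: nD; apply; exact: mem_set.
have -> : (p \in past t) = (p.2.1 \in `]0, t]%classic).
  by apply/idP/idP => /set_mem; [move=> [_ [/= ? _]]; exact: mem_set|move=> ?; apply: mem_set; split].
by rewrite indicE; case: ifPn => _; rewrite ?mulr1 ?mulr0 ?expr0n.
Qed.

Let Dn_fin t n : t <= T -> (M (Dn t n) < +oo)%E.
Proof.
move=> tT; rewrite process_measure_box; [|exact: measurableT|exact: measurable_itv|exact: measurable_itv].
rewrite probability_setT mul1e.
apply: lte_mul_pinfty => //.
- by rewrite lebesgue_measure_itv/=; case: ifP => _; rewrite -?EFinB.
- exact: (lebesgue_bounded_fin (bounded_itvcc n)).
Qed.

(** Integrands that have an integral measurable at time t form a closed subspace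
    of L2: closed by the isometry and completeness, with measurability preserved
    because the noise filtration contains the null sets. It contains the
    indicators of the past boxes by the previous lemma on increments, hence is
    everything by density. *)
Lemma adapted_integral_exists t (X : S -> R) : 0 <= t -> t <= T ->
  (forall C, measurable C -> <<s past_boxes t >> (past t `&` X @^-1` C)) ->
  (sqint M (past t) X < +oo)%E ->
  exists2 I, integral_of P J mu N (is_elementary T nu F)
      (jump_integrand (fun p => X p * \1_(`]0, t]%classic) p.2.1)) I
    & gmeasurable_fun (noise_events P T nu N t) setT I.
Proof.
move=> t0 tT mX Xfin.
pose V (f : S -> R) := measurable_fun (past t) f /\
  exists2 I, integral_of P J mu N (is_elementary T nu F)
      (jump_integrand (fun p => f p * \1_(`]0, t]%classic) p.2.1)) I
    & gmeasurable_fun (noise_events P T nu N t) setT I.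
suff [] : V X by [].
apply: (@L2_density _ _ _ M (past t) (past_boxes t) (Dn t) V).
- exact: past_boxesI.
- exact: past_boxes_measurable.
- exact: Dn_box.
- exact: DnU.
- move=> n k nk; apply/subsetPset => -[om [s x]] [_ [/=]]; rewrite !in_itv/=.
  have nk' : k.+1%:R^-1 <= n.+1%:R^-1 :> R by rewrite lef_pV2 ?posrE ?ltr0n// ler_nat.
  have nk2 : n%:R <= k%:R :> R by rewrite ler_nat.
  move=> /andP[h1 h2]; rewrite -!ler_norml => h3; split => //; split => /=.
    by rewrite in_itv/= (le_lt_trans nk' h1).
  by rewrite in_itv/= -ler_norml (le_trans h3).
- by move=> n; exact: Dn_fin.
- move=> A bA; split; first by apply: measurable_funTS; apply: measurable_indic; exact: past_boxes_measurable bA.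
  have [U [a [b [B [FU a0 bt bB AE]]]]] := bA; have [mB _] := bB.
  have [ba|ab] := leP b a.
    have -> : A = set0.
      rewrite AE -subset0 => -[om [s x]] [_ [/=]]; rewrite in_itv/= => /andP[h1 h2].
      by have := lt_le_trans h1 (le_trans h2 ba); rewrite ltxx.
    exists (fun=> 0).
      split => //.
        apply: measurable_jump_integrand; exact: past_restrict.
      move=> eps eps0; exists [::]; split => //.
      + rewrite sqint0 ?lee_fin ?ltW// => z _.
        by rewrite /simple_integrand big_nil /jump_integrand indic0 !mul0r subrr.
      + rewrite sqint0 ?lee_fin ?ltW// => o _.
        by rewrite /simple_sum big_nil subrr.
    exact: (@measurable_cst _ _ (g_sigma_algebraType (noise_events P T nu N t))).
  have bT := le_trans bt tT.
  have [I HI] := increment_exists muE NP nu_moment (ltW a0) bT bB.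
  have bY : bounded_adapted (F a) (\1_U : Omega -> R).
    split; last by apply/bounded_onP; exists 1 => o _; rewrite indicE; case: (_ \in _); rewrite ?normr0 ?normr1.
    move=> C mC; have := @measurable_indic _ (g_sigma_algebraType (noise_events P T nu N a)) R setT U FU.
    by move=> /(_ (@measurableT _ (g_sigma_algebraType _)) C mC); rewrite setTI.
  exists (fun o => \1_U o * I o).
    have := adapted_increment a0 bB bY HI; congr integral_of.
    apply/funext => o; apply/funext => -[s [x z]].
    rewrite /jump_integrand /noise_integrand /= AE !indicE.
    have -> : ((o, (s, x)) \in U `*` (`]a, b]%classic `*` B)) = [&& o \in U, s \in `]a, b]%classic & x \in B].
      apply/idP/idP => [/set_mem[/= oU [sab xB]]|/and3P[/set_mem oU /set_mem sab /set_mem xB]].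
        by apply/and3P; split; exact: mem_set.
      by apply: mem_set; split.
    case: (boolP (s \in `]a, b]%classic)) => [/set_mem /=|_]; last by rewrite !andbF /= !(mulr0, mul0r).
    rewrite in_itv/= => /andP[h1 h2].
    have -> : (s \in `]0, t]%classic) by apply: mem_set; rewrite /= in_itv/= (lt_trans a0 h1) (le_trans h2 bt).
    by case: (o \in U); case: (x \in B); rewrite ?(mulr0, mul0r, mulr1, mul1r).
  apply: (@measurable_funM _ (g_sigma_algebraType (noise_events P T nu N t))).
    apply: (@measurable_indic _ (g_sigma_algebraType (noise_events P T nu N t))).
    by apply: noise_filtration_mono FU; exact: le_trans (ltW ab) bt.
  have mI := increment_adapted muE NP nu_moment (ltW a0) (ltW ab) bT bB HI.
  by move=> m0 C mC; rewrite setTI; apply: (noise_filtration_mono bt); have := mI (@measurableT _ (g_sigma_algebraType _)) C mC; rewrite setTI.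
- move=> c g h [mg [I HI mI]] [mh [I' HI' mI']]; split.
    by apply: measurable_funD => //; exact: measurable_funM.
  exists (fun o => c * I o + I' o).
    have := integral_of_lin mJ admF c HI HI'; congr integral_of.
    by apply/funext => o; apply/funext => q; rewrite /jump_integrand; ring.
  apply: (@measurable_funD _ (g_sigma_algebraType (noise_events P T nu N t))) => //.
  exact: (@measurable_funM _ (g_sigma_algebraType (noise_events P T nu N t))).
- move=> g mg Vg; split => //.
  apply: (integral_of_complete mJ NPJ admF) => //.
  + exact: noise_events_measurable.
  + by apply: measurable_jump_integrand; exact: past_restrict.
  + move=> eps eps0.
    have v1 : 0 < jump_variance + 1 by rewrite ltr_wpDl// jump_variance_ge0.
    have [h [mh [I HI mI]] [mh' ghe]] := Vg _ (divr_gt0 eps0 v1).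
    exists (jump_integrand (fun p => h p * \1_(`]0, t]%classic) p.2.1)), I; split => //.
    rewrite (@eq_sqint _ _ _ Q QJ _ (fun z => jump_integrand (fun p => (h p - g p) * \1_(`]0, t]%classic) p.2.1) z.1 z.2)); last first.
      by move=> z _; rewrite /jump_integrand; ring.
    rewrite sqint_jump_integrand; last by apply: past_restrict => //; exact: measurable_funB.
    rewrite (sqint_past (X := fun p => h p - g p))//; last exact: measurable_funB.
    rewrite sqint_subC; apply: le_trans (lee_wpmul2l _ ghe) _.
      by rewrite lee_fin jump_variance_ge0.
    by rewrite -EFinM lee_fin scale_small// jump_variance_ge0.
- exact: mX.
- exact: Xfin.
Qed.

End adapted_integrands.

(** * The predictable sigma-algebra *)

Section predictable_processes.
Context {R : realType} {d : measure_display} {Omega : measurableType d}.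
Local Notation Rm := (measurableTypeR R).
Local Notation E := (Rm * (Rm * Rm))%type.
Local Notation S := (Omega * (Rm * Rm))%type.
Local Notation leb := (@lebesgue_measure R).
Variables (P : probability Omega R) (T : R) (nu : {sigma_finite_measure set Rm -> \bar R}).
Variable N : R.-ker Omega ~> E.
Hypothesis T_gt0 : 0 < T.
Local Notation F := (noise_filtration P T nu N).
Local Notation events := (noise_events P T nu N).
Local Notation pred_sets := (predictable_sets P T nu N).

Let PD : set S := setT `*` space_time T.
Let mPD : measurable PD.
Proof. by apply: measurableX => //; exact: measurable_space_time. Qed.

Definition joint (X : R -> R -> Omega -> R) (p : S) : R := X p.2.1 p.2.2 p.1.

Let sa_pred : sigma_algebra PD pred_sets.
Proof. exact: smallest_sigma_algebra. Qed.

Lemma predictable_sets_domain : pred_sets PD.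
Proof. by have [s0 sC _] := sa_pred; have := sC _ s0; rewrite setD0. Qed.

(** The predictable sets form a sigma-algebra on the process domain only. On the
    whole space they generate a sigma-algebra whose trace on the domain is the
    original one; passing to it makes the closure properties of measurable
    functions available. *)
Lemma predictable_sets_trace A : <<s pred_sets >> A -> pred_sets (PD `&` A).
Proof.
move: A; apply: smallest_sub.
  have [s0 sC sU] := sa_pred; split.
  - by rewrite /= setI0.
  - move=> A /= hA; rewrite setTD.
    have -> : PD `&` ~` A = PD `\` (PD `&` A).
      by apply/seteqP; split => p [Dp h]; split => //; [case|move=> Ap; exact: h].
    exact: sC.
  - move=> A /= hA; rewrite setI_bigcupr; exact: sU.
move=> A pA /=; rewrite setIidr//.
suff : pred_sets `<=` [set B | B `<=` PD] by apply.
apply: smallest_sub.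
  split => /=; first exact: sub0set.
  - by move=> B _; exact: subDsetl.
  - by move=> B hB; exact: bigcup_sub.
by move=> _ [p [C [_ _ ->]]] /=; exact: subIsetl.
Qed.

Let mPDg : @measurable _ (g_sigma_algebraType pred_sets) PD.
Proof. by apply: sub_sigma_algebra; exact: predictable_sets_domain. Qed.

Lemma predictableP X : predictable P T nu N X <-> gmeasurable_fun pred_sets PD (joint X).
Proof.
split.
  by move=> pX _ C mC; apply: sub_sigma_algebra; exact: pX.
move=> mX C mC.
have := mX mPDg C mC => /predictable_sets_trace.
by rewrite setIA setIid.
Qed.

Let filtration_measurable t A : F t A -> measurable A.
Proof. exact: noise_filtration_measurable. Qed.

(** Induction over the generators, for a sigma-algebra K on the whole space. *)
Lemma predictable_sets_ind (K : set (set S)) : sigma_algebra setT K -> K PD ->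
  (forall (a b : R) (Y : Omega -> R) (B : set R), 0 < a -> bounded_adapted (F a) Y -> bounded_borel B ->
     forall C, measurable C -> K (PD `&` (fun x : S => Y x.1 * \1_(`]a, b]%classic : set R) x.2.1 * \1_B x.2.2) @^-1` C)) ->
  (forall (Y : Omega -> R) (B : set R), bounded_adapted (F 0) Y -> bounded_borel B ->
     forall C, measurable C -> K (PD `&` (fun x : S => Y x.1 * \1_([set 0] : set R) x.2.1 * \1_B x.2.2) @^-1` C)) ->
  pred_sets `<=` K.
Proof.
move=> [K0 KC KU] KD K1 K2; apply: smallest_sub.
  split => // A KA.
  have -> : PD `\` A = setT `\` (A `|` (setT `\` PD)).
    apply/seteqP; split => p; first by move=> [Dp nA]; split => // -[Ap|[_ nD]]; [exact: nA|exact: nD].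
    move=> [_ h]; split; last by move=> Ap; apply: h; left.
    by apply: contrapT => nD; apply: h; right.
  apply: (KC); rewrite -bigcup2E; apply: KU => -[|[|n]] //=.
  exact: KC.
move=> A [p [C [[[a [b [Y [B [/andP[a0 _] bY bB ->]]]]]|[Y [B [bY bB ->]]]] mC ->]]].
- exact: K1.
- exact: K2.
Qed.

Lemma predictable_measurable A : pred_sets A -> measurable A.
Proof.
move: A; apply: predictable_sets_ind.
- exact: sigma_algebra_measurable.
- exact: mPD.
- move=> a b Y B a0 [FY _] [mB _] C mC.
  have mY : measurable_fun setT Y by move=> _ C' mC'; rewrite setTI; apply: (@filtration_measurable a); exact: FY.
  apply: (_ : measurable_fun PD _) => //; apply: measurable_funTS.
  apply: measurable_funM; last first.
    apply: measurableT_comp; first exact: measurable_indic.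
    by apply: measurableT_comp; exact: measurable_snd.
  apply: measurable_funM; first by apply: measurableT_comp => //; exact: measurable_fst.
  apply: measurableT_comp; first by apply: measurable_indic; exact: measurable_itv.
  by apply: measurableT_comp; [exact: measurable_fst|exact: measurable_snd].
- move=> Y B [FY _] [mB _] C mC.
  have mY : measurable_fun setT Y by move=> _ C' mC'; rewrite setTI; apply: (@filtration_measurable 0); exact: FY.
  apply: (_ : measurable_fun PD _) => //; apply: measurable_funTS.
  apply: measurable_funM; last first.
    apply: measurableT_comp; first exact: measurable_indic.
    by apply: measurableT_comp; exact: measurable_snd.
  apply: measurable_funM; first by apply: measurableT_comp => //; exact: measurable_fst.
  apply: measurableT_comp; first by apply: measurable_indic; exact: measurable_set1.
  by apply: measurableT_comp; [exact: measurable_fst|exact: measurable_snd].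
Qed.

Lemma predictable_measurable_fun (X : S -> R) : gmeasurable_fun pred_sets PD X -> measurable_fun PD X.
Proof.
move=> mX; apply: (generated_measurable_fun predictable_measurable mPD mX).
exact: mPDg.
Qed.

(** Generators at time 0 vanish after time 0, and the others restrict to the past
    of t as indicators of boxes with random coefficients. *)
Lemma predictable_past t A : t <= T -> pred_sets A -> <<s past_boxes P T nu N t >> (past t `&` A).
Proof.
move=> tT; move: A; apply: predictable_sets_ind.
- split => /=.
  + by rewrite setI0; exact: (@measurable0 _ (g_sigma_algebraType (past_boxes P T nu N t))).
  + move=> A hA; rewrite setTD.
    have -> : past t `&` ~` A = past t `\` (past t `&` A).
      by apply/seteqP; split => p [Dp h]; split => //; [case|move=> Ap; exact: h].
    apply: (@measurableD _ (g_sigma_algebraType (past_boxes P T nu N t))) => //.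
    exact: past_generated.
  + move=> A hA; rewrite setI_bigcupr.
    exact: (@bigcupT_measurable _ (g_sigma_algebraType (past_boxes P T nu N t))).
- by rewrite /= setIidl; [exact: past_generated|exact: past_sub].
- move=> a b Y B a0 [FY _] bB C mC /=.
  have mbox U : F a U -> <<s past_boxes P T nu N t >> (U `*` (`]a, Num.min b t]%classic `*` B)).
    move=> FU; apply: sub_sigma_algebra; exists U, a, (Num.min b t), B; split => //.
    by rewrite ge_min lexx orbT.
  have mbox1 := mbox (Y @^-1` C) (FY C mC).
  have mboxT := mbox setT (@measurableT _ (g_sigma_algebraType (events a))).
  have inbox (p : S) : past t p -> (`]a, Num.min b t]%classic `*` B) p.2 <->
      (\1_(`]a, b]%classic : set R) p.2.1 * \1_B p.2.2 = 1 :> R).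
    move=> [_ [/= + _]]; rewrite in_itv/= => /andP[_ pt]; rewrite /setX /= !indicE in_itv/= le_min pt andbT.
    split.
      by move=> [h hB]; rewrite !mem_set ?mulr1//= in_itv.
    case: (boolP (p.2.1 \in _)) => [/set_mem|_]; last by rewrite mul0r => /eqP; rewrite eq_sym oner_eq0.
    rewrite /= in_itv/= => ->.
    by case: (boolP (p.2.2 \in _)) => [/set_mem|_]; last by rewrite mulr0 => /eqP; rewrite eq_sym oner_eq0.
  have inbox0 (p : S) : past t p -> ~ (`]a, Num.min b t]%classic `*` B) p.2 ->
      (\1_(`]a, b]%classic : set R) p.2.1 * \1_B p.2.2 = 0 :> R).
    move=> pp /(inbox p pp); rewrite !indicE.
    by case: (_ \in _); case: (_ \in _); rewrite ?(mulr0, mul0r)// mulr1.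
  have sub : setT `*` (`]a, Num.min b t]%classic `*` B) `<=` past t.
    move=> [om [s x]] [_ [/= + _]]; rewrite in_itv/= le_min => /and3P[h1 _ h3].
    by split => //; split => //=; rewrite in_itv/= h3 (lt_trans a0).
  have [C0|C0] := pselect (C 0).
    have -> : past t `&` (PD `&` (fun x : S => Y x.1 * \1_(`]a, b]%classic : set R) x.2.1 * \1_B x.2.2) @^-1` C) =
        (Y @^-1` C) `*` (`]a, Num.min b t]%classic `*` B) `|` (past t `\` setT `*` (`]a, Num.min b t]%classic `*` B)).
      apply/seteqP; split => p.
        move=> [pp [_ /=]]; rewrite -mulrA; have [pb|nb] := pselect ((`]a, Num.min b t]%classic `*` B) p.2).
          by have /(inbox p pp) -> := pb; rewrite mulr1 => Yp; left; split.
        by move=> _; right; split => // -[_ ].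
      move=> [[Yp pb]|[pp nb]].
        have pp : past t p by apply: sub.
        split => //; split; first exact: past_sub pp.
        by rewrite /= -mulrA; have /(inbox p pp) -> := pb; rewrite mulr1.
      split => //; split; first exact: past_sub pp.
      rewrite /= -mulrA inbox0 ?mulr0// => pb; exact: nb.
    apply: (@measurableU _ (g_sigma_algebraType (past_boxes P T nu N t))) => //.
    apply: (@measurableD _ (g_sigma_algebraType (past_boxes P T nu N t))) => //.
    exact: past_generated.
  have -> : past t `&` (PD `&` (fun x : S => Y x.1 * \1_(`]a, b]%classic : set R) x.2.1 * \1_B x.2.2) @^-1` C) =
      (Y @^-1` C) `*` (`]a, Num.min b t]%classic `*` B).
    apply/seteqP; split => p.
      move=> [pp [_ /=]]; rewrite -mulrA; have [pb|nb] := pselect ((`]a, Num.min b t]%classic `*` B) p.2).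
        by have /(inbox p pp) -> := pb; rewrite mulr1 => Yp; split.
      by rewrite inbox0// mulr0.
    move=> [Yp pb]; have pp : past t p by apply: sub.
    split => //; split; first exact: past_sub pp.
    by rewrite /= -mulrA; have /(inbox p pp) -> := pb; rewrite mulr1.
  exact: mbox1.
- move=> Y B _ _ C mC /=.
  have [C0|C0] := pselect (C 0).
    have -> : past t `&` (PD `&` (fun x : S => Y x.1 * \1_([set 0] : set R) x.2.1 * \1_B x.2.2) @^-1` C) = past t.
      apply/seteqP; split => p; first by case.
      move=> pp; split => //; split; first exact: past_sub pp.
      rewrite /= [\1_[set 0] _]indicE memNset ?mulr0 ?mul0r// => p0.
      by have [_ [/= + _]] := pp; rewrite in_itv/= p0 ltxx.
    exact: past_generated.
  have -> : past t `&` (PD `&` (fun x : S => Y x.1 * \1_([set 0] : set R) x.2.1 * \1_B x.2.2) @^-1` C) = set0.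
    apply/seteqP; split => // p [pp [_ /=]].
    rewrite [\1_[set 0] _]indicE memNset ?mulr0 ?mul0r// => p0.
    by have [_ [/= + _]] := pp; rewrite in_itv/= p0 ltxx.
  exact: (@measurable0 _ (g_sigma_algebraType (past_boxes P T nu N t))).
Qed.

Lemma predictable_past_fun t (X : S -> R) : t <= T -> gmeasurable_fun pred_sets PD X ->
  forall C, measurable C -> <<s past_boxes P T nu N t >> (past t `&` X @^-1` C).
Proof.
move=> tT mX C mC.
have := mX mPDg C mC => /predictable_sets_trace h.
have := predictable_past tT h; congr (<<s _ >>).
apply/seteqP; split => p; first by move=> [pp [_ [_ Cp]]].
by move=> [pp Cp]; have Dp := past_sub tT pp.
Qed.

Lemma generator_measurable p : predictable_generator P T nu N p -> gmeasurable_fun pred_sets PD p.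
Proof.
move=> gp _ C mC; apply: sub_sigma_algebra; apply: sub_sigma_algebra.
by exists p, C.
Qed.

Lemma predictable_box a b B U : 0 < a < b -> bounded_borel B -> F a U ->
  <<s pred_sets >> (PD `&` (U `*` (`]a, b]%classic `*` B))).
Proof.
move=> ab bB FU.
pose p (x : S) : R := \1_U x.1 * \1_(`]a, b]%classic : set R) x.2.1 * \1_B x.2.2.
have gp : predictable_generator P T nu N p.
  left; exists a, b, (\1_U), B; split => //; split.
    move=> C mC; have := @measurable_indic _ (g_sigma_algebraType (events a)) R setT U FU.
    by move=> /(_ (@measurableT _ (g_sigma_algebraType _)) C mC); rewrite setTI.
  by apply/bounded_onP; exists 1 => x _; rewrite indicE; case: (_ \in _); rewrite ?normr0 ?normr1.
have := generator_measurable gp mPDg (measurable_set1 1).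
congr (<<s _ >>); apply/seteqP; split => -[om [s x]] [Dp h]; split => //; move: h; rewrite /p /= !indicE.
  case: (boolP (om \in U)) => [/set_mem ?|_]; last by rewrite !mul0r => /eqP; rewrite eq_sym oner_eq0.
  case: (boolP (s \in _)) => [/set_mem ?|_]; last by rewrite mulr0 mul0r => /eqP; rewrite eq_sym oner_eq0.
  case: (boolP (x \in B)) => [/set_mem ?|_]; last by rewrite mulr0 => /eqP; rewrite eq_sym oner_eq0.
  by [].
by move=> [/= oU [sab xB]]; rewrite !mem_set// !mulr1.
Qed.

Lemma predictable_initial_box B : bounded_borel B ->
  <<s pred_sets >> (PD `&` (setT `*` ([set 0] `*` B))).
Proof.
move=> bB.
pose p (x : S) : R := (fun=> 1) x.1 * \1_([set 0] : set R) x.2.1 * \1_B x.2.2.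
have gp : predictable_generator P T nu N p.
  right; exists (fun=> 1), B; split => //; split; last first.
    by apply/bounded_onP; exists 1 => x _; rewrite normr1.
  move=> C mC; have := @measurable_cst _ _ (g_sigma_algebraType (events 0)) R setT 1.
  by move=> /(_ (@measurableT _ (g_sigma_algebraType _)) C mC); rewrite setTI.
have := generator_measurable gp mPDg (measurable_set1 1).
congr (<<s _ >>); apply/seteqP; split => -[om [s x]] [Dp h]; split => //; move: h; rewrite /p /= !indicE mul1r.
  case: (boolP (s \in _)) => [/set_mem ?|_]; last by rewrite mul0r => /eqP; rewrite eq_sym oner_eq0.
  case: (boolP (x \in B)) => [/set_mem ?|_]; last by rewrite mulr0 => /eqP; rewrite eq_sym oner_eq0.
  by [].
by move=> [/= oU [sab xB]]; rewrite !mem_set// !mulr1.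
Qed.

Let bounded_piece (B : set Rm) (n : nat) : measurable B -> bounded_borel (B `&` `[- n%:R, n%:R]%classic : set R).
Proof.
move=> mB; split; first by apply: (@measurableI _ Rm) => //; exact: measurable_itv.
by apply/bounded_onP; exists n%:R => x [_ /=]; rewrite in_itv/= -ler_norml.
Qed.

Let in_pieces (x : R) : exists n : nat, `|x| <= n%:R.
Proof. by apply: (@filter_ex _ \oo); exact: nbhs_infty_ger. Qed.

Let mpred := @bigcupT_measurable _ (g_sigma_algebraType pred_sets).

(** A box unbounded in time and space is a countable union of bounded ones; the
    left ends have to stay away from 0. *)
Let after (c : R) (B : set Rm) : 0 <= c -> measurable B ->
  <<s pred_sets >> (PD `&` (setT `*` (`]c, +oo[%classic `*` B))).
Proof.
move=> c0 mB.
pose A n : set S := PD `&` (setT `*` (`]Num.max c n.+1%:R^-1, Num.max c n.+1%:R^-1 + (T + 1)]%classic `*` (B `&` `[- n%:R, n%:R]%classic))).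
have -> : PD `&` (setT `*` (`]c, +oo[%classic `*` B)) = \bigcup_n A n.
  apply/seteqP; split => -[om [s x]].
    move=> [[_ [/= sT _]] [_ [/= + Bx]]]; rewrite in_itv/= andbT => cs.
    have s0 : 0 < s by apply: le_lt_trans cs.
    have [n [h1 h3]] : exists n, n.+1%:R^-1 < s /\ `|x| <= n%:R.
      apply: (@filter_ex _ \oo); near=> n; split.
      - near: n; exact: (near_infty_natSinv_lt (PosNum s0)).
      - near: n; exact: nbhs_infty_ger.
    exists n => //; split; first by split.
    split => //; split => /=.
      rewrite in_itv/= gt_max cs h1 /=; move: sT; rewrite in_itv/= => /andP[_ sT].
      apply: (le_trans sT); rewrite -[leLHS]add0r lerD ?lerDl ?ler01//.
      by rewrite le_max c0.
    by split => //=; rewrite in_itv/= -ler_norml.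
  move=> [n _ [Dp [_ [/= + [Bx _]]]]]; rewrite in_itv/= gt_max => /andP[/andP[cs _] _].
  by split => //; split => //; split => //=; rewrite in_itv/= cs.
apply: mpred => n; apply: predictable_box.
- rewrite lt_max invr_gt0 ltr0n orbT /= ltrDl ltr_wpDr// ltW//.
- exact: bounded_piece.
- exact: (@measurableT _ (g_sigma_algebraType (events _))).
Unshelve. all: by end_near. Qed.

(** The coordinates are predictable: half-lines in time and Borel sets in space
    are countable unions of generating boxes, including those at time 0. *)
Lemma predictable_deterministic (f : Rm * Rm -> R) : measurable_fun (space_time T) f ->
  gmeasurable_fun pred_sets PD (fun p : S => f p.2).
Proof.
move=> mf.
have mD : @measurable _ (g_sigma_algebraType pred_sets) PD := mPDg.
have m1 : gmeasurable_fun pred_sets PD (fun p : S => p.2.1).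
  apply: (measurability _ (RGenOInfty.measurableE R)) => _ [_ [c ->] <-].
  have [c0|c0] := leP 0 c.
    have := after c0 measurableT; congr (<<s _ >>).
    by apply/seteqP; split => p; [move=> [Dp [_ [h _]]]|move=> [Dp h]].
  have -> : PD `&` (fun p : S => p.2.1) @^-1` `]c, +oo[%classic = PD => //.
  apply/seteqP; split => p; first by case.
  move=> Dp; split => //=; have [_ [/= + _]] := Dp; rewrite !in_itv/= andbT => /andP[s0 _].
  exact: lt_le_trans c0 s0.
have m2 : gmeasurable_fun pred_sets PD (fun p : S => p.2.2).
  move=> _ B mB.
  have -> : PD `&` (fun p : S => p.2.2) @^-1` B =
     (PD `&` (setT `*` (`]0, +oo[%classic `*` B))) `|`
     \bigcup_n (PD `&` (setT `*` ([set 0] `*` (B `&` `[- n%:R, n%:R]%classic)))).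
    apply/seteqP; split => -[om [s x]].
      move=> [[_ [/= sT _]] /= Bx].
      have [s0|s0] := ltP 0 s.
        by left; split => //; split => //; split => //=; rewrite in_itv/= s0.
      right; have [n xn] := in_pieces x; exists n => //; split => //; split => //; split => /=.
        apply/eqP; rewrite eq_le s0; by move: sT; rewrite in_itv/= => /andP[].
      by split => //=; rewrite in_itv/= -ler_norml.
    by move=> [[Dp [_ [_ Bx]]]|[n _ [Dp [_ [_ [Bx _]]]]]].
  apply: (@measurableU _ (g_sigma_algebraType pred_sets)); first exact: after.
  by apply: mpred => n; apply: predictable_initial_box; exact: bounded_piece.
have m12 : @measurable_fun _ _ (g_sigma_algebraType pred_sets) (Rm * Rm)%type PD (fun p : S => p.2).
  have : @measurable_fun _ _ (g_sigma_algebraType pred_sets) (Rm * Rm)%type PD (fun p : S => (p.2.1, p.2.2)).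
    exact: (@measurable_fun_pair_in _ _ _ (g_sigma_algebraType pred_sets)).
  by apply: eq_measurable_fun => -[om [s x]].
apply: (@measurable_comp _ _ _ (g_sigma_algebraType pred_sets) _ _ (space_time T)) => //.
- exact: measurable_space_time.
- by move=> _ [p [_ h] <-].
Qed.

End predictable_processes.

(** * Predictable versions of adapted processes *)

Section grids.
Context {R : realType}.
Implicit Types h s x : R.

(** In time the grid point is strictly to the left of s, so that values there are
    known before s; in space it is the usual one. *)
Definition grid_before h s : R := h * (Num.ceil (s / h) - 1)%:~R.
Definition grid_floor h x : R := h * (Num.floor (x / h))%:~R.

Lemma grid_before_itv h s : 0 < h -> grid_before h s < s <= grid_before h s + h.
Proof.
move=> h0; have := ceil_itv (s / h); rewrite /grid_before => /andP[h1 h2].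
rewrite mulrC -ltr_pdivlMr// h1 /=.
by move: h2; rewrite ler_pdivrMr// intrB mulrBl mul1r subrK.
Qed.

Lemma grid_floor_itv h x : 0 < h -> grid_floor h x <= x < grid_floor h x + h.
Proof.
move=> h0; have := floor_itv (x / h); rewrite /grid_floor => /andP[h1 h2].
rewrite mulrC -ler_pdivlMr// h1 /=.
by move: h2; rewrite ltr_pdivrMr// intrD mulrDl mul1r.
Qed.

Lemma grid_before_eq h s (k : nat) : 0 < h -> h * k%:R < s <= h * k%:R + h -> grid_before h s = h * k%:R.
Proof.
move=> h0 /andP[h1 h2]; rewrite /grid_before (@ceil_def _ _ (k.+1 : int)).
  by rewrite intS addrAC subrr add0r.
rewrite intS [(1 + k%:Z)%R]addrC addrK -[k%:~R]/(k%:R) ltr_pdivlMr// mulrC h1 /=.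
by rewrite ler_pdivrMr// intrD mulrDl mul1r mulrC.
Qed.

Lemma grid_floor_eq h x (n m : nat) : 0 < h ->
  h * (n%:R - m%:R) <= x < h * (n%:R - m%:R) + h -> grid_floor h x = h * (n%:R - m%:R).
Proof.
move=> h0 /andP[h1 h2]; rewrite /grid_floor (@floor_def _ _ (n%:Z - m%:Z)); first by rewrite intrB.
have e : (n%:Z - m%:Z)%:~R = n%:R - m%:R :> R by rewrite intrB.
rewrite [(_ + 1)%:~R]intrD e ler_pdivlMr// mulrC h1 /=.
by rewrite ltr_pdivrMr// mulrDl mul1r mulrC.
Qed.

Lemma grid_beforeP h s : 0 < h -> h < s -> exists k : nat, (0 < k)%N /\ grid_before h s = h * k%:R.
Proof.
move=> h0 hs; have : (1 < Num.ceil (s / h)) by rewrite ceil_gt_int ltr_pdivlMr// mul1r.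
rewrite /grid_before; case: (Num.ceil _) => // -[|k] // k1; exists k; split => //.
by rewrite intS addrAC subrr add0r.
Qed.

Lemma grid_floorP h x : exists n m : nat, grid_floor h x = h * (n%:R - m%:R).
Proof.
rewrite /grid_floor; case: (Num.floor _) => n; first by exists n, 0%N; rewrite subr0.
by exists 0%N, n.+1; rewrite sub0r NegzE intrN.
Qed.

End grids.

Section predictable_versions.
Context {R : realType} {d : measure_display} {Omega : measurableType d}.
Local Notation Rm := (measurableTypeR R).
Local Notation E := (Rm * (Rm * Rm))%type.
Local Notation S := (Omega * (Rm * Rm))%type.
Variables (P : probability Omega R) (T : R) (nu : {sigma_finite_measure set Rm -> \bar R}).
Variable N : R.-ker Omega ~> E.
Hypothesis T_gt0 : 0 < T.
Local Notation F := (noise_filtration P T nu N).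
Local Notation events := (noise_events P T nu N).
Local Notation pred_sets := (predictable_sets P T nu N).

Let PD : set S := setT `*` space_time T.
Let mPDg : @measurable _ (g_sigma_algebraType pred_sets) PD.
Proof. by apply: sub_sigma_algebra; exact: predictable_sets_domain. Qed.

Let mpredU := @bigcupT_measurable _ (g_sigma_algebraType pred_sets).

Variable Z : R -> R -> Omega -> R.
Hypothesis Z_adapted : forall t x, 0 <= t <= T -> gmeasurable_fun (events t) setT (Z t x).

(** The process Z read off at the nearest earlier grid point: freezing an
    adapted process over the next time step makes it predictable. *)
Definition frozen (h : R) (s x : R) (o : Omega) : R :=
  if h < s then Z (grid_before h s) (grid_floor h x) o else 0.

Lemma predictable_frozen h : 0 < h -> gmeasurable_fun pred_sets PD (joint (frozen h)).
Proof.
move=> h0 _ C mC.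
pose box (k n m : nat) : set S :=
  if h * k%:R <= T then
    PD `&` ((Z (h * k%:R) (h * (n%:R - m%:R)) @^-1` C) `*`
     (`]h * k%:R, h * k%:R + h]%classic `*` `[h * (n%:R - m%:R), h * (n%:R - m%:R) + h[%classic))
  else set0.
pose early : set S := if `[< C 0 >] then PD `&` (fun p => p.2.1) @^-1` `]-oo, h]%classic else set0.
have -> : PD `&` joint (frozen h) @^-1` C = early `|` \bigcup_k \bigcup_n \bigcup_m box k.+1 n m.
  apply/seteqP; split => -[om [s x]].
    move=> [Dp]; rewrite /joint /frozen /=; case: ifPn => [hs|nhs] Cz.
      right; have [[|k] [// _ ek]] := grid_beforeP h0 hs.
      have [n [m enm]] := grid_floorP h x.
      have := grid_before_itv s h0; rewrite ek => sk.
      have := grid_floor_itv x h0; rewrite enm => xnm.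
      exists k => //; exists n => //; exists m => //; rewrite /box ifT; last first.
        have [_ [/= + _]] := Dp; rewrite in_itv/= => /andP[_]; apply: le_trans.
        by move: sk => /andP[/ltW].
      by split => //; split; [rewrite /= -ek -enm|split => /=; rewrite in_itv].
    by left; rewrite /early asboolT//; split => //=; rewrite in_itv/= leNgt.
  move=> [|[k _ [n _ [m _]]]].
    rewrite /early; case: asboolP => // C0 [Dp /=]; rewrite in_itv/= => sh; split => //.
    by rewrite /joint /frozen /= ltNge sh.
  rewrite /box; case: ifP => // _ [Dp [/= Cz [/=]]]; rewrite !in_itv/= => sk xnm; split => //.
  rewrite /joint /frozen /= (grid_before_eq h0 sk) (grid_floor_eq h0 xnm) ifT//.
  case/andP: sk => + _; apply: le_lt_trans.
  by rewrite ler_pMr// ler1n.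
apply: (@measurableU _ (g_sigma_algebraType pred_sets)).
  rewrite /early; case: ifP => _; last exact: (@measurable0 _ (g_sigma_algebraType pred_sets)).
  have mfst : measurable_fun (space_time T) (fun p : Rm * Rm => p.1) by apply: measurable_funTS; exact: measurable_fst.
  have mI : measurable (`]-oo, h]%classic : set R) by exact: measurable_itv.
  exact: (predictable_deterministic T_gt0 mfst mPDg mI).
apply: mpredU => k; apply: mpredU => n; apply: mpredU => m; rewrite /box.
case: ifP => kT; last exact: (@measurable0 _ (g_sigma_algebraType pred_sets)).
have hk0 : 0 < h * k.+1%:R by rewrite mulr_gt0.
have FU : F (h * k.+1%:R) (Z (h * k.+1%:R) (h * (n%:R - m%:R)) @^-1` C).
  have := @Z_adapted (h * k.+1%:R) (h * (n%:R - m%:R)) _ (@measurableT _ (g_sigma_algebraType _)) C mC.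
  by rewrite setTI; apply; rewrite kT ltW.
apply: predictable_box => //; first by rewrite hk0 ltrDl.
split; first exact: measurable_itv.
apply/bounded_onP; exists (`|h * (n%:R - m%:R)| + h) => x /=; rewrite in_itv/= => /andP[x1 x2].
move: (h * (n%:R - m%:R)) x1 x2 => y x1 x2.
have -> : x = y + (x - y) by ring.
apply: le_trans (ler_normD _ _) _; rewrite lerD2l ger0_norm; first by rewrite lerBlDl ltW.
by rewrite subr_ge0.
Qed.

Hypothesis Z_initial : forall x, {ae P, forall o, Z 0 x o = 0}.
Hypothesis Z_modulus : forall eps : R, 0 < eps -> exists2 h : R, 0 < h &
  forall t x t' x', 0 <= t <= T -> 0 <= t' <= T -> `|t - t'| <= h -> `|x - x'| <= h ->
    (sqint P setT (fun o => Z t x o - Z t' x' o)%R <= eps%:E)%E.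

(** An adapted process that is uniformly continuous in L2 has a predictable
    version, the limit of its values at earlier times along finer grids. *)
Lemma predictable_version : exists2 X : R -> R -> Omega -> R,
  gmeasurable_fun pred_sets PD (joint X) &
  forall t x, 0 <= t <= T -> {ae P, forall o, X t x o = Z t x o}.
Proof.
have e0 n : 0 < 2^-1 ^+ n :> R by rewrite exprn_gt0.
pose h n : R := Num.min (projT1 (cid2 (Z_modulus (e0 n)))) n.+1%:R^-1.
have h0 n : 0 < h n by rewrite lt_min invr_gt0 ltr0n andbT; case: cid2.
have hn n : h n <= n.+1%:R^-1 by rewrite ge_min lexx orbT.
have hZ n t x t' x' : 0 <= t <= T -> 0 <= t' <= T -> `|t - t'| <= h n -> `|x - x'| <= h n ->
    (sqint P setT (fun o => Z t x o - Z t' x' o)%R <= (2^-1 ^+ n)%:E)%E.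
  rewrite /h; case: cid2 => /= k k0 hk tT tT'; rewrite !le_min => /andP[h1 _] /andP[h2 _].
  exact: hk.
have mZ t x : 0 <= t <= T -> measurable_fun setT (Z t x).
  move=> tT; apply: (generated_measurable_fun (@noise_events_measurable _ _ _ P T nu N t) measurableT (Z_adapted x tT)).
  exact: (@measurableT _ (g_sigma_algebraType (events t))).
exists (fun t x o => rlimsup (fun n => frozen (h n) t x o)).
  apply: (@measurable_rlimsup _ (g_sigma_algebraType pred_sets) R PD (fun n => joint (frozen (h n)))) => //.
  by move=> n; exact: predictable_frozen.
move=> t x tT; have [/andP[t0 tT']] := tT; move: t0; rewrite le_eqVlt => /orP[/eqP t0|t0].
  rewrite -t0; apply: filterS (Z_initial x) => o ->.
  apply: rlimsup_cvg; rewrite (_ : (fun n => _) = cst 0); first exact: cvg_cst.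
  by apply/funext => n; rewrite /frozen ltNge ltW//.
have [n0 n0t] : exists n, n.+1%:R^-1 < t.
  by apply: (@filter_ex _ \oo); exact: (near_infty_natSinv_lt (PosNum t0)).
have late n : (n0 <= n)%N -> h n < t.
  move=> n0n; apply: le_lt_trans n0t; apply: le_trans (hn n) _.
  by rewrite lef_pV2 ?posrE ?ltr0n// ler_nat.
have frozenE n : (n0 <= n)%N -> exists t' x', [/\ 0 <= t' <= T, `|t' - t| <= h n, `|x' - x| <= h n
     & frozen (h n) t x = Z t' x'].
  move=> n0n; exists (grid_before (h n) t), (grid_floor (h n) x).
  have /andP[b1 b2] := grid_before_itv t (h0 n).
  have /andP[c1 c2] := grid_floor_itv x (h0 n).
  have [k [_ ek]] := grid_beforeP (h0 n) (late n n0n).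
  split.
  - by rewrite (le_trans (ltW b1) tT') andbT ek mulr_ge0// ltW.
  - by rewrite distrC ger0_norm; [rewrite lerBlDl|rewrite subr_ge0 ltW].
  - by rewrite distrC ger0_norm ?subr_ge0// lerBlDl ltW.
  - by apply/funext => o; rewrite /frozen late.
have mfz n : measurable_fun setT (frozen (h (n + n0)%N) t x).
  by have [t' [x' [tT1 _ _ ->]]] := frozenE (n + n0)%N (leq_addl _ _); exact: mZ.
have fast n : (sqint P setT (fun o => frozen (h (n + n0)%N) t x o - Z t x o)%R <= (1 * 2^-1 ^+ n)%:E)%E.
  have [t' [x' [tT1 h1 h2 ->]]] := frozenE (n + n0)%N (leq_addl _ _).
  apply: le_trans (hZ _ _ _ _ _ tT1 tT h1 h2) _; rewrite lee_fin mul1r exprD.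
  by rewrite ler_piMr ?exprn_ge0 ?exprn_ile1 ?invr_ge0 ?invf_le1 ?ler1n.
apply: filterS (fast_L2_ae_cvg mfz (mZ t x tT) fast) => o oc; apply: rlimsup_cvg.
by rewrite -(cvg_shiftn n0).
Qed.

End predictable_versions.

(** * Translations and weights in the plane *)

Section plane.
Context {R : realType}.
Local Notation Rm := (measurableTypeR R).
Local Notation leb := (@lebesgue_measure R).
Local Notation planar := (@planar R).
Implicit Types (f : Rm * Rm -> R).

Section reflection.
Variable c : R.
Let phi (x : Rm) : Rm := c - x.
Let mphi : measurable_fun setT phi. Proof. exact: measurable_funB. Qed.
Let phi_mixin := isMeasurableFun.Build _ _ _ _ _ mphi.
Let phi_fun : {mfun Rm >-> Rm} := HB.pack phi phi_mixin.

Let lebesgue_reflection A : measurable A -> leb A = pushforward leb phi A.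
Proof.
apply: (@lebesgue_measure_unique _ (pushforward leb phi_fun)) => _ [[a b]] _ <-.
rewrite /= /pushforward.
have -> : phi @^-1` `]a, b]%classic = `[c - b, c - a[%classic.
  apply/seteqP; split => x /=; rewrite /phi !in_itv/= => /andP[h1 h2]; apply/andP; split; lra.
rewrite !lebesgue_measure_itv/= !lte_fin ltrD2l ltrN2.
by case: ifP => // _; rewrite -!EFinB; congr EFin; ring.
Qed.

Lemma integral_reflection (f : Rm -> \bar R) : measurable_fun setT f -> (forall x, 0 <= f x)%E ->
  (\int[leb]_x f (c - x)%R = \int[leb]_x f x)%E.
Proof.
move=> mf f0; have h := @ge0_integral_pushforward _ _ _ _ _ phi mphi leb setT f measurableT mf (fun x _ => f0 x).
rewrite preimage_setT in h; rewrite -[LHS]/(\int[leb]_x ((f \o phi) x))%E -h.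
by apply: eq_measure_integral => A mA _; exact/esym/lebesgue_reflection.
Qed.

End reflection.

Lemma integral_shift h (f : Rm -> \bar R) : measurable_fun setT f -> (forall x, 0 <= f x)%E ->
  (\int[leb]_x f (x + h)%R = \int[leb]_x f x)%E.
Proof.
move=> mf f0; rewrite -(integral_reflection h mf f0).
rewrite -(@integral_reflection 0 (fun x => f (h - x))%R)//; last first.
  by apply: (measurableT_comp mf); exact: measurable_funB.
by apply: eq_integral => x _ /=; rewrite sub0r opprK addrC.
Qed.

Lemma plane_tonelli (f : Rm * Rm -> \bar R) : measurable_fun setT f -> (forall p, 0 <= f p)%E ->
  (\int[planar]_p f p = \int[leb]_x \int[leb]_y f (x, y))%E.
Proof. by move=> mf f0; exact: fubini_tonelli1. Qed.

Let mrefl (c e : R) : measurable_fun setT (fun p : Rm * Rm => (c - p.1, e - p.2) : Rm * Rm).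
Proof.
by apply: measurable_fun_pair; apply: measurable_funB => //.
Qed.

(** In the convolution the kernel is evaluated at (t - s, x - y), and its
    norm has to be computed in the variables (s, y). *)
Lemma plane_reflection c e (f : Rm * Rm -> \bar R) : measurable_fun setT f -> (forall p, 0 <= f p)%E ->
  (\int[planar]_p f (c - p.1, e - p.2)%R = \int[planar]_p f p)%E.
Proof.
move=> mf f0; rewrite plane_tonelli; [|exact: (measurableT_comp mf (mrefl c e))|by []].
rewrite [RHS]plane_tonelli//=.
pose I (x : Rm) := (\int[leb]_y f (x, y))%E.
have mI : measurable_fun setT I.
  exact: (measurable_fun_fubini_tonelli_F (m2 := leb) f mf f0).
rewrite -(integral_reflection c mI) => [|x]; last exact: integral_ge0.
apply: eq_integral => x _; rewrite /I -(integral_reflection e)//.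
exact: (measurableT_comp mf).
Qed.

Lemma sqint_reflection c e f : measurable_fun setT f ->
  sqint planar setT (fun p => f (c - p.1, e - p.2)) = sqint planar setT f.
Proof.
move=> mf; apply: (@plane_reflection c e (fun p => (f p ^+ 2)%:E)); first exact: measurable_sq.
by move=> p; rewrite lee_fin sqr_ge0.
Qed.

Let mshift (h k : R) : measurable_fun setT (fun p : Rm * Rm => (p.1 + h, p.2 + k) : Rm * Rm).
Proof.
by apply: measurable_fun_pair; apply: measurable_funD => //.
Qed.

Lemma sqint_shift h k f : measurable_fun setT f ->
  sqint planar setT (fun p => f (p.1 + h, p.2 + k)) = sqint planar setT f.
Proof.
move=> mf; rewrite -(sqint_reflection h k mf).
rewrite -(@sqint_reflection 0 0 (fun p => f (h - p.1, k - p.2))); last exact: (measurableT_comp mf (mrefl h k)).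
by apply: eq_sqint => p _ /=; rewrite !sub0r !opprK [h + _]addrC [k + _]addrC.
Qed.

Lemma sqint_tensor (u v : Rm -> R) : measurable_fun setT u -> measurable_fun setT v ->
  sqint planar setT (fun p => u p.1 * v p.2) = (sqint leb setT u * sqint leb setT v)%E.
Proof.
move=> mu mv; rewrite /sqint plane_tonelli; last 2 first.
- apply: measurable_sq; apply: measurable_funM; first by apply: measurableT_comp => //; exact: measurable_fst.
  by apply: measurableT_comp => //; exact: measurable_snd.
- by move=> p; rewrite lee_fin sqr_ge0.
rewrite -ge0_integralZr//; last 3 first.
- exact: measurable_sq.
- by move=> x _; rewrite lee_fin sqr_ge0.
- by apply: integral_ge0 => x _; rewrite lee_fin sqr_ge0.
apply: eq_integral => x _ /=.
rewrite -ge0_integralZl//; last 3 first.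
- exact: measurable_sq.
- by move=> y _; rewrite lee_fin sqr_ge0.
- by rewrite lee_fin sqr_ge0.
by apply: eq_integral => y _; rewrite -EFinM exprMn.
Qed.

Let len (a b : R) : R := fine (leb `]a, b]%classic).

Let len_ge0 a b : 0 <= len a b. Proof. exact: fine_ge0. Qed.

Let mitv_indic (a b : R) : measurable_fun setT (\1_(`]a, b]%classic) : Rm -> R).
Proof. by apply: measurable_indic; exact: measurable_itv. Qed.

Let sqint_indic (A : set Rm) : measurable A -> sqint leb setT (\1_A) = leb A.
Proof.
move=> mA; rewrite -[A in RHS]setIT -integral_indic//; apply: eq_integral => x _.
by rewrite indicE; case: (_ \in _); rewrite ?expr0n ?expr1n.
Qed.

Let lenE a b : sqint leb setT (\1_(`]a, b]%classic)) = (len a b)%:E.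
Proof.
rewrite sqint_indic; last exact: measurable_itv.
rewrite fineK// lebesgue_measure_itv/=; case: ifP => _ //.
Qed.

(** Shifting an interval by h changes its indicator only within distance |h| of
    the two endpoints. *)
Let near_endpoint (a b h x : R) :
  (\1_(`]a, b]%classic) (x + h) - \1_(`]a, b]%classic) x) ^+ 2 <=
  \1_(`[a - `|h|, a + `|h| ]%classic) x + \1_(`[b - `|h|, b + `|h| ]%classic) x :> R.
Proof.
have [nh nh'] : h <= `|h| /\ - h <= `|h| by rewrite ler_norm -normrN ler_norm.
have le1 (u v : bool) (y : R) : 0 <= y -> (u%:R - v%:R) ^+ 2 <= 1 + y :> R.
  by move=> y0; case: u; case: v; rewrite ?subrr ?subr0 ?sub0r ?expr0n ?sqrrN ?expr1n /= ?lerDl// addr_ge0.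
have [ha|ha] := leP `|x - a| `|h|.
  have /= -> : \1_(`[a - `|h|, a + `|h| ]%classic) x = 1 :> R.
    rewrite indicE mem_set//= in_itv/=; move: ha; rewrite ler_norml => /andP[h1 h2].
    by apply/andP; split; lra.
  by rewrite !indicE; apply: le1.
have [hb|hb] := leP `|x - b| `|h|.
  have /= -> : \1_(`[b - `|h|, b + `|h| ]%classic) x = 1 :> R.
    rewrite indicE mem_set//= in_itv/=; move: hb; rewrite ler_norml => /andP[h1 h2].
    by apply/andP; split; lra.
  by rewrite !indicE [leRHS]addrC; apply: le1.
have -> : \1_(`]a, b]%classic) (x + h) = \1_(`]a, b]%classic) x :> R.
  rewrite !indicE !mem_setE !in_itv/=; congr (nat_of_bool _)%:R; congr (_ && _).
    move: ha nh nh'; rewrite ltr_normr; move: `|h| => m /orP[] h1 h2 h3; apply/idP/idP; lra.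
  move: hb nh nh'; rewrite ltr_normr; move: `|h| => m /orP[] h1 h2 h3; apply/idP/idP; lra.
by rewrite subrr expr0n/= !indicE addr_ge0.
Qed.

Let sqint_indic_shift a b h :
  (sqint leb setT (fun x : Rm => \1_(`]a, b]%classic) (x + h) - \1_(`]a, b]%classic) x)%R <= (4 * `|h|)%:E)%E.
Proof.
have mI (c : R) : measurable (`[c - `|h|, c + `|h| ]%classic : set Rm) by exact: measurable_itv.
have mi (c : R) : measurable_fun setT (fun x : Rm => (\1_(`[c - `|h|, c + `|h| ]%classic) x : R)%:E).
  by apply/measurable_EFinP; exact: measurable_indic.
have li (c : R) : (\int[leb]_x (\1_(`[c - `|h|, c + `|h| ]%classic) x : R)%:E = (2 * `|h|)%:E)%E.
  transitivity (leb `[c - `|h|, c + `|h| ]%classic); first by rewrite integral_indic// setIT.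
  rewrite lebesgue_measure_itv/= lte_fin.
  case: ifPn => [_|]; first by rewrite -EFinB; congr EFin; ring.
  by rewrite -leNgt => h1; congr EFin; move: (normr_ge0 h) h1; move: `|h| => m; lra.
apply: (@le_trans _ _ (\int[leb]_x ((\1_(`[a - `|h|, a + `|h| ]%classic) x : R)%:E + (\1_(`[b - `|h|, b + `|h| ]%classic) x : R)%:E))%E).
  apply: ge0_le_integral => //.
  - by move=> x _; rewrite lee_fin sqr_ge0.
  - apply: measurable_sq; apply: measurable_funB => //.
    by apply: measurableT_comp => //; exact: measurable_funD.
  - exact: emeasurable_funD.
  - by move=> x _; rewrite -EFinD lee_fin near_endpoint.
rewrite ge0_integralD//.
by rewrite !li -EFinD lee_fin; lra.
Qed.

Definition rectangles : set (set (Rm * Rm)) :=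
  [set A | exists a b c e : R, A = `]a, b]%classic `*` `]c, e]%classic].

Let rectanglesI : setI_closed rectangles.
Proof.
move=> _ _ [a [b [c [e ->]]]] [a' [b' [c' [e' ->]]]].
exists (Num.max a a'), (Num.min b b'), (Num.max c c'), (Num.min e e').
apply/seteqP; split => -[x y] /=; rewrite !in_itv/= !gt_max !le_min.
  by move=> [[/andP[-> ->] /andP[-> ->]] [/andP[-> ->] /andP[-> ->]]].
by move=> [/andP[/andP[-> ->] /andP[-> ->]] /andP[/andP[-> ->] /andP[-> ->]]].
Qed.

Let rectangles_measurable A : rectangles A -> measurable A.
Proof. by move=> [a [b [c [e ->]]]]; apply: measurableX; exact: measurable_itv. Qed.

Let rectangles_generate f : measurable_fun setT f ->
  forall C, measurable C -> <<s rectangles >> (setT `&` f @^-1` C).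
Proof.
move=> mf C mC.
have mT : @measurable _ (g_sigma_algebraType rectangles) setT by exact: measurableT.
have m1 : gmeasurable_fun rectangles setT (fun p : Rm * Rm => p.1).
  apply: (measurability _ (RGenOInfty.measurableE R)) => _ [_ [c ->] <-].
  have -> : setT `&` (fun p : Rm * Rm => p.1) @^-1` `]c, +oo[%classic =
      \bigcup_n (`]c, n%:R]%classic `*` `]- n%:R, n%:R]%classic).
    apply/seteqP; split => -[x y] /=; rewrite ?in_itv/=.
      rewrite andbT => -[_ cx].
      have [n [h1 h2]] : exists n : nat, x <= n%:R /\ `|y| < n%:R.
        by apply: (@filter_ex _ \oo); near=> n; split; near: n; [exact: nbhs_infty_ger|exact: nbhs_infty_gtr].
      exists n => //; split => /=; rewrite in_itv/= ?cx//.
      by move: h2; rewrite ltr_norml => /andP[-> /ltW ->].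
    by move=> [n _ [/=]]; rewrite in_itv/= => /andP[-> _] _.
  apply: (@bigcupT_measurable _ (g_sigma_algebraType rectangles)) => n; apply: sub_sigma_algebra.
  by exists c, n%:R, (- n%:R), n%:R.
have m2 : gmeasurable_fun rectangles setT (fun p : Rm * Rm => p.2).
  apply: (measurability _ (RGenOInfty.measurableE R)) => _ [_ [c ->] <-].
  have -> : setT `&` (fun p : Rm * Rm => p.2) @^-1` `]c, +oo[%classic =
      \bigcup_n (`]- n%:R, n%:R]%classic `*` `]c, n%:R]%classic).
    apply/seteqP; split => -[y x] /=; rewrite ?in_itv/=.
      rewrite andbT => -[_ cx].
      have [n [h1 h2]] : exists n : nat, x <= n%:R /\ `|y| < n%:R.
        by apply: (@filter_ex _ \oo); near=> n; split; near: n; [exact: nbhs_infty_ger|exact: nbhs_infty_gtr].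
      exists n => //; split => /=; rewrite in_itv/= ?cx//.
      by move: h2; rewrite ltr_norml => /andP[-> /ltW ->].
    by move=> [n _ [_ /=]]; rewrite in_itv/= => /andP[-> _].
  apply: (@bigcupT_measurable _ (g_sigma_algebraType rectangles)) => n; apply: sub_sigma_algebra.
  by exists (- n%:R), n%:R, c, n%:R.
have mid : @measurable_fun _ _ (g_sigma_algebraType rectangles) (Rm * Rm)%type setT id.
  have : @measurable_fun _ _ (g_sigma_algebraType rectangles) (Rm * Rm)%type setT (fun p => (p.1, p.2)).
    exact: (@measurable_fun_pair_in _ _ _ (g_sigma_algebraType rectangles)).
  by apply: eq_measurable_fun => -[x y].
have := mid mT _ (mf measurableT C mC); by rewrite !setTI.
Unshelve. all: by end_near. Qed.

(** Clear for indicators of rectangles; the property is linear and, because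
    translations preserve the norm, closed in L2. *)
Lemma translation_continuity f : measurable_fun setT f -> (sqint planar setT f < +oo)%E ->
  forall eps : R, 0 < eps -> exists2 delta : R, 0 < delta &
    forall h k, `|h| <= delta -> `|k| <= delta ->
      (sqint planar setT (fun p => f (p.1 + h, p.2 + k) - f p)%R <= eps%:E)%E.
Proof.
move=> mf fin.
pose V (g : Rm * Rm -> R) := measurable_fun setT g /\ forall eps : R, 0 < eps -> exists2 delta : R, 0 < delta &
    forall h k, `|h| <= delta -> `|k| <= delta ->
      (sqint planar setT (fun p => g (p.1 + h, p.2 + k) - g p)%R <= eps%:E)%E.
pose Dn n : set (Rm * Rm) := `]- n%:R, n%:R]%classic `*` `]- n%:R, n%:R]%classic.
suff [] : V f by [].
have msh (g : Rm * Rm -> R) h k : measurable_fun setT g -> measurable_fun setT (fun p : Rm * Rm => g (p.1 + h, p.2 + k)).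
  by move=> mg; exact: (measurableT_comp mg (mshift h k)).
apply: (@L2_density _ _ _ planar setT rectangles Dn V) => //.
- by move=> n; exists (- n%:R), n%:R, (- n%:R), n%:R.
- apply/seteqP; split => // -[x y] _.
  have [n [h1 h2]] : exists n : nat, `|x| < n%:R /\ `|y| < n%:R.
    by apply: (@filter_ex _ \oo); near=> n; split; near: n; exact: nbhs_infty_gtr.
  exists n => //; split => /=; rewrite in_itv/=.
    by move: h1; rewrite ltr_norml => /andP[-> /ltW ->].
  by move: h2; rewrite ltr_norml => /andP[-> /ltW ->].
- move=> n k nk; apply/subsetPset => -[x y] [/=]; rewrite !in_itv/=.
  have nk2 : n%:R <= k%:R :> R by rewrite ler_nat.
  have nk3 : - k%:R <= - n%:R :> R by rewrite lerN2.
  move=> /andP[h1 h2] /andP[h3 h4]; split => /=; rewrite in_itv/=.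
    by rewrite (le_lt_trans nk3 h1) (le_trans h2).
  by rewrite (le_lt_trans nk3 h3) (le_trans h4).
- move=> n; pose A : set Rm := `]- n%:R, n%:R]%classic.
  have e : planar (Dn n) = (leb A * leb A)%E by apply: planar_box; exact: measurable_itv.
  apply: (eq_ind_r (fun y => y < +oo)%E _ e).
  by rewrite lebesgue_measure_itv/=; case: ifP => _; rewrite ?mule0// -EFinB -EFinM ltry.
- move=> A rA; split; first by apply: measurable_indic; exact: rectangles_measurable.
  have [a [b [c [e AE]]]] := rA.
  have indE p : \1_A p = \1_(`]a, b]%classic) p.1 * \1_(`]c, e]%classic) p.2 :> R.
    rewrite AE !indicE -natrM mulnb; congr (_%:R); congr nat_of_bool.
    apply/idP/andP => [/set_mem[/= ? ?]|[/set_mem h1 /set_mem h2]]; last by apply: mem_set; split.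
    by split; exact: mem_set.
  move=> eps eps0; pose K := 8 * (len a b + len c e).
  have K0 : 0 <= K by rewrite mulr_ge0// addr_ge0.
  have K1 : 0 < K + 1 by rewrite ltr_wpDl.
  exists (eps / (K + 1)); first by rewrite divr_gt0.
  move=> h k hd kd.
  have ms1 (u v w : R) : measurable_fun setT (fun x : Rm => \1_(`]u, v]%classic) (x + w) : R).
    by apply: measurableT_comp => //; exact: measurable_funD.
  have m1 : measurable_fun setT (fun p : Rm * Rm => (\1_(`]a, b]%classic) (p.1 + h) - \1_(`]a, b]%classic) p.1) * \1_(`]c, e]%classic) (p.2 + k) : R).
    apply: measurable_funM.
      apply: (measurableT_comp (f := fun x : Rm => \1_(`]a, b]%classic) (x + h) - \1_(`]a, b]%classic) x : R)); last exact: measurable_fst.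
      exact: measurable_funB.
    by apply: (measurableT_comp (ms1 c e k)); exact: measurable_snd.
  have m2 : measurable_fun setT (fun p : Rm * Rm => \1_(`]a, b]%classic) p.1 * (\1_(`]c, e]%classic) (p.2 + k) - \1_(`]c, e]%classic) p.2) : R).
    apply: measurable_funM.
      by apply: (measurableT_comp (mitv_indic a b)); exact: measurable_fst.
    apply: (measurableT_comp (f := fun x : Rm => \1_(`]c, e]%classic) (x + k) - \1_(`]c, e]%classic) x : R)); last exact: measurable_snd.
    exact: measurable_funB.
  rewrite (@eq_sqint _ _ _ planar setT _ (fun p => (\1_(`]a, b]%classic) (p.1 + h) - \1_(`]a, b]%classic) p.1) * \1_(`]c, e]%classic) (p.2 + k) + \1_(`]a, b]%classic) p.1 * (\1_(`]c, e]%classic) (p.2 + k) - \1_(`]c, e]%classic) p.2))); last first.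
    by move=> p _; rewrite !indE /=; ring.
  apply: le_trans (sqintD _ measurableT m1 m2) _.
  rewrite (@sqint_tensor (fun x => \1_(`]a, b]%classic) (x + h) - \1_(`]a, b]%classic) x) (fun y => \1_(`]c, e]%classic) (y + k)))//; last exact: measurable_funB.
  rewrite (@sqint_tensor (\1_(`]a, b]%classic)) (fun y => \1_(`]c, e]%classic) (y + k) - \1_(`]c, e]%classic) y))//; last exact: measurable_funB.
  have -> : sqint leb setT (fun y : Rm => \1_(`]c, e]%classic) (y + k) : R) = (len c e)%:E.
    rewrite -lenE; apply: (integral_shift k (measurable_sq (mitv_indic c e))) => x; by rewrite lee_fin sqr_ge0.
  rewrite lenE.
  apply: (@le_trans _ _ (2%:E * ((4 * `|h|)%:E * (len c e)%:E) + 2%:E * ((len a b)%:E * (4 * `|k|)%:E))%E).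
    apply: leeD; apply: lee_wpmul2l; rewrite ?lee_fin//.
      by apply: lee_wpmul2r; [rewrite lee_fin len_ge0|exact: sqint_indic_shift].
    by apply: lee_wpmul2l; [rewrite lee_fin len_ge0|exact: sqint_indic_shift].
  rewrite -!EFinM -EFinD lee_fin.
  apply: le_trans (scale_small K0 eps0).
  rewrite /K; move: (eps / _) (len_ge0 a b) (len_ge0 c e) hd kd => z; nra.
- move=> c g1 g2 [mg1 H1] [mg2 H2]; split.
    by apply: measurable_funD => //; exact: measurable_funM.
  move=> eps eps0.
  have c2 : 0 <= 2 * c ^+ 2 by rewrite mulr_ge0// sqr_ge0.
  have e2 : 0 < eps / 2 by rewrite divr_gt0.
  have e4 : 0 < eps / 4 by rewrite divr_gt0.
  have c21 : 0 < 2 * c ^+ 2 + 1 by rewrite ltr_wpDl.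
  have [d1 d10 h1] := H1 _ (divr_gt0 e2 c21); have [d2 d20 h2] := H2 _ e4.
  exists (Num.min d1 d2); first by rewrite lt_min d10.
  move=> h k; rewrite !le_min => /andP[hd1 hd2] /andP[kd1 kd2].
  rewrite (@eq_sqint _ _ _ planar setT _ (fun p => c * (g1 (p.1 + h, p.2 + k) - g1 p) + (g2 (p.1 + h, p.2 + k) - g2 p))); last first.
    by move=> p _; ring.
  apply: le_trans (sqintD _ _ _ _) _ => //.
  + by apply: measurable_funM => //; apply: measurable_funB => //; exact: msh.
  + by apply: measurable_funB => //; exact: msh.
  rewrite sqintZ//; last by apply: measurable_funB => //; exact: msh.
  have -> : eps%:E = ((eps / 2)%:E + 2%:E * (eps / 4)%:E)%E.
    by rewrite -EFinM -EFinD; congr EFin; field.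
  apply: leeD; last by apply: lee_wpmul2l; rewrite ?lee_fin//; exact: h2.
  apply: (@le_trans _ _ (2%:E * ((c ^+ 2)%:E * (eps / 2 / (2 * c ^+ 2 + 1))%:E))%E).
    by do 2 (apply: lee_wpmul2l; rewrite ?lee_fin ?sqr_ge0//); exact: h1.
  by rewrite -!EFinM lee_fin mulrA; exact: scale_small.
- move=> g mg Vg; split => // eps eps0.
  have e16 : 0 < eps / 16 by rewrite divr_gt0.
  have [g' [mg' H'] [_ gg']] := Vg _ e16.
  have [d0 d00 hd] := H' _ e16.
  exists d0 => // h k hd0 kd0.
  have s1 : (sqint planar setT (fun p => g (p.1 + h, p.2 + k) - g' (p.1 + h, p.2 + k))%R <= (eps / 16)%:E)%E.
    rewrite (@sqint_shift h k (fun p => g p - g' p))//; exact: measurable_funB.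
  have s2 := sqint_tri_eps measurableT (msh _ h k mg) (msh _ h k mg') mg' s1 (hd _ _ hd0 kd0).
  rewrite sqint_subC in gg'.
  have s3 := sqint_tri_eps measurableT (msh _ h k mg) mg' mg s2 gg'.
  apply: le_trans s3 _; rewrite lee_fin; lra.
- exact: rectangles_generate.
Unshelve. all: by end_near. Qed.

(** Dominated convergence: the weights tend to 0 at every positive time. *)
Lemma exponential_weight f : measurable_fun setT f -> (forall p, p.1 < 0 -> f p = 0) ->
  (sqint planar setT f < +oo)%E -> forall eps : R, 0 < eps ->
  exists n : nat, (\int[planar]_p (f p ^+ 2 * expR (- (n%:R * p.1)))%:E <= eps%:E)%E.
Proof.
move=> mf f0 fin eps eps0.
have mw n : measurable_fun setT (fun p : Rm * Rm => (f p ^+ 2 * expR (- (n%:R * p.1)))%:E).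
  apply/measurable_EFinP; apply: measurable_funM; first exact: measurable_funX.
  apply: measurableT_comp; first exact: measurable_expR.
  by apply: measurableT_comp => //; apply: measurable_funM => //; exact: measurable_fst.
have w0 n (p : Rm * Rm) : (0 <= (f p ^+ 2 * expR (- (n%:R * p.1)))%:E)%E.
  by rewrite lee_fin mulr_ge0 ?sqr_ge0// expR_ge0.
have f20 p : (0 <= (f p ^+ 2)%:E)%E by rewrite lee_fin sqr_ge0.
have [||||_ _ lim0] := @dominated_convergence _ _ _ planar setT measurableT
  (fun n p => (f p ^+ 2 * expR (- (n%:R * p.1)))%:E) (cst 0%E) (fun p => (f p ^+ 2)%:E) mw _ _ _ _.
- exact: measurable_cst.
- exists ([set 0] `*` setT); split.
  + by apply: measurableX.
  + transitivity (leb [set 0%R] * leb setT)%E; first exact: planar_box.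
    by rewrite lebesgue_measure_set1 mul0e.
  + move=> p np; split => //; apply: contrapT => p0; apply: np => _.
    have /orP[pn|pp] : (p.1 < 0) || (0 < p.1) by rewrite -neq_lt; exact/eqP.
      by rewrite f0//; under eq_fun do rewrite expr0n mul0r; exact: cvg_cst.
    have e1 : (fun n : nat => f p ^+ 2 * expR (- (n%:R * p.1))) @ \oo --> f p ^+ 2 * 0.
      apply: cvgMr; have p0' : `|expR (- p.1)| < 1 by rewrite ger0_norm ?expR_ge0// expR_lt1 oppr_lt0.
      apply: cvg_trans (cvg_expr p0'); apply: near_eq_cvg; apply: nearW => n.
      by rewrite -expRM_natl -mulrN.
    rewrite mulr0 in e1; apply: cvg_EFin; [exact: nearW|exact: e1].
- apply/integrableP; split; first exact: measurable_sq.
  by under eq_integral do rewrite gee0_abs//.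
- apply: aeW => p n _; rewrite gee0_abs// lee_fin.
  have [pn|p0] := ltP p.1 0; first by rewrite f0// expr0n mul0r.
  by rewrite ler_piMr ?sqr_ge0// expR_le1 oppr_le0 mulr_ge0.
rewrite integral0 in lim0.
have pos n : (0 <= \int[planar]_p (f p ^+ 2 * expR (- (n%:R * p.1)))%:E)%E by exact: integral_ge0.
have [n _ /(_ n (leqnn n))] := cvge0_le pos lim0 eps0.
by exists n.
Qed.

End plane.

(** * Stochastic convolutions *)

Lemma eq_lee {R : realType} (x y : \bar R) : x = y -> (x <= y)%E.
Proof. by move->. Qed.

Section swapped_tonelli.
Context {d1 d2 : measure_display} {T1 : measurableType d1} {T2 : measurableType d2}.
Context {R : realType}.
Variables (m1 : {sigma_finite_measure set T1 -> \bar R})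
          (m2 : {sigma_finite_measure set T2 -> \bar R}).

Lemma sections_bound (D : set T2) (f : T1 * T2 -> \bar R) (b : T2 -> \bar R) :
  measurable D -> measurable_fun (setT `*` D) f -> (forall z, 0 <= f z)%E ->
  measurable_fun setT b -> (forall y, 0 <= b y)%E ->
  (forall y, D y -> \int[m1]_x f (x, y) <= b y)%E ->
  (\int[(m1 \x m2)%E]_(z in setT `*` D) f z <= \int[m2]_y b y)%E.
Proof.
move=> mD mf f0 mb b0 fb.
have mDD : measurable (setT `*` D : set (T1 * T2)) by exact: measurableX.
have mp : measurable_fun setT (f \_ (setT `*` D)) by apply/(measurable_restrictT _ _).1.
have p0 z : (0 <= (f \_ (setT `*` D)) z)%E by rewrite patchE; case: ifP.
rewrite integral_mkcond fubini_tonelli2//.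
apply: ge0_le_integral => //.
- by move=> y _; apply: integral_ge0.
- exact: (measurable_fun_fubini_tonelli_G (m1 := m1) (f \_ (setT `*` D)) mp p0).
- move=> y _; rewrite /fubini_G; have [Dy|nDy] := pselect (D y).
    apply: le_trans (fb y Dy); apply: eq_lee; apply: eq_integral => x _.
    by rewrite patchE mem_set.
  rewrite integral0_eq// => x _; rewrite patchE memNset// => -[_ /=]; exact: nDy.
Qed.

End swapped_tonelli.

Section stochastic_convolutions.
Context {R : realType} {d : measure_display} {Omega : measurableType d}.
Local Notation Rm := (measurableTypeR R).
Local Notation E := (Rm * (Rm * Rm))%type.
Local Notation S := (Omega * (Rm * Rm))%type.
Variables (P : probability Omega R) (T : R) (nu : {sigma_finite_measure set Rm -> \bar R}).
Variable N : R.-ker Omega ~> E.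
Variable mu : {sigma_finite_measure set E -> \bar R}.
Hypothesis T_gt0 : 0 < T.
Hypothesis muE : forall A, measurable A -> intensity nu A = mu A.
Hypothesis NP : poisson_random_measure P T nu N.
Hypothesis nu_moment : finite_second_moment nu.
Local Notation J := (jump_domain T).
Local Notation Q := (P \x mu)%E.
Local Notation QJ := (setT `*` J).
Local Notation F := (noise_filtration P T nu N).
Local Notation events := (noise_events P T nu N).
Local Notation pred_sets := (predictable_sets P T nu N).
Local Notation M := (process_measure P).
Local Notation planar := (@planar R).
Local Notation v := (jump_variance nu).

Let NPJ : poisson_on P J mu N := poisson_onP muE NP.
Let mJ : measurable J := measurable_jump_domain T.
Let mQJ : measurable (QJ : set (Omega * E)). Proof. exact: measurableX. Qed.
Let admF : admissible P J mu N (is_elementary T nu F) :=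
  admissible_elementary muE (nonanticipating_noise muE NP nu_moment).

Let PD : set S := setT `*` space_time T.
Let mST : measurable (space_time T : set (Rm * Rm)) := measurable_space_time T.
Let mPD : measurable PD. Proof. exact: measurableX. Qed.
Let mPDg : @measurable _ (g_sigma_algebraType pred_sets) PD.
Proof. by apply: sub_sigma_algebra; exact: predictable_sets_domain. Qed.

Definition ito (A : S -> R) (I : Omega -> R) : Prop :=
  integral_of P J mu N (is_elementary T nu F) (jump_integrand A) I.

Lemma ito_measurable A I : ito A I -> measurable_fun setT I.
Proof. by case. Qed.

Lemma ito_isometry A A' I I' (K : R) : measurable_fun PD A -> measurable_fun PD A' ->
  ito A I -> ito A' I' -> (sqint M PD (fun p => A p - A' p)%R <= K%:E)%E ->
  (sqint P setT (fun o => I o - I' o)%R <= (16 * v * K)%:E)%E.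
Proof.
move=> mA mA' HI HI' AK; rewrite -mulrA; apply: (integral_isometry mJ NPJ admF HI HI').
rewrite (@eq_sqint _ _ _ Q QJ _ (fun z => jump_integrand (fun p => A p - A' p) z.1 z.2)); last first.
  by move=> z _; rewrite /jump_integrand mulrBl.
rewrite (sqint_jump_integrand P muE nu_moment); last exact: measurable_funB.
rewrite EFinM; apply: lee_wpmul2l => //.
by rewrite lee_fin jump_variance_ge0.
Qed.

(** Integrands need only agree after time 0, which the intensity does not
    charge. *)
Lemma ito_ae A A' I I' : measurable_fun PD A' -> (forall p, PD p -> 0 < p.2.1 -> A p = A' p) ->
  measurable_fun setT I' -> {ae P, forall o, I o = I' o} -> ito A I -> ito A' I'.
Proof.
move=> mA' AA' mI' II' HI; have [mI mH _] := HI.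
apply: (integral_of_ae mJ admF HI mI'); first exact: measurable_jump_integrand.
- apply: (sqint_after_zero P muE).
    by apply: measurable_funB => //; exact: measurable_jump_integrand.
  by move=> z [_ [zT _]] z0; rewrite /jump_integrand AA' ?subrr//.
- rewrite /sqint; rewrite (ae_eq_integral (cst 0%E))//.
  + by rewrite integral_cst//= mul0e.
  + by apply: measurable_sq; exact: measurable_funB.
  + by apply: filterS II' => o -> _; rewrite subrr expr0n.
Qed.

Lemma ito0 : ito (fun=> 0) (fun=> 0).
Proof.
split => //; first by apply: measurable_jump_integrand.
move=> eps eps0; exists [::]; split => //.
- rewrite sqint0 ?lee_fin ?ltW// => z _.
  by rewrite /simple_integrand big_nil /jump_integrand mul0r subrr.
- rewrite sqint0 ?lee_fin ?ltW// => o _.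
  by rewrite /simple_sum big_nil subrr.
Qed.

(** The integrand vanishes after t, so the integral only involves the past of t
    and is known at time t. *)
Lemma ito_exists t A : 0 <= t <= T -> gmeasurable_fun pred_sets PD A ->
  (sqint M PD A < +oo)%E -> (forall p, PD p -> t < p.2.1 -> A p = 0) ->
  exists2 I, ito A I & gmeasurable_fun (events t) setT I.
Proof.
move=> /andP[t0 tT] gA finA A0.
have mA := predictable_measurable_fun gA.
have fin : (sqint M (past t) A < +oo)%E.
  apply: le_lt_trans finA; apply: ge0_subset_integral => //.
  - exact: measurable_past.
  - exact: measurable_sq.
  - by move=> p _; rewrite lee_fin sqr_ge0.
  - exact: past_sub.
have [I HI gI] := adapted_integral_exists muE NP nu_moment t0 tT (predictable_past_fun tT gA) fin.
exists I => //; have [mI _ _] := HI.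
apply: (ito_ae mA _ mI _ HI) => [p Dp p0|]; last exact: aeW.
rewrite indicE; have [pt|tp] := leP p.2.1 t.
  by rewrite mem_set ?mulr1//= in_itv/= p0.
by rewrite A0// mul0r.
Qed.

Variable G : R -> R -> R.
Hypothesis mG : measurable_fun (space_time T) (fun q : Rm * Rm => G q.1 q.2).
Hypothesis finG : (\int[area]_(q in space_time T) (G q.1 q.2 ^+ 2)%:E < +oo)%E.

(** Cut off outside [0, T], so that G(t - s, x - y) vanishes for s > t and
    convolutions become integrals over the whole space-time. *)
Definition kernel : Rm * Rm -> R := (fun q => G q.1 q.2) \_ (space_time T).

Lemma measurable_kernel_fun : measurable_fun setT kernel.
Proof. exact: (measurable_restrictT _ mST).1. Qed.

Lemma kernel_fin : (sqint planar setT kernel < +oo)%E.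
Proof.
apply: le_lt_trans finG; rewrite [leRHS]integral_mkcond; apply: eq_lee.
apply: eq_integral => q _; rewrite /kernel !patchE; case: ifP => // _; exact: (congr1 EFin (expr0n R 2)).
Qed.

Lemma kernel_past p : p.1 < 0 -> kernel p = 0.
Proof.
move=> p0; rewrite /kernel patchE memNset// => -[/= + _].
by rewrite in_itv/= leNgt p0.
Qed.

Definition shifted (t x : R) (q : Rm * Rm) : R := kernel (t - q.1, x - q.2).

Lemma measurable_shifted t x : measurable_fun setT (shifted t x).
Proof.
apply: (measurableT_comp measurable_kernel_fun).
by apply: measurable_fun_pair; apply: measurable_funB.
Qed.

Definition conv (t x : R) (Y : S -> R) (p : S) : R := shifted t x p.2 * Y p.

Lemma predictable_conv t x Y : gmeasurable_fun pred_sets PD Y -> gmeasurable_fun pred_sets PD (conv t x Y).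
Proof.
move=> gY; apply: (@measurable_funM _ (g_sigma_algebraType pred_sets)) => //.
have ms : measurable_fun (space_time T) (shifted t x) by apply: measurable_funTS; exact: measurable_shifted.
exact: (predictable_deterministic T_gt0 ms).
Qed.

Lemma measurable_conv t x Y : measurable_fun PD Y -> measurable_fun PD (conv t x Y).
Proof.
move=> mY; apply: measurable_funM => //; apply: measurable_funTS.
by apply: (measurableT_comp (measurable_shifted t x)); exact: measurable_snd.
Qed.

(** The expectation is integrated first: only a bound on E|Y(s,y)|^2 is needed
    for each point (s, y). *)
Lemma sqint_weighted (k : Rm * Rm -> R) (Y : S -> R) (b : Rm * Rm -> R) :
  measurable_fun setT k -> measurable_fun PD Y -> measurable_fun setT b -> (forall q, 0 <= b q) ->
  (forall q, space_time T q -> (sqint P setT (fun o => Y (o, q)) <= (b q)%:E)%E) ->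
  (sqint M PD (fun p => k p.2 * Y p)%R <= \int[planar]_q (k q ^+ 2 * b q)%:E)%E.
Proof.
move=> mk mY mb b0 Yb.
apply: (@sections_bound _ _ _ _ _ P planar (space_time T) (fun p => ((k p.2 * Y p) ^+ 2)%:E)) => //.
- apply: measurable_sq; apply: measurable_funM => //.
  by apply: measurable_funTS; apply: (measurableT_comp mk); exact: measurable_snd.
- by move=> p; rewrite lee_fin sqr_ge0.
- by apply/measurable_EFinP; apply: measurable_funM => //; exact: measurable_funX.
- by move=> q; rewrite lee_fin mulr_ge0 ?sqr_ge0.
- move=> q qT /=.
  have mYq : measurable_fun setT (fun o => Y (o, q)).
    apply: (measurable_comp (F := PD)) => //; first by move=> _ [om _ <-].
    rewrite -[X in (X <= _)%E]/(sqint P setT (fun o => k q * Y (o, q))%R) sqintZ// [leRHS]EFinM.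
  by apply: lee_wpmul2l; [rewrite lee_fin sqr_ge0|exact: Yb].
Qed.

(** Reflecting space-time turns the exponential bound m e^(ns) into a
    weight e^(-nr) on the kernel. *)
Lemma sqint_conv t x Y (m c : R) (n : nat) : measurable_fun PD Y -> 0 <= m ->
  (forall q, space_time T q -> (sqint P setT (fun o => Y (o, q)) <= (m * expR (n%:R * q.1))%:E)%E) ->
  (\int[planar]_p (kernel p ^+ 2 * expR (- (n%:R * p.1)))%:E <= c%:E)%E ->
  (sqint M PD (conv t x Y) <= (m * expR (n%:R * t) * c)%:E)%E.
Proof.
move=> mY m0 Yb kc.
have me (a : R) : measurable_fun setT (fun q : Rm * Rm => expR (a * q.1)).
  by apply: measurableT_comp; [exact: measurable_expR|apply: measurable_funM].
apply: le_trans (sqint_weighted (measurable_shifted t x) mY _ _ Yb) _.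
- exact: measurable_funM.
- by move=> q; rewrite mulr_ge0// expR_ge0.
pose h (p : Rm * Rm) := ((m * expR (n%:R * t))%:E * (kernel p ^+ 2 * expR (- (n%:R * p.1)))%:E)%E.
have mw : measurable_fun setT (fun p : Rm * Rm => (kernel p ^+ 2 * expR (- (n%:R * p.1)))%:E).
  apply/measurable_EFinP; apply: measurable_funM; first by apply: measurable_funX; exact: measurable_kernel_fun.
  by under eq_fun do rewrite -mulNr; exact: me.
have w0 (p : Rm * Rm) : (0 <= (kernel p ^+ 2 * expR (- (n%:R * p.1)))%:E)%E.
  by rewrite lee_fin mulr_ge0 ?sqr_ge0// expR_ge0.
have m0' : 0 <= m * expR (n%:R * t) by rewrite mulr_ge0// expR_ge0.
have -> : (\int[planar]_q (shifted t x q ^+ 2 * (m * expR (n%:R * q.1)))%:E = \int[planar]_q h (t - q.1, x - q.2)%R)%E.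
  apply: eq_integral => q _; rewrite /h /shifted -EFinM; congr EFin => /=.
  have -> : expR (n%:R * q.1) = expR (n%:R * t) * expR (- (n%:R * (t - q.1))) :> R.
    by rewrite -expRD; congr expR; ring.
  by ring.
rewrite plane_reflection; last 2 first.
- exact: measurable_funeM.
- by move=> p; rewrite /h mule_ge0// lee_fin.
rewrite ge0_integralZl// [leRHS]EFinM; apply: lee_wpmul2l => //.
Qed.

Definition kernel_norm : R := fine (sqint planar setT kernel).

Lemma kernel_normE : sqint planar setT kernel = kernel_norm%:E.
Proof. by rewrite fineK// ge0_fin_numE ?kernel_fin// sqint_ge0. Qed.

Lemma kernel_norm_ge0 : 0 <= kernel_norm.
Proof. by apply: fine_ge0; exact: sqint_ge0. Qed.

Lemma sqint_conv_bound t x Y (m : R) : measurable_fun PD Y -> 0 <= m ->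
  (forall q, space_time T q -> (sqint P setT (fun o => Y (o, q)) <= m%:E)%E) ->
  (sqint M PD (conv t x Y) <= (m * kernel_norm)%:E)%E.
Proof.
move=> mY m0 Yb.
have := @sqint_conv t x Y m kernel_norm 0%N mY m0.
rewrite mul0r expR0 mulr1; apply.
- by move=> q qT; rewrite mul0r expR0 mulr1; exact: Yb.
- rewrite -kernel_normE; apply: eq_lee; apply: eq_integral => p _.
  by rewrite mul0r oppr0 expR0 mulr1.
Qed.

(** The modulus of continuity of a convolution is that of the translates of
    the kernel. *)
Lemma convolution_modulus Y (m : R) : measurable_fun PD Y -> 0 <= m ->
  (forall q, space_time T q -> (sqint P setT (fun o => Y (o, q)) <= m%:E)%E) ->
  forall eps : R, 0 < eps -> exists2 h : R, 0 < h &
  forall t x t' x' I I', ito (conv t x Y) I -> ito (conv t' x' Y) I' ->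
    `|t - t'| <= h -> `|x - x'| <= h ->
    (sqint P setT (fun o => I o - I' o)%R <= eps%:E)%E.
Proof.
move=> mY m0 Yb eps eps0.
pose K := 16 * v * m.
have v0 : 0 <= v := jump_variance_ge0 nu.
have K0 : 0 <= K by rewrite !mulr_ge0.
have K1 : 0 < K + 1 by rewrite ltr_wpDl.
have [h h0 hk] := translation_continuity measurable_kernel_fun kernel_fin (divr_gt0 eps0 K1).
exists h => // t x t' x' I I' HI HI' tt' xx'.
have b1 : (sqint M PD (fun p => conv t x Y p - conv t' x' Y p)%R <= (m * (eps / (K + 1)))%:E)%E.
  rewrite (@eq_sqint _ _ _ M PD _ (fun p => (shifted t x p.2 - shifted t' x' p.2) * Y p)); last first.
    by move=> p _; rewrite /conv mulrBl.
  apply: le_trans (sqint_weighted (k := fun q => shifted t x q - shifted t' x' q) (b := fun=> m) _ mY _ _ Yb) _ => //.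
    by apply: measurable_funB; exact: measurable_shifted.
  under eq_integral do rewrite mulrC EFinM.
  have ms : measurable_fun setT (fun q : Rm * Rm => shifted t x q - shifted t' x' q).
    by apply: measurable_funB; exact: measurable_shifted.
  rewrite ge0_integralZl//; last 2 first.
  - exact: measurable_sq.
  - by move=> q _; rewrite lee_fin sqr_ge0.
  rewrite [leRHS]EFinM; apply: lee_wpmul2l => //.
  apply: le_trans (hk _ _ tt' xx').
  rewrite -(@sqint_reflection _ t' x' (fun p => kernel (p.1 + (t - t'), p.2 + (x - x')) - kernel p)); last first.
    apply: measurable_funB; last exact: measurable_kernel_fun.
    apply: (measurableT_comp measurable_kernel_fun).
    by apply: measurable_fun_pair; apply: measurable_funD.
  apply: eq_lee; apply: eq_sqint => q _ /=; rewrite /shifted; congr (kernel (_, _) - _).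
    by ring.
  by ring.
have := ito_isometry (measurable_conv t x mY) (measurable_conv t' x' mY) HI HI' b1.
move/le_trans; apply; rewrite lee_fin mulrA -/K; exact: scale_small.
Qed.

Lemma convolution_bound Y (m : R) t x I : measurable_fun PD Y -> 0 <= m ->
  (forall q, space_time T q -> (sqint P setT (fun o => Y (o, q)) <= m%:E)%E) ->
  ito (conv t x Y) I -> (sqint P setT I <= (16 * v * (m * kernel_norm))%:E)%E.
Proof.
move=> mY m0 Yb HI.
have m00 : measurable_fun PD (fun=> 0 : R) by exact: measurable_cst.
have := ito_isometry (measurable_conv t x mY) m00 HI ito0 (K := m * kernel_norm) _.
rewrite (@eq_sqint _ _ _ P setT _ I); last by move=> o _; rewrite subr0.
apply; rewrite (@eq_sqint _ _ _ M PD _ (conv t x Y)); last by move=> o _; rewrite subr0.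
exact: sqint_conv_bound.
Qed.

(** The values of the convolution are integrals known at their own time, and they
    depend continuously on the point in L2, so a predictable version exists. *)
Lemma convolution_exists Y (m : R) : gmeasurable_fun pred_sets PD Y -> 0 <= m ->
  (forall q, space_time T q -> (sqint P setT (fun o => Y (o, q)) <= m%:E)%E) ->
  exists2 Z : R -> R -> Omega -> R, gmeasurable_fun pred_sets PD (joint Z) &
    forall t x, 0 <= t <= T -> ito (conv t x Y) (Z t x).
Proof.
move=> gY m0 Yb; have mY := predictable_measurable_fun gY.
have ex (q : R * R) : exists I, 0 <= q.1 <= T -> ito (conv q.1 q.2 Y) I /\ gmeasurable_fun (events q.1) setT I.
  have [qT|qT] := boolP (0 <= q.1 <= T); last by exists (fun=> 0).
  have [|||I HI gI] := @ito_exists q.1 (conv q.1 q.2 Y) qT.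
  - exact: predictable_conv.
  - exact: le_lt_trans (sqint_conv_bound q.1 q.2 mY m0 Yb) (ltry _).
  - move=> p _ qp; rewrite /conv /shifted kernel_past ?mul0r//=.
    by rewrite subr_lt0.
  by exists I.
have [Z0 HZ0] := choice ex.
pose Z t x := Z0 (t, x).
have HZ t x : 0 <= t <= T -> ito (conv t x Y) (Z t x) /\ gmeasurable_fun (events t) setT (Z t x).
  by move=> tT; exact: (HZ0 (t, x) tT).
have [X gX XZ] : exists2 X : R -> R -> Omega -> R, gmeasurable_fun pred_sets PD (joint X) &
    forall t x, 0 <= t <= T -> {ae P, forall o, X t x o = Z t x o}.
  apply: predictable_version => //.
  - by move=> t x tT; have [] := HZ t x tT.
  - move=> x; have T0 : 0 <= (0 : R) <= T by rewrite lexx ltW.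
    have [HZ1 _] := HZ 0 x T0.
    have : ito (conv 0 x Y) (fun=> 0).
      apply: ito_ae ito0 => //; last exact: aeW.
      - exact: measurable_conv.
      - by move=> p _ p0; rewrite /conv /shifted kernel_past ?mul0r//= sub0r oppr_lt0.
    move=> H0; apply: (integral_of_unique mJ NPJ admF HZ1 H0).
    by rewrite sqint0// => z _; rewrite subrr.
  - move=> eps eps0; have [h h0 hm] := convolution_modulus mY m0 Yb eps0.
    exists h => // t x t' x' tT tT'; apply: hm; [by have [] := HZ t x tT|by have [] := HZ t' x' tT'].
exists X => // t x tT; have [HZ1 _] := HZ t x tT.
have mX : measurable_fun setT (X t x).
  apply: (measurable_comp (F := PD) (f := joint X) (g := fun o => (o, (t, x)))) => //.
  - by move=> _ [om _ <-]; split.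
  - exact: predictable_measurable_fun gX.
apply: (ito_ae (measurable_conv t x mY) _ mX _ HZ1) => //.
by apply: filterS (XZ t x tT) => o ->.
Qed.

End stochastic_convolutions.

(** * Picard iteration *)

Lemma eq_ler {R : numDomainType} (x y : R) : x = y -> x <= y.
Proof. by move->. Qed.

Lemma decay_le {R : realFieldType} (a m e e' : R) : 0 <= a -> 0 <= m -> e <= e' ->
  a * m * e <= m * e' * a.
Proof.
move=> a0 m0 ee'; have -> : m * e' * a = a * m * e' by ring.
by apply: ler_wpM2l => //; exact: mulr_ge0.
Qed.

Section picard_iteration.
Context {R : realType} {d : measure_display} {Omega : measurableType d}.
Local Notation Rm := (measurableTypeR R).
Local Notation E := (Rm * (Rm * Rm))%type.
Local Notation S := (Omega * (Rm * Rm))%type.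
Variables (P : probability Omega R) (T : R) (nu : {sigma_finite_measure set Rm -> \bar R}).
Variable N : R.-ker Omega ~> E.
Variable mu : {sigma_finite_measure set E -> \bar R}.
Hypothesis T_gt0 : 0 < T.
Hypothesis muE : forall A, measurable A -> intensity nu A = mu A.
Hypothesis NP : poisson_random_measure P T nu N.
Hypothesis nu_moment : finite_second_moment nu.
Local Notation pred_sets := (predictable_sets P T nu N).
Local Notation M := (process_measure P).
Local Notation planar := (@planar R).
Local Notation v := (jump_variance nu).
Local Notation ito := (ito P T nu N mu).

Let PD : set S := setT `*` space_time T.
Let mPD : measurable PD.
Proof. by apply: measurableX => //; exact: measurable_space_time. Qed.
Let mPDg : @measurable _ (g_sigma_algebraType pred_sets) PD.
Proof. by apply: sub_sigma_algebra; exact: predictable_sets_domain. Qed.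

Variables (w G : R -> R -> R) (sigma : R -> R) (L W : R).
Hypothesis mG : measurable_fun (space_time T) (fun q : Rm * Rm => G q.1 q.2).
Hypothesis finG : (\int[area]_(q in space_time T) (G q.1 q.2 ^+ 2)%:E < +oo)%E.
Hypothesis mw : measurable_fun (space_time T) (fun q : Rm * Rm => w q.1 q.2).
Hypothesis wW : forall q, space_time T q -> `|w q.1 q.2| <= W.
Hypothesis msigma : measurable_fun setT sigma.
Hypothesis sigmaL : forall a b, `|sigma a - sigma b| <= `|L * (a - b)|.

Local Notation cnv := (conv T G).

Definition phi (X : R -> R -> Omega -> R) : S -> R := sigma \o joint X.

Definition L2_bounded_by (m : R) (X : R -> R -> Omega -> R) : Prop :=
  forall q, space_time T q -> (sqint P setT (X q.1 q.2) <= m%:E)%E.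

(** X' is obtained from X by substitution in the right-hand side of the
    equation; a solution is a fixed point. *)
Definition picard_step (X X' : R -> R -> Omega -> R) : Prop :=
  forall t x, 0 <= t <= T -> ito (cnv t x (phi X)) (fun o => X' t x o - w t x).

Lemma predictable_phi X : gmeasurable_fun pred_sets PD (joint X) -> gmeasurable_fun pred_sets PD (phi X).
Proof. by move=> gX; exact: (measurableT_comp msigma gX). Qed.

Lemma measurable_phi X : measurable_fun PD (joint X) -> measurable_fun PD (phi X).
Proof. by move=> gX; exact: (measurableT_comp msigma gX). Qed.

Lemma measurable_section (A : S -> R) (q : Rm * Rm) : measurable_fun PD A -> space_time T q ->
  measurable_fun setT (fun o => A (o, q)).
Proof.
move=> mA qT; apply: (measurable_comp (F := PD) (f := A) (g := fun o => (o, q))) => //.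
by move=> _ [om _ <-]; split.
Qed.

Lemma measurable_at X (q : Rm * Rm) : measurable_fun PD (joint X) -> space_time T q ->
  measurable_fun setT (X q.1 q.2).
Proof. exact: (@measurable_section (joint X)). Qed.

Lemma sqint_phi_diff X X' q (b : R) : measurable_fun PD (joint X) -> measurable_fun PD (joint X') ->
  space_time T q -> (sqint P setT (fun o => X q.1 q.2 o - X' q.1 q.2 o)%R <= b%:E)%E ->
  (sqint P setT (fun o => phi X (o, q) - phi X' (o, q))%R <= (L ^+ 2 * b)%:E)%E.
Proof.
move=> mX mX' qT Xb.
have mq := measurable_at mX qT; have mq' := measurable_at mX' qT.
have md : measurable_fun setT (fun o => X q.1 q.2 o - X' q.1 q.2 o) by exact: measurable_funB.
have ms := measurable_section (measurable_phi mX) qT.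
have ms' := measurable_section (measurable_phi mX') qT.
apply: le_trans (le_sqint (g := fun o => L * (X q.1 q.2 o - X' q.1 q.2 o)) _ _ _ _ _) _ => //.
- exact: measurable_funB.
- exact: measurable_funM.
- by move=> o _; exact: sigmaL.
rewrite sqintZ// [leRHS]EFinM; apply: lee_wpmul2l => //.
by rewrite lee_fin sqr_ge0.
Qed.

(** The bound of E|sigma(X)|^2 in terms of one of E|X|^2, from
    |sigma(a)| <= |L a| + |sigma(0)|. *)
Definition phi_bound (m : R) : R := 2 * (L ^+ 2 * m) + 2 * sigma 0 ^+ 2.

Lemma phi_bound_ge0 m : 0 <= m -> 0 <= phi_bound m.
Proof. move=> m0; apply: addr_ge0; apply: mulr_ge0 => //; last exact: sqr_ge0.
by apply: mulr_ge0 => //; exact: sqr_ge0. Qed.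

Lemma sqint_cst (c : R) : sqint P setT (fun=> c) = (c ^+ 2)%:E.
Proof. by rewrite /sqint integral_probability_cst. Qed.

Lemma sqint_phi X m q : measurable_fun PD (joint X) -> L2_bounded_by m X -> space_time T q ->
  (sqint P setT (fun o => phi X (o, q)) <= (phi_bound m)%:E)%E.
Proof.
move=> mX Xm qT.
have m0 : measurable_fun PD (joint (fun _ _ _ => 0) : S -> R) by exact: measurable_cst.
have h := @sqint_phi_diff X (fun _ _ _ => 0) q m mX m0 qT.
have {}h : (sqint P setT (fun o => phi X (o, q) - phi (fun _ _ _ => 0) (o, q))%R <= (L ^+ 2 * m)%:E)%E.
  apply: h; rewrite (@eq_sqint _ _ _ P setT _ (X q.1 q.2)); first exact: Xm.
  by move=> o _; rewrite subr0.
have ms := measurable_section (measurable_phi mX) qT.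
have h2 : (sqint P setT (fun o => phi (fun _ _ _ => 0) (o, q) - 0)%R <= (sigma 0 ^+ 2)%:E)%E.
  by rewrite (@eq_sqint _ _ _ P setT _ (fun=> sigma 0)) ?sqint_cst// => o _; rewrite subr0.
have mc (c : R) : measurable_fun [set: Omega] (fun=> c) by exact: measurable_cst.
have := sqint_tri_eps measurableT ms (mc (sigma 0)) (mc 0) h h2.
by rewrite (@eq_sqint _ _ _ P setT _ (fun o => phi X (o, q)))// => o _; rewrite subr0.
Qed.

Lemma sqint_w t x (Z : Omega -> R) (b : R) : 0 <= t <= T -> measurable_fun setT Z ->
  (sqint P setT Z <= b%:E)%E -> (sqint P setT (fun o => w t x + Z o)%R <= (2 * W ^+ 2 + 2 * b)%:E)%E.
Proof.
move=> tT mZ Zb.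
apply: le_trans (sqintD P measurableT (@measurable_cst _ _ _ _ _ (w t x)) mZ) _.
rewrite (sqint_cst (w t x)) [leRHS]EFinD; apply: leeD; rewrite [leRHS]EFinM; apply: lee_wpmul2l => //.
rewrite lee_fin -real_normK ?num_real//.
have wtx : `|w t x| <= W by apply: (wW (q := (t, x))); split.
by rewrite lerXn2r// nnegrE (le_trans _ wtx).
Qed.

Lemma picard_step_bound X X' m t x : measurable_fun PD (joint X) -> 0 <= m -> L2_bounded_by m X ->
  picard_step X X' -> 0 <= t <= T ->
  (sqint P setT (fun o => X' t x o - w t x)%R <= (16 * v * (phi_bound m * kernel_norm T G))%:E)%E.
Proof.
move=> mX m0 Xm XX' tT.
apply: (convolution_bound muE NP nu_moment mG finG (measurable_phi mX) (phi_bound_ge0 m0) _ (XX' t x tT)).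
by move=> q; exact: sqint_phi.
Qed.

(** The convolution with sigma(X) has a predictable version, and so has its sum
    with the deterministic part. *)
Lemma picard_step_exists X m : gmeasurable_fun pred_sets PD (joint X) -> 0 <= m ->
  L2_bounded_by m X -> exists X' m', [/\ gmeasurable_fun pred_sets PD (joint X'), 0 <= m',
    L2_bounded_by m' X' & picard_step X X'].
Proof.
move=> gX m0 Xm; have mX := predictable_measurable_fun gX.
have [Z gZ HZ] := convolution_exists T_gt0 muE NP nu_moment mG finG (predictable_phi gX) (phi_bound_ge0 m0)
  (fun q => sqint_phi mX Xm).
pose X' t x o := w t x + Z t x o.
have gX' : gmeasurable_fun pred_sets PD (joint X').
  apply: (@measurable_funD _ (g_sigma_algebraType pred_sets)) => //.
  exact: (predictable_deterministic T_gt0 mw).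
have st : picard_step X X'.
  move=> t x tT; have := HZ t x tT; congr (ito _ _).
  by apply/funext => o; rewrite /X' addrAC subrr add0r.
have c0 : 0 <= 16 * v * (phi_bound m * kernel_norm T G).
  by rewrite !mulr_ge0 ?jump_variance_ge0 ?kernel_norm_ge0 ?phi_bound_ge0.
exists X', (2 * W ^+ 2 + 2 * (16 * v * (phi_bound m * kernel_norm T G))); split => //.
- by rewrite addr_ge0// mulr_ge0// sqr_ge0.
- move=> [t x] [/= tT _]; apply: sqint_w => //.
    exact: (ito_measurable (HZ t x tT)).
  have := @picard_step_bound X X' m t x mX m0 Xm st tT.
  rewrite (@eq_sqint _ _ _ P setT _ (Z t x))// => o _.
  by rewrite /X' addrAC subrr add0r.
Qed.

Lemma contraction_constant (m e c : R) : 0 <= m -> 0 <= e -> 16 * v * L ^+ 2 * c <= 8^-1 ->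
  16 * v * (L ^+ 2 * m * e * c) <= 8^-1 * m * e.
Proof.
move=> m0 e0 hc.
have -> : 16 * v * (L ^+ 2 * m * e * c) = 16 * v * L ^+ 2 * c * (m * e) by ring.
by rewrite -[leRHS]mulrA; apply: ler_wpM2r => //; exact: mulr_ge0.
Qed.

(** In the norm sup e^(-n t) E|X(t,x)|^2 with n large, substitution is a
    contraction. *)
Lemma picard_contraction : exists n : nat, forall X1 X2 X1' X2' m,
  measurable_fun PD (joint X1) -> measurable_fun PD (joint X2) ->
  picard_step X1 X1' -> picard_step X2 X2' -> 0 <= m ->
  (forall q, space_time T q ->
     (sqint P setT (fun o => X1 q.1 q.2 o - X2 q.1 q.2 o)%R <= (m * expR (n%:R * q.1))%:E)%E) ->
  (forall q, space_time T q ->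
     (sqint P setT (fun o => X1' q.1 q.2 o - X2' q.1 q.2 o)%R <= (8^-1 * m * expR (n%:R * q.1))%:E)%E).
Proof.
have v0 : 0 <= v := jump_variance_ge0 nu.
pose K := 16 * v * L ^+ 2.
have K0 : 0 <= K by apply: mulr_ge0; [exact: mulr_ge0|exact: sqr_ge0].
have K1 : 0 < K + 1 by rewrite ltr_wpDl.
have e8 : 0 < 8^-1 :> R by rewrite invr_gt0.
have [n kn] := exponential_weight (measurable_kernel_fun mG) (@kernel_past _ T G) (kernel_fin finG)
  (divr_gt0 e8 K1).
exists n => X1 X2 X1' X2' m mX1 mX2 st1 st2 m0 X12 [t x] [/= tT _].
have p1 := measurable_phi mX1; have p2 := measurable_phi mX2.
have Yb q : space_time T q ->
    (sqint P setT (fun o => phi X1 (o, q) - phi X2 (o, q))%R <= (L ^+ 2 * m * expR (n%:R * q.1))%:E)%E.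
  by move=> qT; rewrite -mulrA; apply: sqint_phi_diff => //; exact: X12.
have L2m : 0 <= L ^+ 2 * m by rewrite mulr_ge0// sqr_ge0.
have mY : measurable_fun PD (fun p => phi X1 p - phi X2 p) by exact: measurable_funB.
have AB : (sqint M PD (fun p => cnv t x (phi X1) p - cnv t x (phi X2) p)%R <=
    (L ^+ 2 * m * expR (n%:R * t) * (8^-1 / (K + 1)))%:E)%E.
  rewrite (@eq_sqint _ _ _ M PD _ (cnv t x (fun p => phi X1 p - phi X2 p))); last first.
    by move=> p _; rewrite /conv mulrBr.
  exact: (sqint_conv mG t x mY L2m Yb kn).
have := ito_isometry muE NP nu_moment (measurable_conv mG t x p1) (measurable_conv mG t x p2)
  (st1 t x tT) (st2 t x tT) AB.
rewrite (@eq_sqint _ _ _ P setT _ (fun o => X1' t x o - X2' t x o)); last first.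
  by move=> o _; ring.
move/le_trans; apply; rewrite lee_fin; apply: contraction_constant => //.
by rewrite -/K; exact: scale_small.
Qed.

(** Two fixed points are the images of themselves under the contraction, so their
    distance is smaller than every positive number. *)
Lemma picard_unique X X' m : gmeasurable_fun pred_sets PD (joint X) ->
  gmeasurable_fun pred_sets PD (joint X') -> 0 <= m ->
  L2_bounded_by m X -> L2_bounded_by m X' -> picard_step X X -> picard_step X' X' ->
  forall t x, 0 <= t <= T -> {ae P, forall o, X t x o = X' t x o}.
Proof.
move=> gX gX' m0 Xm Xm' st st' t x tT.
have mX := predictable_measurable_fun gX; have mX' := predictable_measurable_fun gX'.
have [n contr] := picard_contraction.
have iter k q : space_time T q ->
    (sqint P setT (fun o => X q.1 q.2 o - X' q.1 q.2 o)%R <= (8^-1 ^+ k * (4 * m) * expR (n%:R * q.1))%:E)%E.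
  elim: k q => [|k IH] q qT.
    have mq := measurable_at mX qT; have mq' := measurable_at mX' qT.
    have mc (c : R) : measurable_fun [set: Omega] (fun=> c) by exact: measurable_cst.
    have h1 : (sqint P setT (fun o => X q.1 q.2 o - 0)%R <= m%:E)%E.
      by under eq_fun do rewrite subr0; exact: Xm.
    have h2 : (sqint P setT (fun o => 0 - X' q.1 q.2 o)%R <= m%:E)%E.
      by rewrite sqint_subC; under eq_fun do rewrite subr0; exact: Xm'.
    apply: le_trans (sqint_tri_eps measurableT mq (mc 0) mq' h1 h2) _.
    have q0 : 0 <= q.1 by have [/= + _] := qT; rewrite in_itv/= => /andP[].
    rewrite lee_fin expr0 mul1r; apply: le_trans (_ : _ <= 4 * m * 1) _; first lra.
    by rewrite ler_wpM2l ?mulr_ge0// -expR0 ler_expR mulr_ge0.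
  have m8 : 0 <= 8^-1 ^+ k * (4 * m) by rewrite mulr_ge0// ?mulr_ge0// exprn_ge0.
  have := contr X X' X X' _ mX mX' st st' m8 IH q qT.
  by rewrite exprS -!mulrA.
have qT : space_time T (t, x) by split.
have mt := measurable_at mX qT; have mt' := measurable_at mX' qT.
have e0 : sqint P setT (fun o => X t x o - X' t x o) = 0%E.
  apply: sqint_le_all => eps eps0.
  pose K := 4 * m * expR (n%:R * t).
  have K0 : 0 <= K by rewrite !mulr_ge0 ?expR_ge0.
  have K1 : 0 < K + 1 by rewrite ltr_wpDl.
  have [k hk _] := geometric_small (divr_gt0 eps0 K1).
  apply: le_trans (iter k (t, x) qT) _; rewrite lee_fin -mulrA -/K mulrC.
  apply: le_trans (scale_small K0 eps0); exact: ler_wpM2l.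
by have := sqint_ae_eq measurableT mt mt' e0; apply: filterS => o; apply.
Qed.

(** Iterates from 0 converge geometrically fast at every point, hence almost
    surely; the pointwise limit superior of predictable processes is a predictable
    version of the limit, and the isometry passes the equation to the limit. *)
Lemma picard_exists : exists X m, [/\ gmeasurable_fun pred_sets PD (joint X), 0 <= m,
  L2_bounded_by m X & picard_step X X].
Proof.
have [n contr] := picard_contraction.
pose good (Xm : (R -> R -> Omega -> R) * R) := [/\ gmeasurable_fun pred_sets PD (joint Xm.1), 0 <= Xm.2 & L2_bounded_by Xm.2 Xm.1].
have step (A : {Xm | good Xm}) : exists A' : {Xm | good Xm}, picard_step (sval A).1 (sval A').1.
  case: A => -[X m] [/= gX m0 Xm].
  have [X' [m' [gX' m0' Xm' st]]] := picard_step_exists gX m0 Xm.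
  by exists (exist _ (X', m') (And3 gX' m0' Xm')).
have [nxt nxtP] := choice step.
have good0 : good ((fun _ _ _ => 0), 0).
  split => //=.
    exact: (@measurable_cst _ _ (g_sigma_algebraType pred_sets)).
  by move=> q _; rewrite sqint0.
pose A k := iter k nxt (exist _ _ good0).
pose X k := (sval (A k)).1.
have gX k : gmeasurable_fun pred_sets PD (joint (X k)) by rewrite /X; case: (A k) => Y [].
have mX k : measurable_fun PD (joint (X k)) := predictable_measurable_fun (gX k).
have st k : picard_step (X k) (X k.+1) by rewrite /X /A iterS; exact: nxtP.
have X0 t x o : X 0%N t x o = 0 by [].
have [m1 m10 X1m] : exists2 m1, 0 <= m1 & L2_bounded_by m1 (X 1%N).
  by rewrite /X; case: (A 1%N) => -[Y m] /= [_ m0 Ym]; exists m.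
have iterX k q : space_time T q ->
    (sqint P setT (fun o => X k.+1 q.1 q.2 o - X k q.1 q.2 o)%R <= (8^-1 ^+ k * m1 * expR (n%:R * q.1))%:E)%E.
  elim: k q => [|k IH] q qT.
    rewrite (@eq_sqint _ _ _ P setT _ (X 1%N q.1 q.2)); last by move=> o _; rewrite X0 subr0.
    apply: le_trans (X1m q qT) _.
    have q0 : 0 <= q.1 by have [/= + _] := qT; rewrite in_itv/= => /andP[].
    rewrite lee_fin expr0 mul1r -[leLHS]mulr1.
    by rewrite ler_wpM2l// -expR0 ler_expR mulr_ge0.
  have m8 : 0 <= 8^-1 ^+ k * m1 by rewrite mulr_ge0// exprn_ge0.
  have := contr _ _ _ _ _ (mX k.+1) (mX k) (st k.+1) (st k) m8 IH q qT.
  by rewrite exprS -!mulrA.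
pose C := m1 * expR (n%:R * T).
have C0 : 0 <= C by rewrite mulr_ge0// expR_ge0.
have stepC k q : space_time T q ->
    (sqint P setT (fun o => X k.+1 q.1 q.2 o - X k q.1 q.2 o)%R <= (C * 8^-1 ^+ k)%:E)%E.
  move=> qT; apply: le_trans (iterX k q qT) _; rewrite lee_fin /C.
  have qT' : q.1 <= T by have [/= + _] := qT; rewrite in_itv/= => /andP[].
  by apply: decay_le => //; rewrite ?exprn_ge0// ler_expR ler_wpM2l.
pose Y t x o := rlimsup (fun k => X k t x o).
have gY : gmeasurable_fun pred_sets PD (joint Y).
  exact: (@measurable_rlimsup _ (g_sigma_algebraType pred_sets) R PD (fun k => joint (X k))).
have mY := predictable_measurable_fun gY.
have close k q : space_time T q ->
    (sqint P setT (fun o => X k q.1 q.2 o - Y q.1 q.2 o)%R <= (4 * C * 8^-1 ^+ k)%:E)%E.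
  move=> qT; rewrite sqint_subC.
  have [_ h] := L2_complete (fun k => measurable_at (mX k) qT) (fun k => stepC k q qT).
  exact: h.
exists Y, (4 * C); split => //; first by rewrite mulr_ge0.
  move=> q qT; have := close 0%N q qT; rewrite sqint_subC expr0 mulr1.
  by rewrite (@eq_sqint _ _ _ P setT _ (Y q.1 q.2))// => o _; rewrite X0 subr0.
move=> t x tT.
have qT : space_time T (t, x) by split.
have mXt k := measurable_at (mX k) qT; have mYt := measurable_at mY qT.
have mc : measurable_fun [set: Omega] (fun=> w t x) by exact: measurable_cst.
have pY := measurable_phi mY.
apply: (integral_of_lim (measurable_jump_domain T)
   (admissible_elementary muE (nonanticipating_noise muE NP nu_moment))).
- exact: measurable_funB.
- by apply: measurable_jump_integrand; exact: measurable_conv.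
move=> eps eps0.
have v0 : 0 <= v := jump_variance_ge0 nu.
pose K := v * (L ^+ 2 * (4 * C) * kernel_norm T G) + 4 * C.
have C4 : 0 <= 4 * C by rewrite mulr_ge0.
have K0' : 0 <= v * (L ^+ 2 * (4 * C) * kernel_norm T G).
  apply: mulr_ge0 => //; apply: mulr_ge0; last exact: kernel_norm_ge0.
  by apply: mulr_ge0; [exact: sqr_ge0|exact: C4].
have K0 : 0 <= K by rewrite addr_ge0.
have K1 : 0 < K + 1 by rewrite ltr_wpDl.
have [k hk _] := geometric_small (divr_gt0 eps0 K1).
have e8 : 0 <= 8^-1 ^+ k :> R by rewrite exprn_ge0.
have Keps : K * 8^-1 ^+ k <= eps.
  by apply: le_trans (scale_small K0 eps0); apply: ler_wpM2l.
exists (jump_integrand (cnv t x (phi (X k)))), (fun o => X k.+1 t x o - w t x); split.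
- exact: st.
- have pX := measurable_phi (mX k).
  rewrite (@eq_sqint _ _ _ _ _ _ (fun z => jump_integrand (cnv t x (fun p => phi (X k) p - phi Y p)) z.1 z.2)); last first.
    by move=> z _; rewrite /jump_integrand /conv; ring.
  rewrite (sqint_jump_integrand P muE nu_moment); last first.
    by apply: measurable_conv => //; exact: measurable_funB.
  have mdiff : measurable_fun PD (fun p => phi (X k) p - phi Y p) by exact: measurable_funB.
  have m0 : 0 <= L ^+ 2 * (4 * C * 8^-1 ^+ k) by apply: mulr_ge0; [exact: sqr_ge0|exact: mulr_ge0].
  have b1 := sqint_conv_bound mG finG t x mdiff m0 (fun q qT => sqint_phi_diff (mX k) mY qT (close k q qT)).
  apply: le_trans (lee_wpmul2l _ b1) _; first by rewrite lee_fin.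
  rewrite -EFinM lee_fin; apply: le_trans Keps; rewrite /K [leRHS]mulrDl.
  apply: (@le_trans _ _ (v * (L ^+ 2 * (4 * C) * kernel_norm T G) * 8^-1 ^+ k)); last by rewrite lerDl; exact: mulr_ge0.
  by apply: eq_ler; ring.
- rewrite (@eq_sqint _ _ _ P setT _ (fun o => X k.+1 t x o - Y t x o)); last first.
    by move=> o _; ring.
  apply: le_trans (close k.+1 (t, x) qT) _; rewrite lee_fin; apply: le_trans Keps.
  rewrite /K [leRHS]mulrDl; apply: (@le_trans _ _ (4 * C * 8^-1 ^+ k)); last by rewrite lerDr; exact: mulr_ge0.
  rewrite exprS; apply: ler_wpM2l => //; by rewrite ler_piMl// invf_le1// ler1n.
Qed.

(** The L2 modulus of continuity of a solution is that of its stochastic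
    part, a convolution. *)
Lemma solution_modulus X m : measurable_fun PD (joint X) -> 0 <= m ->
  L2_bounded_by m X -> picard_step X X -> forall eps : R, 0 < eps -> exists2 h : R, 0 < h &
  forall t x t' x', 0 <= t <= T -> 0 <= t' <= T -> `|t - t'| <= h -> `|x - x'| <= h ->
    (sqint P setT (fun o => (X t x o - w t x) - (X t' x' o - w t' x'))%R <= eps%:E)%E.
Proof.
move=> mX m0 Xm st eps eps0.
have [h h0 hm] := convolution_modulus muE NP nu_moment mG finG (measurable_phi mX) (phi_bound_ge0 m0)
  (fun q => sqint_phi mX Xm) eps0.
by exists h => // t x t' x' tT tT'; apply: hm; exact: st.
Qed.

End picard_iteration.

(** * Mild solutions as fixed points *)

Section open_sets_of_the_plane.
Context {R : realType}.
Local Notation Rm := (measurableTypeR R).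

(** The Borel structure of the plane used here is the product one, while
    continuity refers to the product topology: an open set is a countable union of
    squares with rational centers and radii 1/(n+1). *)
Lemma open_plane_measurable (V : set (R * R)) : open V -> measurable (V : set (Rm * Rm)).
Proof.
move=> oV.
have around (r x a : R) : x - r < a -> a < x -> a - r < x < a + r.
  by move=> h1 h2; apply/andP; split; lra.
have near_center (r e x a x' : R) : x - r < a -> a < x -> a - r < x' -> x' < a + r -> r < e / 2 ->
    ball x e x'.
  by move=> h1 h2 h3 h4 h5; rewrite /ball/= ltr_norml; apply/andP; split; lra.
pose box (n : nat) (a b : rat) : set (Rm * Rm) :=
  `]ratr a - n.+1%:R^-1, ratr a + n.+1%:R^-1[%classic `*` `]ratr b - n.+1%:R^-1, ratr b + n.+1%:R^-1[%classic.
have -> : V = \bigcup_n \bigcup_a \bigcup_b (if `[< box n a b `<=` V >] then box n a b else set0).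
  apply/seteqP; split => -[x y]; last first.
    by move=> [n _ [a _ [b _]]]; case: asboolP => // sub; exact: sub.
  move=> Vxy; have /nbhs_ballP[e /= e0 eV] := open_nbhs_nbhs (conj oV Vxy).
  have e2 : 0 < e / 2 by rewrite divr_gt0.
  have [n ne] : exists n, n.+1%:R^-1 < e / 2.
    by apply: (@filter_ex _ \oo); exact: (near_infty_natSinv_lt (PosNum e2)).
  have n0 : 0 < n.+1%:R^-1 :> R by rewrite invr_gt0.
  have [a] : exists a, ratr a \in `]x - n.+1%:R^-1, x[ by apply: rat_in_itvoo; rewrite ltrBlDr ltrDl.
  have [b] : exists b, ratr b \in `]y - n.+1%:R^-1, y[ by apply: rat_in_itvoo; rewrite ltrBlDr ltrDl.
  rewrite !in_itv/= => /andP[b1 b2] /andP[a1 a2].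
  exists n => //; exists a => //; exists b => //; rewrite asboolT.
    by split => /=; rewrite in_itv/=; exact: around.
  move=> [x' y'] [/=]; rewrite !in_itv/= => /andP[h1 h2] /andP[h3 h4]; apply: eV.
  by split; [exact: near_center a1 a2 h1 h2 ne|exact: near_center b1 b2 h3 h4 ne].
apply: bigcupT_measurable => n; apply: bigcupT_measurable_rat => a; apply: bigcupT_measurable_rat => b.
by case: ifP => // _; apply: measurableX; exact: measurable_itv.
Qed.

Lemma continuous_within_plane_measurable (D : set (R * R)) (f : R * R -> R) :
  measurable (D : set (Rm * Rm)) -> {within D, continuous f} ->
  measurable_fun (D : set (Rm * Rm)) f.
Proof.
move=> mD /continuousP cf; apply: (measurability _ (RGenOInfty.measurableE R)) => _ [_ [c ->] <-].
have oc : open (`]c, +oo[%classic : set R) by exact: interval_open.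
have /open_subspaceP[V oV VD] := cf _ oc.
rewrite setIC -VD; apply: measurableI => //; exact: open_plane_measurable.
Qed.

End open_sets_of_the_plane.

Section L2_norms.
Context {R : realType} {d : measure_display} {Omega : measurableType d}.
Variable P : probability Omega R.

Lemma expectation_square (f : Omega -> R) :
  ('E_P[(fun o => `|f o| ^+ 2)%R] = sqint P setT f)%E.
Proof. by rewrite unlock; apply: eq_integral => o _; rewrite real_normK ?num_real. Qed.

Lemma Lnorm2_le (f : Omega -> R) (e : R) : 0 <= e -> (sqint P setT f <= (e ^+ 2)%:E)%E ->
  ('N[P]_(2%:E)[(fun o => (f o)%:E)] <= e%:E)%E.
Proof.
move=> e0 fe.
have n0 : 2 != 0 :> R by rewrite pnatr_eq0.
have h : ('N[P]_(2%:E)[(fun o => (f o)%:E)] `^ 2 <= e%:E `^ 2)%E.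
  rewrite poweR_Lnorm// poweR_EFin powR_mulrn//; apply: le_trans fe; apply: eq_lee.
  apply: eq_integral => o _; rewrite abse_EFin poweR_EFin powR_mulrn//.
  by rewrite real_normK// num_real.
have i0 : 0 <= 2^-1 :> R by rewrite invr_ge0.
have b1 (y : \bar R) : (y `^ 2)%E \in `[0%E, +oo%E].
  by rewrite in_itv/= leey andbT; exact: poweR_ge0.
have := gt0_ler_poweR i0 (b1 _) (b1 _) h.
by rewrite -!poweRrM mulfV// !poweRe1 ?lee_fin ?Lnorm_ge0.
Qed.

Lemma cvge0_near {X : Type} (F : set_system X) {FF : Filter F} (f : X -> \bar R) :
  (forall x, 0 <= f x)%E -> (forall eps : R, 0 < eps -> \forall x \near F, (f x <= eps%:E)%E) ->
  f x @[x --> F] --> 0%E.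
Proof.
move=> f0 fe; apply/fine_cvgP; split.
  apply: filterS (fe 1 ltr01) => x fx; rewrite ge0_fin_numE//.
  exact: le_lt_trans fx (ltry _).
apply/cvgrPdist_le => eps eps0; apply: filterS (fe _ eps0) => x fx.
rewrite sub0r normrN ger0_norm ?fine_ge0//.
have ffin : f x \is a fin_num by rewrite ge0_fin_numE//; exact: le_lt_trans fx (ltry _).
by rewrite -lee_fin fineK.
Qed.

End L2_norms.

Lemma sqint_process {R : realType} {d : measure_display} {Omega : measurableType d}
  (P : probability Omega R) (T : R) (X : Omega * (measurableTypeR R * measurableTypeR R) -> R) :
  measurable_fun (setT `*` space_time T) X ->
  sqint (process_measure P) (setT `*` space_time T) X =
  (\int[P]_o \int[area]_(q in space_time T) (X (o, q) ^+ 2)%:E)%E.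
Proof.
move=> mX; rewrite /sqint.
apply: (@tonelli_rectangle _ _ _ _ _ P (@planar R) setT (space_time T) (fun z => (X z ^+ 2)%:E)) => //.
- exact: measurable_space_time.
- exact: measurable_sq.
- by move=> z; rewrite lee_fin sqr_ge0.
Qed.

Section equivalence_with_fixed_points.
Context {R : realType} {d : measure_display} {Omega : measurableType d}.
Local Notation Rm := (measurableTypeR R).
Local Notation E := (Rm * (Rm * Rm))%type.
Local Notation S := (Omega * (Rm * Rm))%type.
Variables (P : probability Omega R) (T : R) (nu : {sigma_finite_measure set Rm -> \bar R}).
Variable N : R.-ker Omega ~> E.
Variable mu : {sigma_finite_measure set E -> \bar R}.
Hypothesis T_gt0 : 0 < T.
Hypothesis muE : forall A, measurable A -> intensity nu A = mu A.
Hypothesis NP : poisson_random_measure P T nu N.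
Hypothesis nu_moment : finite_second_moment nu.
Local Notation pred_sets := (predictable_sets P T nu N).
Local Notation M := (process_measure P).
Local Notation ito := (ito P T nu N mu).

Let PD : set S := setT `*` space_time T.
Let mPD : measurable PD.
Proof. by apply: measurableX => //; exact: measurable_space_time. Qed.

Variables (w G : R -> R -> R) (sigma : R -> R) (L W : R).
Hypothesis mG : measurable_fun (space_time T) (fun q : Rm * Rm => G q.1 q.2).
Hypothesis finG : (\int[area]_(q in space_time T) (G q.1 q.2 ^+ 2)%:E < +oo)%E.
Hypothesis mw : measurable_fun (space_time T) (fun q : Rm * Rm => w q.1 q.2).
Hypothesis wW : forall q, space_time T q -> `|w q.1 q.2| <= W.
Hypothesis msigma : measurable_fun setT sigma.
Hypothesis sigmaL : forall a b, `|sigma a - sigma b| <= `|L * (a - b)|.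

Local Notation cnv := (conv T G).
Local Notation step := (picard_step P T nu N mu w G sigma).

Definition mild_integrand (u : R -> R -> Omega -> R) (t x s y : R) (o : Omega) : R :=
  \1_(`[0, t]%classic : set R) s * (G (t - s) (x - y) * sigma (u s y o)).

(** For s in [0, t] the point t - s lies in [0, T], so the cut-off of the kernel
    and the indicator of [0, t] agree. *)
Lemma mild_integrandE u t x p : 0 <= t <= T -> PD p ->
  joint (mild_integrand u t x) p = cnv t x (phi sigma u) p.
Proof.
move=> /andP[t0 tT] [_ [/= + _]]; rewrite in_itv/= => /andP[s0 sT].
rewrite /joint /mild_integrand /conv /shifted /kernel patchE indicE mulrA; congr (_ * _).
have [st|ts] := leP p.2.1 t.
  rewrite mem_set ?mul1r/= ?in_itv/= ?s0// mem_set//; split => //=.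
  by rewrite in_itv/= subr_ge0 st lerBlDr (le_trans tT)// lerDl.
have -> : (p.2.1 \in `[0, t]%classic) = false by apply: memNset; rewrite /= in_itv/= [_ <= t]leNgt ts andbF.
rewrite mul0r.
rewrite memNset// => -[/= + _]; rewrite in_itv/= subr_ge0 leNgt ts //.
Qed.

Let naF := nonanticipating_noise muE NP nu_moment.

(** Boundedness in L2 supplies the square integrability that is part of the
    definition of the Ito integral. *)
Lemma ito_integralP u t x I m : gmeasurable_fun pred_sets PD (joint u) -> 0 <= m ->
  L2_bounded_by P T m u -> 0 <= t <= T ->
  ito_integral P T nu N (mild_integrand u t x) I <-> ito (cnv t x (phi sigma u)) I.
Proof.
move=> gu m0 um tT; have mu_ := predictable_measurable_fun gu.
have mphi := measurable_phi msigma mu_.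
have gc := predictable_conv T_gt0 mG t x (predictable_phi msigma gu).
have mc := measurable_conv mG t x mphi.
have eqD : {in PD, cnv t x (phi sigma u) =1 joint (mild_integrand u t x)}.
  by move=> p /set_mem pD; rewrite mild_integrandE.
have ga : gmeasurable_fun pred_sets PD (joint (mild_integrand u t x)).
  by apply: (@eq_measurable_fun _ _ (g_sigma_algebraType pred_sets) _ _ _ _ eqD).
have ma := predictable_measurable_fun ga.
have mH := measurable_jump_integrand ma.
have cP := compensated_integralP muE I naF mH.
have ae_refl : measurable_fun setT I -> {ae P, forall o, I o = I o} by move=> _; exact: aeW.
split.
  move=> [_ _ /cP HI]; have [mI _ _] := HI.
  apply: (ito_ae muE NP nu_moment mc _ mI (ae_refl mI) HI) => p pD _.
  exact: mild_integrandE.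
move=> HI; have mI := ito_measurable HI; split.
- exact/predictableP.
- have b := sqint_conv_bound mG finG t x mphi (phi_bound_ge0 sigma L m0) (fun q => sqint_phi msigma sigmaL mu_ um).
  apply: le_lt_trans (le_lt_trans b (ltry _)); apply: eq_lee.
  transitivity (sqint M PD (joint (mild_integrand u t x))).
    rewrite (sqint_process P ma); apply: eq_integral => o _; apply: eq_integral => q _.
    by rewrite real_normK// num_real.
  by apply: eq_sqint => p /eqD.
- apply/cP; apply: (ito_ae muE NP nu_moment ma _ mI (ae_refl mI) HI) => p pD _.
  by rewrite mild_integrandE.
Qed.

(** A version that is almost surely equal to an integral is itself one, so the
    equation may be stated for u - w. *)
Lemma regular_solution_fixed u : regular_solution P T nu N w G sigma u ->
  [/\ gmeasurable_fun pred_sets PD (joint u), exists2 m, 0 <= m & L2_bounded_by P T m u & step u u].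
Proof.
move=> [[pu su] _ bu]; have gu := (predictableP P T nu N u).1 pu.
have mu_ := predictable_measurable_fun gu.
have [m m0 um] : exists2 m, 0 <= m & L2_bounded_by P T m u.
  have ub q : space_time T q -> (sqint P setT (u q.1 q.2) <= ereal_sup [set ('E_P[(fun o => `|u q.1 q.2 o| ^+ 2)%R])%E | q in space_time T])%E.
    by move=> qT; rewrite -expectation_square; apply: ereal_sup_ubound; exists q.
  have q0 : space_time T (0, 0) by split => //=; rewrite in_itv/= lexx ltW.
  have s0 := le_trans (sqint_ge0 P setT (u 0 0)) (ub _ q0).
  exists (fine (ereal_sup [set ('E_P[(fun o => `|u q.1 q.2 o| ^+ 2)%R])%E | q in space_time T])); first exact: fine_ge0.
  by move=> q qT; rewrite fineK ?ge0_fin_numE//; exact: ub.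
split => //; first by exists m.
move=> t x tT; have [I HI uI] := su t x tT.
have qT : space_time T (t, x) by split.
have /(ito_integralP x I gu m0 um tT) HI' := HI.
have mut := measurable_at mu_ qT.
apply: (ito_ae muE NP nu_moment (measurable_conv mG t x (measurable_phi msigma mu_)) _ _ _ HI') => //.
- by apply: measurable_funB => //; exact: measurable_cst.
- by apply: filterS uI => o ->; rewrite addrAC subrr add0r.
Qed.

Hypothesis cw : {within space_time T, continuous (fun q : R * R => w q.1 q.2)}.

(** Continuity of u is that of w, which is deterministic, together with the modulus
    of the stochastic part. *)
Lemma fixed_regular_solution u m : gmeasurable_fun pred_sets PD (joint u) -> 0 <= m ->
  L2_bounded_by P T m u -> step u u -> regular_solution P T nu N w G sigma u.
Proof.
move=> gu m0 um st; have mu_ := predictable_measurable_fun gu.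
split.
- split; first exact/predictableP.
  move=> t x tT; exists (fun o => u t x o - w t x).
    by apply/(ito_integralP x _ gu m0 um tT); exact: st.
  by apply: aeW => o; rewrite addrCA subrr addr0.
- split.
    move=> t x tT; have qT : space_time T (t, x) by split.
    have mut := measurable_at mu_ qT.
    apply/andP; rewrite !inE; split => //.
    rewrite /finite_norm; apply: (@le_lt_trans _ _ (m + 1)%:E); last exact: ltry.
    apply: Lnorm2_le; first by rewrite addr_ge0.
    apply: le_trans (um _ qT) _; rewrite lee_fin sqrrD1; nra.
  move=> p pT.
  apply: cvge0_near => [q|eps eps0]; first exact: Lnorm_ge0.
  have e4 : 0 < eps ^+ 2 / 4 by rewrite divr_gt0// exprn_gt0.
  have e2 : 0 < eps / 2 by rewrite divr_gt0.
  have [h h0 hm] := solution_modulus muE NP nu_moment mG finG msigma sigmaL mu_ m0 um st e4.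
  have wp : (fun q : R * R => w q.1 q.2) @ within (space_time T) (nbhs p) --> w p.1 p.2.
    by move/subspace_continuousP : cw; exact.
  have /cvgrPdist_le/(_ _ e2) wn := wp.
  have n1 : \forall q \near within (space_time T) (nbhs p), space_time T q by exact: withinT.
  have n2 : \forall q \near within (space_time T) (nbhs p), `|q.1 - p.1| <= h /\ `|q.2 - p.2| <= h.
    apply: cvg_within; apply/nbhs_ballP; exists h => //= q [/= q1 q2].
    by split; rewrite distrC ltW.
  near=> q.
  have qT : space_time T q by near: q.
  have [h1 h2] : `|q.1 - p.1| <= h /\ `|q.2 - p.2| <= h by near: q.
  have wq : `|w p.1 p.2 - w q.1 q.2| <= eps / 2 by near: q.
  have mq := measurable_at mu_ qT; have mp := measurable_at mu_ pT.
  have [qT1 pT1] : 0 <= q.1 <= T /\ 0 <= p.1 <= T.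
    by case: qT pT => /= + _ [/= + _]; rewrite !in_itv.
  apply: Lnorm2_le; first exact: ltW.
  have s1 := hm q.1 q.2 p.1 p.2 qT1 pT1 h1 h2.
  have mc (c : R) : measurable_fun [set: Omega] (fun=> c) by exact: measurable_cst.
  rewrite (@eq_sqint _ _ _ P setT _ (fun o => ((u q.1 q.2 o - w q.1 q.2) - (u p.1 p.2 o - w p.1 p.2)) + (w q.1 q.2 - w p.1 p.2))); last first.
    by move=> o _; ring.
  apply: le_trans (sqintD _ _ _ _) _ => //.
    by apply: measurable_funB; exact: measurable_funB.
  rewrite (sqint_cst P (w q.1 q.2 - w p.1 p.2)).
  apply: (@le_trans _ _ (2%:E * (eps ^+ 2 / 4)%:E + 2%:E * ((eps / 2) ^+ 2)%:E)%E).
    apply: leeD; apply: lee_wpmul2l => //.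
    rewrite lee_fin -real_normK ?num_real// distrC lerXn2r// nnegrE ltW//.
  rewrite -!EFinM -EFinD lee_fin; apply: eq_ler; by field.
- apply: (@le_lt_trans _ _ m%:E); last exact: ltry.
  by apply: ge_ereal_sup => _ [q qT <-]; rewrite expectation_square; exact: um.
Unshelve. all: by end_near. Qed.

End equivalence_with_fixed_points.

(** * Existence and uniqueness *)

Theorem theorem3p1 (R : realType) (d : measure_display)
    (Omega : measurableType d) (P : probability Omega R)
    (T : R) (nu : {measure set (measurableTypeR R) -> \bar R})
    (N : R.-ker Omega ~>
           (measurableTypeR R * (measurableTypeR R * measurableTypeR R))%type)
    (w G : R -> R -> R) (sigma : R -> R)
    (T_gt0 : 0 < T)
    (P_complete : measure_is_complete P)
    (nu_levy : levy_measure nu)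
    (nu_moment : finite_second_moment nu)
    (N_poisson : poisson_random_measure P T nu N)
    (sigma_lipschitz : lipschitz sigma)
    (H1 : hypothesis_H1 T w)
    (H2 : hypothesis_H2 T G) :
  (exists u : R -> R -> Omega -> R, regular_solution P T nu N w G sigma u) /\
  (forall u u' : R -> R -> Omega -> R,
     regular_solution P T nu N w G sigma u ->
     regular_solution P T nu N w G sigma u' ->
     forall t x, 0 <= t <= T -> {ae P, forall o, u t x o = u' t x o}).
Proof.
(* The second moment makes a Levy measure sigma-finite, so that the intensity is a
   product to which Tonelli's theorem applies. *)
have sf := levy_sigma_finite nu_moment nu_levy.
move: nu_moment N_poisson; rewrite (sigma_finite_copyE sf).
set nu' : {sigma_finite_measure set (measurableTypeR R) -> \bar R} := sigma_finite_copy sf.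
move=> moment poisson.
have muE A : measurable A -> intensity nu' A = jump_measure nu' A := @intensityE R nu' A.
have [cw bw] := H1; have [W wW] := (bounded_onP _ _).1 bw.
have mw := continuous_within_plane_measurable (measurable_space_time T) cw.
have [[mG finG] _ _ _] := H2.
(* The filter form of the Lipschitz condition holds for all large constants. *)
have [L sigmaL] : exists L : R, forall a b, `|sigma a - sigma b| <= `|L * (a - b)|.
  move: sigma_lipschitz => [M0 [_ HM]]; have HM1 := HM (M0 + 1) ltac:(by rewrite ltrDl).
  exists (M0 + 1) => a b; apply: le_trans (HM1 (a, b) _) _ => //.
  by rewrite normrM /= ler_wpM2r// ler_norm.
have msigma : measurable_fun setT sigma.
  apply: continuous_measurable_fun => a; apply/cvgrPdist_le => eps eps0.
  have L1 : 0 < `|L| + 1 by rewrite ltr_wpDl.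
  near=> b; apply: le_trans (sigmaL a b) _; rewrite normrM.
  apply: le_trans (scale_small (normr_ge0 L) eps0); apply: ler_wpM2l => //.
  near: b; apply: cvgr_dist_le; [exact: cvg_id|exact: divr_gt0].
split.
  have [u [m [gu m0 um st]]] := picard_exists T_gt0 muE poisson moment mG finG mw wW msigma sigmaL.
  by exists u; exact: (fixed_regular_solution T_gt0 muE poisson moment mG finG msigma sigmaL cw gu m0 um st).
move=> u u' ru ru' t x tT.
have [gu [m m0 um] su] := regular_solution_fixed T_gt0 muE poisson moment mG finG msigma sigmaL ru.
have [gu' [m' m0' um'] su'] := regular_solution_fixed T_gt0 muE poisson moment mG finG msigma sigmaL ru'.
have mm : 0 <= Num.max m m' by rewrite le_max m0.
apply: (picard_unique muE poisson moment mG finG msigma sigmaL gu gu' mm _ _ su su' x tT).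
- by move=> q qT; apply: le_trans (um q qT) _; rewrite lee_fin le_max lexx.
- by move=> q qT; apply: le_trans (um' q qT) _; rewrite lee_fin le_max lexx orbT.
Unshelve. all: by end_near. Qed.
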